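(* There exist numerical constants $c_0,C>0$ such that the following holds. Let $d,m,n$ be positive integers and $\delta\in(0,1)$, and assume $$m\wedge n\ge c_0\big(d\log d+\log(1/\delta)\big)\quad\text{and}\quad mn\ge c_0\,d\,\big(d\log d+\log(1/\delta)\big)\big(d+\log(1/\delta)\big).$$ Then for every $\pi^\star\in S_d$ and every positive definite $\Sigma\in\mathbb{R}^{d\times d}$ with $\|\Sigma\|_{\mathrm{op}}\le1$, with probability at least $1-\delta$, $$\big\|\Sigma^{\widehat\pi^{\mathsf{QMLE}}}-\Sigma^{\pi^\star}\big\|_{\mathrm F}^2\le C\left(\frac{d\log d+\log(1/\delta)}{m\wedge n}+\sqrt{\frac{d\,(d\log d+\log(1/\delta))(d+\log(1/\delta))}{mn}}\right).$$
   Context: $S_d$ is the set of permutations of $\{1,\dots,d\}$. For $A\in\mathbb{R}^{d\times d}$ and $\pi\in S_d$, $(A^\pi)_{i,j}=A_{\pi(i),\pi(j)}$. $\langle A,B\rangle=\mathrm{Tr}(AB^\top)$; $\|\cdot\|_{\mathrm F}$ and $\|\cdot\|_{\mathrm{op}}$ are the Frobenius and operator norms; $a\wedge b=\min(a,b)$. Covariance alignment model: $\Sigma\succ0$ is an unknown $d\times d$ covariance matrix and $\pi^\star\in S_d$ an unknown permutation. One observes $X_1,\dots,X_m$ i.i.d. from $\mathcal N(0,\Sigma)$ and $Y_1,\dots,Y_n$ i.i.d. from $\mathcal N(0,\Sigma^{\pi^\star})$, the two samples being independent. Put $\widehat\Sigma_X=\frac1m\sum_{i=1}^mX_iX_i^\top$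 and $\widehat\Sigma_Y=\frac1n\sum_{i=1}^nY_iY_i^\top$. Quasi maximum likelihood estimator: $\widehat\pi^{\mathsf{QMLE}}\in\arg\min_{\pi\in S_d}\langle\widehat\Sigma_Y,(\widehat\Sigma_X^{\pi})^{-1}\rangle$ (any minimizer; $\widehat\Sigma_X$ is almost surely invertible when $m\ge d$). *)

(* Defs.v *)
From HB Require Import structures.
From mathcomp Require Import all_boot all_order all_algebra all_fingroup.
From mathcomp Require Import all_classical all_reals all_analysis.

Set Implicit Arguments.
Unset Strict Implicit.
Unset Printing Implicit Defensive.

Import Order.TTheory GRing.Theory Num.Theory.

Local Open Scope classical_set_scope.
Local Open Scope ring_scope.

Section Matrices.
Context {R : realType}.

Definition perm_conj d (p : 'S_d) (A : 'M[R]_d) : 'M[R]_d :=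
  \matrix_(i, j) A (p i) (p j).

Definition mx_inner m n (A B : 'M[R]_(m, n)) : R := \tr (A *m B^T).

(* On column vectors this is the Euclidean norm. *)
Definition frob_norm m n (A : 'M[R]_(m, n)) : R := Num.sqrt (mx_inner A A).

Definition op_norm m n (A : 'M[R]_(m, n)) : R :=
  sup [set frob_norm (A *m x) | x in [set x : 'cV[R]_n | frob_norm x <= 1]].

Definition posdef d (A : 'M[R]_d) : Prop :=
  A^T = A /\ forall x : 'cV[R]_d, x != 0 -> 0 < (x^T *m A *m x) 0 0.

End Matrices.

Section Probability.
Context {disp : measure_display} {T : measurableType disp} {R : realType}.
Variable P : probability T R.

Definition mutually_independent disp' (T' : measurableType disp') (I : finType)
    (X : I -> {RV P >-> T'}) : Prop :=
  forall (J : {set I}) (B : I -> set T'), (forall i, measurable (B i)) ->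
    P (\bigcap_(i in [set` J]) X i @^-1` B i) =
    (\prod_(i in J) fine (P (X i @^-1` B i)))%:E.

(* Inner probability: on a measurable event E this says p <= P E, and it stays
   meaningful when E involves a possibly non-measurable selection. *)
Definition with_prob_ge (p : R) (E : set T) : Prop :=
  exists2 A : set T, measurable A & A `<=` E /\ (p%:E <= P A)%E.

(* Random vectors take values in d.-tuple R, which carries the product of the
   Borel sigma-algebras. *)
Definition col_of_tuple d (t : d.-tuple R) : 'cV[R]_d := \col_k tnth t k.

(* X ~ N(0, S) for a positive definite S: X is A Z with A A^T = S and Z a
   standard Gaussian vector. As A is then invertible, Z = A^-1 X lives on the
   same space as X and the condition only depends on the law of X. *)
Definition gaussian_vector d (S : 'M[R]_d) (X : {RV P >-> d.-tuple R}) : Prop :=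
  exists (A : 'M[R]_d) (Z : 'I_d -> {RV P >-> R}),
    [/\ A *m A^T = S,
        mutually_independent Z,
        forall k (B : set R), measurable B ->
          distribution P (Z k) B = normal_prob 0 1 B
      & forall w : T, col_of_tuple (X w) = A *m \col_k Z k w].

Definition sum_family (I J : Type) (U : Type) (X : I -> U) (Y : J -> U)
    (s : I + J) : U :=
  match s with inl i => X i | inr j => Y j end.

(* Independence of the joint family encodes both that each sample is made of
   independent vectors and that the two samples are independent. *)
Definition covariance_alignment_model d m n (S : 'M[R]_d) (pstar : 'S_d)
    (X : 'I_m -> {RV P >-> d.-tuple R})
    (Y : 'I_n -> {RV P >-> d.-tuple R}) : Prop :=
  [/\ mutually_independent (sum_family X Y),
      forall i, gaussian_vector S (X i)
    & forall j, gaussian_vector (perm_conj pstar S) (Y j)].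

Definition sample_cov d m (X : 'I_m -> {RV P >-> d.-tuple R}) (w : T) :
    'M[R]_d :=
  m%:R^-1 *: \sum_(i < m) col_of_tuple (X i w) *m (col_of_tuple (X i w))^T.

End Probability.

Definition qmle_objective {R : realType} d (SX SY : 'M[R]_d) (p : 'S_d) : R :=
  mx_inner SY (invmx (perm_conj p SX)).

Definition is_qmle {R : realType} d (SX SY : 'M[R]_d) (p : 'S_d) : Prop :=
  forall q : 'S_d, qmle_objective SX SY p <= qmle_objective SX SY q.

(* Main.v *)
Require Import Defs.
From HB Require Import structures.
From mathcomp Require Import all_boot all_order all_algebra all_fingroup.
From mathcomp Require Import all_classical all_reals all_analysis.
From mathcomp Require Import measurable_realfun.
From mathcomp Require Import ring lra.

(** Write [Sigma = A A^T]. In the coordinates whitened by [A] the two samples are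
    independent standard Gaussian matrices, with sample covariances [W] and [W'],
    and choosing the labelling [p] instead of the true one [q] amounts to the
    matrix [G = A^-1 P_p^T P_q A], of determinant [1] or [-1]. Put
    [K = G G^T - 1], [V = W^-1] and [N = G^T V G - V]. Optimality of the
    estimator says [<N, W'> <= 0] ([qmle_excess]), and [tr N = <K, V>].

    Everything is measured by the distortion [D = tr K]. Let [G = L U] with [L]
    the Cholesky factor of [G G^T] and [U] orthogonal. The diagonal of [L] has
    product one, so its sum is at least [d], which yields [|L - 1|_F^2 <= D]
    ([near_orthogonal_factor]). Hence [|K|_F] is of order [sqrt D], [|N|_F] is of
    order [sqrt D + |V - 1|_F], and the loss, which is [|A K A^T|_F^2], is at
    most [4 D]: as [A] and [A G] both have operator norm at most one, the
    condition number of [Sigma] does not enter ([distortion_loss]).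

    If [<K, V>] and [<N, W'>] were equal to [tr K] and [tr N], optimality would
    give [D <= 0]. With [y] of order [d ln d + ln (1 / delta)] and with high
    probability, simultaneously for the [d!] labellings,
      [<K, V> >= tr K / 5 - |K|_F sqrt (768 y / m)], and
      [<N, W'> >= tr N / 5 - |N|_F sqrt (768 y / n)] when [tr N >= 0]
    ([wishart_lower_inverse], and [wishart_lower_linear] with the first sample
    held fixed). Together these form a quadratic inequality in [sqrt D]
    ([distortion_bound]). Its solution is the sum of the parametric term and of
    the product of [sqrt (y / n)] with [|V - 1|_F], which is of order
    [sqrt (d (d + ln (1 / delta)) / m)] ([frob_wishart_tail]): this product is the
    second term of the rate.

    The lower deviations rest on two ideas. First, a functional of a Gaussian
    matrix is compared at two independent points by moving from one to the other
    along a quarter circle ([chain_concentration]); this localizes well to the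
    event that [W] is near the identity, outside of which the inverse is not
    smooth. Secondly, such a comparison does not say around which level the
    functional concentrates; signed cyclic shifts of the coordinates preserve the
    Gaussian law, and the average of [<K, V>] over them is [tr K tr V / d],
    which is at least [tr K / 5] ([lower_deviation]). The good event itself is
    controlled by a finite grid and chi-square tails ([grid_net],
    [good_fail_le]). *)

Set Implicit Arguments.
Unset Strict Implicit.
Unset Printing Implicit Defensive.

Import Order.TTheory GRing.Theory Num.Theory.
Import numFieldNormedType.Exports.

Local Open Scope classical_set_scope.
Local Open Scope ring_scope.

(** * Measurable sets and finite products *)

Section MeasurableSets.
Context disp (T : measurableType disp) (R : realType).
Implicit Types f g : T -> R.

Lemma measurable_preimageT disp' (U : measurableType disp') (h : T -> U) A :
  measurable_fun setT h -> measurable A -> measurable (h @^-1` A).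
Proof. by move=> mh mA; rewrite -[X in measurable X]setTI; exact: mh. Qed.

Lemma measurable_lt_set f g :
  measurable_fun setT f -> measurable_fun setT g -> measurable [set t | f t < g t].
Proof.
move=> mf mg; rewrite (_ : [set t | _] = (fun t => g t - f t) @^-1` `]0, +oo[%classic).
  by apply: measurable_preimageT; [exact: measurable_funB|exact: measurable_itv].
by apply/seteqP; split => t /=; rewrite in_itv/= andbT subr_gt0.
Qed.

Lemma measurable_le_set f g :
  measurable_fun setT f -> measurable_fun setT g -> measurable [set t | f t <= g t].
Proof.
move=> mf mg; rewrite -[X in measurable X]setCK; apply: measurableC.
rewrite (_ : ~` _ = [set t | g t < f t]); first exact: measurable_lt_set.
by apply/seteqP; split => t /=; rewrite ltNge => /negP.
Qed.

End MeasurableSets.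

Lemma prod_pair (R : realType) (m n : nat) (F : 'I_m * 'I_n -> R) :
  \prod_p F p = \prod_i \prod_j F (i, j).
Proof. by rewrite (pair_bigA _ (fun i j => F (i, j))); apply: eq_bigr => -[]. Qed.

(** * Integration against a density and the standard Gaussian line *)

Section Density.
Local Open Scope ereal_scope.
Context d (T : measurableType d) (R : realType).
Variables (mu nu : {measure set T -> \bar R}) (p : T -> R).
Hypothesis mp : measurable_fun setT p.
Hypothesis p0 : forall x, (0 <= p x)%R.
Hypothesis nuE : forall A, measurable A -> nu A = \int[mu]_(x in A) (p x)%:E.

Import HBNNSimple.

Let integral_density_nnsfun (f : {nnsfun T >-> R}) :
  \int[nu]_x (f x)%:E = \int[mu]_x ((f x)%:E * (p x)%:E).
Proof.
under [LHS]eq_integral do rewrite fimfunE -fsumEFin//.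
rewrite [LHS]ge0_integral_fsum//; last 2 first.
  - by move=> r; apply/measurable_EFinP; exact: measurable_funM.
  - by move=> n x _; rewrite EFinM nnfun_muleindic_ge0.
transitivity (\sum_(i \in range f) \int[mu]_x
    ((i * \1_(f @^-1` [set i]) x)%:E * (p x)%:E)); last first.
  rewrite -ge0_integral_fsum//.
  - apply: eq_integral => x _; rewrite [in RHS]fimfunE -fsumEFin//.
    rewrite ge0_mule_fsuml// => r.
    by rewrite EFinM nnfun_muleindic_ge0.
  - move=> r; apply: emeasurable_funM.
      by apply/measurable_EFinP; exact: measurable_funM.
    exact/measurable_EFinP.
  - move=> n x _; rewrite mule_ge0//; last by rewrite lee_fin.
    by rewrite EFinM nnfun_muleindic_ge0.
apply: eq_fsbigr => r _.
under [LHS]eq_integral do rewrite EFinM.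
rewrite [LHS]integralZl_indic_nnsfun//= integral_indic//= setIT.
have [r0|r0] := leP 0%R r; last first.
  rewrite preimage_nnfun0// measure0 mule0.
  by rewrite integral0_eq// => x _; rewrite indic0 mulr0 mul0e.
under [RHS]eq_integral do rewrite EFinM -muleA.
rewrite ge0_integralZl//; last 2 first.
  - by apply: emeasurable_funM; exact/measurable_EFinP.
  - by move=> x _; rewrite -EFinM lee_fin mulr_ge0.
congr (_ * _).
rewrite nuE// integral_mkcond; apply: eq_integral => x _.
rewrite patchE indicE; case: ifPn => _; last by rewrite mul0e.
by rewrite mul1e.
Qed.

(** It suffices to know [nu] on sets: both sides are continuous along
    increasing sequences of simple functions. *)
Lemma ge0_integral_density (f : T -> \bar R) :
  measurable_fun setT f -> (forall x, 0 <= f x) ->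
  \int[nu]_x f x = \int[mu]_x (f x * (p x)%:E).
Proof.
move=> mf f0.
pose f_ := nnsfun_approx measurableT mf.
transitivity (lim (\int[nu]_x (f_ n x)%:E @[n --> \oo])).
  rewrite -monotone_convergence//=.
  - apply: eq_integral => ? /[!inE] xD; apply/esym/cvg_lim => //=.
    exact: cvg_nnsfun_approx.
  - by move=> n; exact/measurable_EFinP/measurable_funTS.
  - by move=> n ? _; rewrite lee_fin.
  - by move=> ? _ ? ? mn; rewrite lee_fin; exact/lefP/nd_nnsfun_approx.
transitivity (lim (\int[mu]_x ((f_ n x)%:E * (p x)%:E) @[n --> \oo])).
  by apply: congr_lim; apply/funext => n /=; exact: integral_density_nnsfun.
rewrite -monotone_convergence//=.
- apply: eq_integral => x /[!inE] xD; apply/cvg_lim => //=.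
  apply: cvgeZr => //; exact: cvg_nnsfun_approx.
- move=> n; apply: emeasurable_funM; last exact/measurable_EFinP.
  exact/measurable_EFinP/measurable_funTS.
- by move=> n x _; rewrite -EFinM lee_fin mulr_ge0.
- move=> x _ i j ij; rewrite -!EFinM lee_fin ler_wpM2r//.
  exact/lefP/nd_nnsfun_approx.
Qed.

End Density.

Section Fibrewise.
Local Open Scope ereal_scope.
Context d (T : measurableType d) (R : realType).
Variable mu : {sigma_finite_measure set T -> \bar R}.

(** After exchanging the order of integration the map acts in the inner
    integral, with the other variable fixed. *)
Lemma integral_fibrewise1 (s : T -> T -> T) (H : T * T -> \bar R) :
  measurable_fun setT (fun z => (s z.1 z.2, z.2)) ->
  (forall y f, measurable_fun setT f -> (forall x, 0 <= f x) ->
    \int[mu]_x f (s x y) = \int[mu]_x f x) ->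
  measurable_fun setT H -> (forall z, 0 <= H z) ->
  \int[mu]_x \int[mu]_y H (s x y, y) = \int[mu]_x \int[mu]_y H (x, y).
Proof.
move=> ms sE mH H0.
have mHs : measurable_fun setT (fun z => H (s z.1 z.2, z.2)).
  exact: measurableT_comp.
have E1 := @fubini_tonelli _ _ T T R mu mu _ mHs (fun z => H0 _).
have E2 := @fubini_tonelli _ _ T T R mu mu _ mH H0.
apply: (eq_trans E1); apply: (eq_trans _ (esym E2)).
apply: eq_integral => y _ /=.
by apply: (sE y (fun x => H (x, y))) => //; exact: measurableT_comp.
Qed.

End Fibrewise.

Section OneDim.
Context {R : realType}.
Local Open Scope ereal_scope.
Local Notation leb := (@lebesgue_measure R).

Definition stdnormal : set (measurableTypeR R) -> \bar R := normal_prob 0%R 1%R.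

HB.instance Definition _ := Probability.on stdnormal.

Definition std_pdf (x : R) : R := normal_pdf 0%R 1%R x.

Lemma std_pdfE x : std_pdf x = (normal_peak 1 * expR (- x ^+ 2 / 2))%R.
Proof.
by rewrite /std_pdf normal_pdfE ?oner_eq0// /normal_fun subr0 expr1n.
Qed.

Lemma std_pdf_ge0 x : (0 <= std_pdf x)%R. Proof. exact: normal_pdf_ge0. Qed.

Lemma measurable_std_pdf : measurable_fun [set: measurableTypeR R] std_pdf.
Proof. exact: measurable_normal_pdf. Qed.

Let measurable_std_pdfE :
  measurable_fun [set: measurableTypeR R] (fun x => (std_pdf x)%:E).
Proof. apply: measurableT_comp => //; exact: measurable_std_pdf. Qed.

Lemma integral_stdnormal (f : measurableTypeR R -> \bar R) :
  measurable_fun setT f -> (forall x, 0 <= f x) ->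
  \int[stdnormal]_x f x = \int[leb]_x (f x * (std_pdf x)%:E).
Proof.
apply: ge0_integral_density => //; first exact: measurable_std_pdf.
exact: std_pdf_ge0.
Qed.

Lemma lebesgue_measure_shift (c : R) (A : set R) : measurable A ->
  pushforward leb (+%R^~ c : _ -> measurableTypeR R) A = leb A.
Proof.
move=> mA; apply/esym/lebesgue_measure_unique => //=.
  exact: measurable_funD.
move=> ms _ [[a b]] _ <-.
rewrite /pushforward.
have -> : +%R^~ c @^-1` `]a, b] = `](a - c)%R, (b - c)%R]%classic.
  apply/seteqP; split=> x; rewrite /= !in_itv/=;
  by rewrite ltrBlDr lerBrDr.
rewrite !lebesgue_measure_itv/= !lte_fin ltrD2r; case: ifP => // _.
by rewrite -!EFinD; congr EFin; lra.
Qed.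

Lemma lebesgue_integral_shift c (f : R -> \bar R) :
  measurable_fun setT f -> (forall x, 0 <= f x) ->
  \int[leb]_x f (x + c)%R = \int[leb]_x f x.
Proof.
move=> mf f0.
have ms : measurable_fun [set: R] (+%R^~ c : _ -> measurableTypeR R).
  exact: measurable_funD.
transitivity (\int[pushforward leb
    (+%R^~ c : _ -> measurableTypeR R)]_x f x).
  by rewrite ge0_integral_pushforward.
by apply: eq_measure_integral => //= A mA AS; exact: lebesgue_measure_shift.
Qed.

Local Notation RT := (measurableTypeR R).

Lemma measurable_shear1 (c : R) :
  measurable_fun [set: RT * RT] (fun z : RT * RT => ((z.1 + c * z.2)%R, z.2)).
Proof.
apply: measurable_fun_pair => //; apply: measurable_funD => //.
exact: measurable_funM.
Qed.

Lemma measurable_shear2 (c : R) :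
  measurable_fun [set: RT * RT] (fun z : RT * RT => (z.1, (z.2 + c * z.1)%R)).
Proof.
apply: measurable_fun_pair => //; apply: measurable_funD => //.
exact: measurable_funM.
Qed.

Lemma integral_shear2 c (H : RT * RT -> \bar R) :
  measurable_fun setT H -> (forall z, 0 <= H z) ->
  \int[leb]_x \int[leb]_y H (x, (y + c * x)%R) =
  \int[leb]_x \int[leb]_y H (x, y).
Proof.
move=> mH H0; apply: eq_integral => x _.
apply: (@lebesgue_integral_shift (c * x) (fun y => H (x, y))) => //.
exact: measurableT_comp.
Qed.

Lemma integral_shear1 c (H : RT * RT -> \bar R) :
  measurable_fun setT H -> (forall z, 0 <= H z) ->
  \int[leb]_x \int[leb]_y H ((x + c * y)%R, y) =
  \int[leb]_x \int[leb]_y H (x, y).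
Proof.
move=> mH H0.
have h := @integral_fibrewise1 _ RT R leb (fun x y => (x + c * y)%R) H.
apply: h => //.
  exact: measurable_shear1.
by move=> y f mf f0; exact: lebesgue_integral_shift.
Qed.

Let pdf2 (z : RT * RT) : \bar R := (std_pdf z.1 * std_pdf z.2)%:E.

Let mpdf2 : measurable_fun setT pdf2.
Proof.
apply/measurable_EFinP; apply: measurable_funM;
by apply: measurableT_comp => //; exact: measurable_std_pdf.
Qed.

Let pdf2_ge0 z : 0 <= pdf2 z.
Proof. by rewrite lee_fin mulr_ge0// std_pdf_ge0. Qed.

Lemma integral_stdnormal2 (F : RT * RT -> \bar R) :
  measurable_fun setT F -> (forall z, 0 <= F z) ->
  \int[stdnormal]_x \int[stdnormal]_y F (x, y) =
  \int[leb]_x \int[leb]_y (F (x, y) * pdf2 (x, y)).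
Proof.
move=> mF F0.
rewrite integral_stdnormal//; last 2 first.
- exact: (measurable_fun_fubini_tonelli_F (m2 := stdnormal) F).
- by move=> x; exact: integral_ge0.
apply: eq_integral => x _.
have mFx : measurable_fun [set: RT] (fun y => F (x, y)) by exact: measurableT_comp.
rewrite integral_stdnormal//.
rewrite -ge0_integralZr//=.
- by apply: eq_integral => y _; rewrite -muleA -EFinM mulrC.
- apply: emeasurable_funM => //; exact: measurable_std_pdfE.
- by move=> y _; rewrite mule_ge0// lee_fin std_pdf_ge0.
- by rewrite lee_fin std_pdf_ge0.
Qed.

(** A plane rotation is a product of three shears, each of which preserves
    Lebesgue measure, and it preserves the density. *)
Lemma stdnormal_rotation (a b : R) (F : RT * RT -> \bar R) :
  (0 <= a)%R -> (a ^+ 2 + b ^+ 2 = 1)%R ->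
  measurable_fun setT F -> (forall z, 0 <= F z) ->
  \int[stdnormal]_x \int[stdnormal]_y F ((a * x + b * y)%R, (a * y - b * x)%R)
  = \int[stdnormal]_x \int[stdnormal]_y F (x, y).
Proof.
move=> a0 ab1 mF F0.
(* [al] is the tangent of half the angle: the shears are [al], [- b], [al]. *)
pose al : R := (b / (1 + a))%R.
have a1 : (1 + a != 0)%R by rewrite gt_eqF// ltr_pwDl.
have alM : (al * (1 + a) = b)%R by rewrite /al divfK.
have alb : (al * b = 1 - a)%R.
  rewrite /al mulrAC; apply/(mulIf a1); rewrite divfK//; move: ab1; lra.
pose H z := F z * pdf2 z.
have mH : measurable_fun setT H by exact: emeasurable_funM.
have H0 z : 0 <= H z by rewrite mule_ge0.
pose H1 (z : RT * RT) := H ((z.1 + al * z.2)%R, z.2).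
pose H2 (z : RT * RT) := H1 (z.1, (z.2 + - b * z.1)%R).
have mH1 : measurable_fun setT H1.
  by apply: measurableT_comp => //; exact: measurable_shear1.
have mH2 : measurable_fun setT H2.
  by apply: measurableT_comp => //; exact: measurable_shear2.
rewrite (integral_stdnormal2 (F := fun z =>
  F ((a * z.1 + b * z.2)%R, (a * z.2 - b * z.1)%R)))//; last first.
  apply: measurableT_comp => //; apply: measurable_fun_pair.
    by apply: measurable_funD; exact: measurable_funM.
  by apply: measurable_funB; exact: measurable_funM.
apply: (eq_trans _ (esym (integral_stdnormal2 mF F0))).
have E1 := integral_shear1 al mH H0.
have E2 := integral_shear2 (- b)%R mH1 (fun=> H0 _).
have E3 := integral_shear1 al mH2 (fun=> H0 _).
apply: (eq_trans _ (eq_trans E3 (eq_trans E2 E1))).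
apply: eq_integral => x _; apply: eq_integral => y _ /=.
rewrite /H2 /H1 /=.
have -> : (y + - b * (x + al * y) = a * y - b * x)%R.
  transitivity (y - b * x - (al * b) * y)%R; first by ring.
  by rewrite alb; ring.
have -> : (x + al * y + al * (a * y - b * x) = a * x + b * y)%R.
  transitivity (x - (al * b) * x + (al * (1 + a)) * y)%R; first by ring.
  by rewrite alb alM; ring.
rewrite /H; congr (_ * _); rewrite /pdf2 /= !std_pdfE; congr EFin.
rewrite mulrACA [in RHS]mulrACA -!expRD; congr (_ * expR _)%R.
rewrite -!mulrDl -!opprD; congr (- _ / _)%R.
transitivity ((a ^+ 2 + b ^+ 2) * (x ^+ 2 + y ^+ 2))%R; last by ring.
by rewrite ab1 mul1r.
Qed.

Lemma stdnormal_opp (F : R -> \bar R) :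
  measurable_fun setT F -> (forall z, 0 <= F z) ->
  \int[stdnormal]_x F (- x)%R = \int[stdnormal]_x F x.
Proof.
move=> mF F0.
rewrite integral_stdnormal//; last exact: measurableT_comp.
rewrite integral_stdnormal//.
pose G x := F x * (std_pdf x)%:E.
have mG : measurable_fun setT G.
  by apply: emeasurable_funM => //; exact: measurable_std_pdfE.
transitivity (\int[leb]_x G (- x)%R).
  by apply: eq_integral => x _; rewrite /G !std_pdfE sqrrN.
transitivity (\int[pushforward leb (-%R : _ -> RT)]_x G x).
  rewrite ge0_integral_pushforward// => x _.
  by rewrite mule_ge0// lee_fin std_pdf_ge0.
by apply: eq_measure_integral => //= A mA _; exact: lebesgue_measureN.
Qed.

(** Tilting the density by [expR (u * x)] translates it by [u]. *)
Lemma stdnormal_mgf (u : R) :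
  \int[stdnormal]_x (expR (u * x))%:E = (expR (u ^+ 2 / 2))%:E.
Proof.
rewrite integral_stdnormal//; last first.
  by apply/measurable_EFinP; apply: measurableT_comp => //; exact: measurable_funM.
transitivity (\int[leb]_x ((expR (u ^+ 2 / 2))%:E * (normal_pdf u 1%R x)%:E)).
  apply: eq_integral => x _; rewrite -!EFinM; congr EFin.
  rewrite std_pdfE normal_pdfE ?oner_eq0// /normal_fun expr1n.
  rewrite mulrCA -expRD mulrCA -expRD; congr (_ * expR _)%R.
  by field.
rewrite ge0_integralZl//.
- by rewrite integral_normal_pdf mule1.
- by apply: measurableT_comp => //; exact: measurable_normal_pdf.
- by move=> x _; rewrite lee_fin normal_pdf_ge0.
Qed.

Let normal_peakV (s : R) : (0 < s)%R ->
  (normal_peak s = s^-1 * normal_peak 1)%R.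
Proof.
move=> s0; rewrite /normal_peak -!mulrnAr expr1n mul1r.
by rewrite sqrtrM ?sqr_ge0// sqrtr_sqr gtr0_norm// invfM.
Qed.

(** Tilting by [expR (s * x ^+ 2)] gives a multiple of the centered density of
    variance [1 / (1 - 2 * s)]. *)
Lemma stdnormal_sqr_mgf (s : R) : (s < 1 / 2)%R ->
  \int[stdnormal]_x (expR (s * x ^+ 2))%:E = ((Num.sqrt (1 - 2 * s))^-1)%:E.
Proof.
move=> s2.
have c0 : (0 < 1 - 2 * s)%R by lra.
rewrite integral_stdnormal//; last first.
  apply/measurable_EFinP; apply: measurableT_comp => //.
  by apply: measurable_funM => //; exact: exprn_measurable.
pose sg : R := (Num.sqrt (1 - 2 * s))^-1%R.
have sg0 : (0 < sg)%R by rewrite invr_gt0 sqrtr_gt0.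
have sgE : (sg ^+ 2 = (1 - 2 * s)^-1)%R by rewrite exprVn sqr_sqrtr// ltW.
transitivity (\int[leb]_x (sg%:E * (normal_pdf 0%R sg x)%:E)).
  apply: eq_integral => x _; rewrite -!EFinM; congr EFin.
  rewrite std_pdfE normal_pdfE ?gt_eqF// /normal_fun subr0.
  rewrite [LHS]mulrCA -expRD [RHS]mulrA; congr (_ * expR _)%R.
    by rewrite (normal_peakV sg0) mulrA divff ?mul1r// gt_eqF.
  rewrite sgE; field; rewrite gt_eqF//=; lra.
rewrite ge0_integralZl//.
- by rewrite integral_normal_pdf mule1.
- by apply: measurableT_comp => //; exact: measurable_normal_pdf.
- by move=> x _; rewrite lee_fin normal_pdf_ge0.
- by rewrite lee_fin ltW.
Qed.

End OneDim.

Section GaussianLine.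
Context (R : realType).
Local Open Scope ereal_scope.
Let idTR : measurableTypeR R -> R := idfun.
Let measurable_idTR : measurable_fun [set: measurableTypeR R] idTR.
Proof. exact: measurable_id. Qed.
HB.instance Definition _ := @isMeasurableFun.Build _ _ _ _ idTR measurable_idTR.

(** The same law on [R] itself, the type of the entries of a matrix. *)
Definition gauss1 : probability R R := distribution (@stdnormal R) idTR.

Lemma integral_gauss1 (f : R -> \bar R) :
  measurable_fun setT f -> (forall x, 0 <= f x) ->
  \int[gauss1]_x f x = \int[@stdnormal R]_x f x.
Proof. by move=> mf f0; rewrite ge0_integral_distribution. Qed.

Lemma gauss1_rotation (a b : R) (F : R * R -> \bar R) :
  (0 <= a)%R -> (a ^+ 2 + b ^+ 2 = 1)%R ->
  measurable_fun setT F -> (forall z, 0 <= F z) ->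
  \int[gauss1]_x \int[gauss1]_y F ((a * x + b * y)%R, (a * y - b * x)%R)
  = \int[gauss1]_x \int[gauss1]_y F (x, y).
Proof.
move=> a0 ab1 mF F0.
have aux (G : R * R -> \bar R) : measurable_fun setT G -> (forall z, 0 <= G z) ->
    \int[gauss1]_x \int[gauss1]_y G (x, y) =
    \int[@stdnormal R]_x \int[@stdnormal R]_y G (x, y).
  move=> mG G0; rewrite integral_gauss1.
  - apply: eq_integral => x _; apply: integral_gauss1 => //.
    exact: measurableT_comp.
  - exact: (measurable_fun_fubini_tonelli_F (m2 := gauss1) G).
  - by move=> x; exact: integral_ge0.
have mG : measurable_fun setT (fun z : R * R =>
    F ((a * z.1 + b * z.2)%R, (a * z.2 - b * z.1)%R)).
  apply: measurableT_comp => //; apply: measurable_fun_pair.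
    by apply: measurable_funD; exact: measurable_funM.
  by apply: measurable_funB; exact: measurable_funM.
apply: (eq_trans (aux _ mG (fun=> F0 _))); rewrite (aux _ mF F0).
exact: stdnormal_rotation.
Qed.

Lemma gauss1_opp (F : R -> \bar R) :
  measurable_fun setT F -> (forall z, 0 <= F z) ->
  \int[gauss1]_x F (- x)%R = \int[gauss1]_x F x.
Proof.
move=> mF F0; rewrite !integral_gauss1//; last exact: measurableT_comp.
exact: stdnormal_opp.
Qed.

Lemma gauss1_mgf (u : R) :
  \int[gauss1]_x (expR (u * x))%:E = (expR (u ^+ 2 / 2))%:E.
Proof.
rewrite integral_gauss1; first exact: stdnormal_mgf.
- apply/measurable_EFinP; apply: measurableT_comp => //; exact: measurable_funM.
- by move=> x; rewrite lee_fin expR_ge0.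
Qed.

Lemma gauss1_sqr_mgf (s : R) : (s < 1 / 2)%R ->
  \int[gauss1]_x (expR (s * x ^+ 2))%:E = ((Num.sqrt (1 - 2 * s))^-1)%:E.
Proof.
move=> s2; rewrite integral_gauss1; first exact: stdnormal_sqr_mgf.
- apply/measurable_EFinP; apply: measurableT_comp => //.
  by apply: measurable_funM => //; exact: exprn_measurable.
- by move=> x; rewrite lee_fin expR_ge0.
Qed.
End GaussianLine.

(** * Standard Gaussian matrices *)

Section MatrixSpace.
Context {R : realType} {m n : nat}.
Implicit Types (p q : 'I_m * 'I_n) (B : 'I_m * 'I_n -> set R).

Definition box B : set 'M[R]_(m, n) := [set x | forall p, B p (x p.1 p.2)].

Definition boxes : set (set 'M[R]_(m, n)) :=
  [set A | exists2 B, (forall p, measurable (B p)) & A = box B].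

Let matrix_set0 : <<s boxes >> set0.
Proof. exact: sigma_algebra0. Qed.

Let matrix_setC A : <<s boxes >> A -> <<s boxes >> (~` A).
Proof. exact: sigma_algebraC. Qed.

Let matrix_bigcup (F : _^nat) : (forall i, <<s boxes >> (F i)) ->
  <<s boxes >> (\bigcup_i (F i)).
Proof. exact: sigma_algebra_bigcup. Qed.

HB.instance Definition _ := @isMeasurable.Build default_measure_display
  'M[R]_(m, n) <<s boxes >> matrix_set0 matrix_setC matrix_bigcup.

Lemma measurable_box B : (forall p, measurable (B p)) -> measurable (box B).
Proof. by move=> mB; apply: sub_sigma_algebra; exists B. Qed.

Lemma boxT : box (fun=> setT) = setT.
Proof. by apply/seteqP; split. Qed.

Lemma boxes_setI_closed : setI_closed boxes.
Proof.
move=> _ _ [A mA ->] [B mB ->]; exists (fun p => A p `&` B p).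
  by move=> p; exact: measurableI.
by apply/seteqP; split=> [x [hA hB] p|x h]; [split|split=> p; case: (h p)].
Qed.

Lemma measurable_entry i j : measurable_fun setT (fun x : 'M[R]_(m, n) => x i j).
Proof.
move=> _ Y mY; rewrite setTI.
have -> : (fun x : 'M[R]_(m, n) => x i j) @^-1` Y =
    box (fun p => if p == (i, j) then Y else setT).
  apply/seteqP; split=> x /=.
    by move=> xY p; case: eqP => // ->.
  by move=> /(_ (i, j)); rewrite eqxx.
by apply: measurable_box => p; case: ifP.
Qed.

Lemma measurable_fun_matrixP d (T : measurableType d) (f : T -> 'M[R]_(m, n)) :
  (forall i j, measurable_fun setT (fun t => f t i j)) -> measurable_fun setT f.
Proof.
move=> mf; apply: (@measurability _ _ _ _ _ _ boxes) => //.
move=> _ [_ [B mB ->] <-]; rewrite setTI.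
have -> : f @^-1` box B =
    \big[setI/setT]_(p : 'I_m * 'I_n) ((fun t => f t p.1 p.2) @^-1` B p).
  apply/seteqP; split=> t /=.
    move=> h; apply: (big_ind (fun A : set T => A t)) => //= p _; exact: h.
  by rewrite -bigcap_seq => h p; apply: h => /=; exact: mem_index_enum.
apply: bigsetI_measurable => p _; rewrite -[X in measurable X]setTI.
exact: mf.
Qed.

(** Boxes are stable under intersection, so a law is determined by them. *)
Lemma matrix_measure_unique (m1 m2 : probability 'M[R]_(m, n) R) :
  (forall B, (forall p, measurable (B p)) -> m1 (box B) = m2 (box B)) ->
  forall A, measurable A -> m1 A = m2 A.
Proof.
move=> h; apply: (measure_unique boxes (fun=> setT)).
- by [].
- exact: boxes_setI_closed.
- by move=> _; exists (fun=> setT) => //; rewrite boxT.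
- by rewrite bigcup_const.
- by move=> _ [B mB ->]; exact: h.
- by move=> _; rewrite /= probability_setT ltry.
Qed.

(** Independence of the entries and their marginal law, in a single formula. *)
Definition gaussian_law (mu : probability 'M[R]_(m, n) R) : Prop :=
  forall B, (forall p, measurable (B p)) ->
    mu (box B) = (\prod_p fine (gauss1 R (B p)))%:E.

Definition upd p (t : R) (x : 'M[R]_(m, n)) : 'M[R]_(m, n) :=
  \matrix_(i, j) if (i, j) == p then t else x i j.

Lemma updE p t x q : (upd p t x) q.1 q.2 = if q == p then t else x q.1 q.2.
Proof. by rewrite mxE -surjective_pairing. Qed.

Lemma measurable_upd p : measurable_fun setT
  (fun z : R * 'M[R]_(m, n) => upd p z.1 z.2).
Proof.
apply: measurable_fun_matrixP => i j.
under eq_fun do rewrite mxE.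
case: ((i, j) == p); first exact: measurable_fst.
exact: (measurableT_comp (measurable_entry i j) measurable_snd).
Qed.

Variable mu : probability 'M[R]_(m, n) R.
Hypothesis gmu : gaussian_law mu.
Local Open Scope ereal_scope.

Let updm p : R * 'M[R]_(m, n) -> 'M[R]_(m, n) := fun z => upd p z.1 z.2.

Let resampled_law p A : measurable A ->
  pushforward (gauss1 R \x mu) (updm p) A = mu A.
Proof.
have mupd := measurable_upd p.
pose Xm : {mfun _ >-> _} := HB.pack (updm p) (isMeasurableFun.Build _ _ _ _ _ mupd).
pose PP : probability (R * 'M[R]_(m, n))%type R := [the probability _ _ of gauss1 R \x mu].
apply: (@matrix_measure_unique (distribution PP Xm) mu) => B mB.
rewrite /distribution /pushforward /=.
have -> : updm p @^-1` box B =
    B p `*` box (fun q => if q == p then setT else B q).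
  apply/seteqP; split=> [[t x] /= h|[t x] /= [Bt h] q].
    split; first by have := h p; rewrite /updm updE eqxx.
    by move=> q; case: ifPn => // qp; have := h q; rewrite /updm updE (negbTE qp).
  by rewrite /updm updE; case: eqP => [->//|/eqP qp]; have := h q; rewrite (negbTE qp).
pose B' q := if q == p then setT else B q.
have mB' q : measurable (B' q) by rewrite /B'; case: ifP.
have mbB' := measurable_box mB'.
apply: (eq_trans (product_measure1E (gauss1 R) mu (mB p) mbB')).
have g1 : gauss1 R (B p) = (fine (gauss1 R (B p)))%:E.
  by rewrite fineK// fin_num_measure.
apply: (eq_trans (congr2 mule g1 (gmu mB'))).
rewrite (gmu mB) -EFinM (bigD1 p)//= [in RHS](bigD1 p)//=.
rewrite {1}/B' eqxx probability_setT mul1r; congr (_ * _)%:E%R.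
by apply: eq_bigr => q /negbTE qp; rewrite /B' qp.
Qed.

(** Replacing one coordinate by an independent standard Gaussian leaves
    the law unchanged: the form in which independence enters all later
    computations. *)
Lemma resample p (F : 'M[R]_(m, n) -> \bar R) :
  measurable_fun setT F -> (forall x, 0 <= F x) ->
  \int[mu]_x F x = \int[mu]_x \int[gauss1 R]_t F (upd p t x).
Proof.
move=> mF F0.
have mupd := measurable_upd p.
have mFu : measurable_fun setT (F \o updm p) by exact: measurableT_comp.
transitivity (\int[pushforward (gauss1 R \x mu) (updm p)]_x F x).
  by apply: eq_measure_integral => A mA _; exact/esym/resampled_law.
rewrite ge0_integral_pushforward//.
apply: (eq_trans (@fubini_tonelli2 _ _ _ _ R (gauss1 R) mu _ mFu (fun=> F0 _))).
by [].
Qed.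

End MatrixSpace.

(** * Invariance under linear isometries *)

Section FrobeniusInner.
Context {R : realType} {m n : nat}.
Implicit Types A B C : 'M[R]_(m, n).

Lemma mx_innerE A B : mx_inner A B = \sum_(p : 'I_m * 'I_n) A p.1 p.2 * B p.1 p.2.
Proof.
rewrite /mx_inner /mxtrace.
rewrite -(pair_bigA _ (fun i j => A i j * B i j))/=.
apply: eq_bigr => i _; rewrite mxE; apply: eq_bigr => j _.
by rewrite mxE.
Qed.

Lemma mx_innerC A B : mx_inner A B = mx_inner B A.
Proof. by rewrite !mx_innerE; apply: eq_bigr => p _; rewrite mulrC. Qed.

Lemma mx_innerDl A B C : mx_inner (A + B) C = mx_inner A C + mx_inner B C.
Proof. by rewrite /mx_inner mulmxDl mxtraceD. Qed.

Lemma mx_innerDr A B C : mx_inner C (A + B) = mx_inner C A + mx_inner C B.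
Proof. by rewrite mx_innerC mx_innerDl !(mx_innerC C). Qed.

Lemma mx_innerZl a A B : mx_inner (a *: A) B = a * mx_inner A B.
Proof. by rewrite /mx_inner -scalemxAl mxtraceZ. Qed.

Lemma mx_innerZr a A B : mx_inner A (a *: B) = a * mx_inner A B.
Proof. by rewrite mx_innerC mx_innerZl mx_innerC. Qed.

Lemma mx_innerNl A B : mx_inner (- A) B = - mx_inner A B.
Proof. by rewrite -scaleN1r mx_innerZl mulN1r. Qed.

Lemma mx_innerNr A B : mx_inner A (- B) = - mx_inner A B.
Proof. by rewrite mx_innerC mx_innerNl mx_innerC. Qed.

Lemma mx_innerBl A B C : mx_inner (A - B) C = mx_inner A C - mx_inner B C.
Proof. by rewrite mx_innerDl mx_innerNl. Qed.

Lemma mx_innerBr A B C : mx_inner C (A - B) = mx_inner C A - mx_inner C B.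
Proof. by rewrite mx_innerDr mx_innerNr. Qed.

Lemma mx_inner_ge0 A : 0 <= mx_inner A A.
Proof. by rewrite mx_innerE sumr_ge0// => p _; rewrite -expr2 sqr_ge0. Qed.

Lemma mx_inner_delta A p : mx_inner A (delta_mx p.1 p.2) = A p.1 p.2.
Proof.
rewrite mx_innerE (bigD1 p)//= mxE !eqxx/= mulr1 big1 ?addr0// => q qp.
rewrite mxE -pair_eqE/= in qp *.
by rewrite (_ : _ && _ = false) ?mulr0//; apply: contraNF qp.
Qed.

End FrobeniusInner.

Section OrthogonalInvariance.
Context {R : realType} {m n : nat}.
Local Notation V := 'M[R]_(m, n).
Implicit Types (p q : 'I_m * 'I_n) (x y u v : V).

Definition linear_isometry (f : V -> V) : Prop :=
  (forall a u v, f (a *: u + v) = a *: f u + f v) /\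
  (forall u, mx_inner (f u) (f u) = mx_inner u u).

(** The rotation in the plane of the coordinates [p] and [q]. *)
Definition givens p q (a b : R) x : V :=
  upd p (a * x p.1 p.2 + b * x q.1 q.2)
    (upd q (a * x q.1 q.2 - b * x p.1 p.2) x).

Definition flip p x : V := upd p (- x p.1 p.2) x.

Lemma matrix_pairP x y : (forall p, x p.1 p.2 = y p.1 p.2) -> x = y.
Proof. by move=> h; apply/matrixP => i j; exact: (h (i, j)). Qed.

Let lin_entry a u v p :
  (a *: u + v) p.1 p.2 = a * u p.1 p.2 + v p.1 p.2.
Proof. by rewrite !mxE. Qed.

Lemma isometry_comp f g : linear_isometry f -> linear_isometry g ->
  linear_isometry (f \o g).
Proof.
move=> [lf nf] [lg ng]; split=> [a u v|u] /=; first by rewrite lg lf.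
by rewrite nf ng.
Qed.

Lemma isometry_add f u v : linear_isometry f -> f (u + v) = f u + f v.
Proof. by move=> [lf _]; have := lf 1 u v; rewrite !scale1r. Qed.

Lemma isometry0 f : linear_isometry f -> f 0 = 0.
Proof.
by move=> [lf _]; have := lf (-1) 0 0; rewrite scaler0 addr0 scaleN1r addNr.
Qed.

Lemma isometry_scale f a u : linear_isometry f -> f (a *: u) = a *: f u.
Proof.
by move=> hf; have [lf _] := hf; have := lf a u 0; rewrite (isometry0 hf) !addr0.
Qed.

Lemma isometry_sum f (I : finType) (F : I -> V) : linear_isometry f ->
  f (\sum_i F i) = \sum_i f (F i).
Proof.
move=> hf; apply: (big_morph f) => [u v|]; first exact: isometry_add.
exact: isometry0.
Qed.

Lemma isometry_inner f u v : linear_isometry f ->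
  mx_inner (f u) (f v) = mx_inner u v.
Proof.
move=> hf; have [_ nf] := hf; have := nf (u + v); rewrite isometry_add//.
rewrite !(mx_innerDl, mx_innerDr) !nf (mx_innerC (f v)) (mx_innerC v); lra.
Qed.

Lemma matrix_sum_delta_pair u :
  u = \sum_p u p.1 p.2 *: (delta_mx p.1 p.2 : V).
Proof.
rewrite [LHS]matrix_sum_delta.
exact: (pair_bigA _ (fun i j => u i j *: (delta_mx i j : V))).
Qed.

Lemma measurable_isometry f : linear_isometry f -> measurable_fun setT f.
Proof.
move=> hf; apply: measurable_fun_matrixP => i j.
rewrite (_ : (fun t => f t i j) =
  (fun t => \sum_p t p.1 p.2 * f (delta_mx p.1 p.2) i j)); last first.
  apply/funext => t; rewrite {1}(matrix_sum_delta_pair t) isometry_sum//.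
  by rewrite summxE; apply: eq_bigr => p _; rewrite isometry_scale// mxE.
apply: measurable_sum => p; apply: measurable_funM => //.
exact: measurable_entry.
Qed.

Lemma flip_isometry p : linear_isometry (flip p).
Proof.
split=> [a u v|u].
  apply: matrix_pairP => q; rewrite /flip !(lin_entry, updE).
  by case: eqP => [_|//]; ring.
rewrite !mx_innerE; apply: eq_bigr => q _; rewrite /flip updE.
by case: eqP => [->|]//; rewrite mulrNN.
Qed.

Lemma flipK p : involutive (flip p).
Proof.
move=> x; apply: matrix_pairP => q; rewrite /flip !updE.
by case: eqP => [->|//]; rewrite eqxx opprK.
Qed.

Section Givens.
Variables (p q : 'I_m * 'I_n) (a b : R).
Hypotheses (pq : q != p) (ab1 : a ^+ 2 + b ^+ 2 = 1).

Lemma givensE x r : (givens p q a b x) r.1 r.2 =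
  if r == p then a * x p.1 p.2 + b * x q.1 q.2
  else if r == q then a * x q.1 q.2 - b * x p.1 p.2 else x r.1 r.2.
Proof. by rewrite /givens !updE. Qed.

Lemma givens_isometry : linear_isometry (givens p q a b).
Proof.
split=> [c u v|u].
  apply: matrix_pairP => r.
  rewrite !(lin_entry, givensE).
  by case: eqP => _; [ring|case: eqP => _ //; ring].
rewrite !mx_innerE (bigD1 p)// (bigD1 q)//= [in RHS](bigD1 p)// [in RHS](bigD1 q)//=.
rewrite !addrA; congr (_ + _); last first.
  apply: eq_bigr => r /andP[rp rq]; rewrite givensE.
  by rewrite (negbTE rp) (negbTE rq).
rewrite !givensE !eqxx (negbTE pq).
transitivity ((a ^+ 2 + b ^+ 2) *
  (u p.1 p.2 * u p.1 p.2 + u q.1 q.2 * u q.1 q.2)); first by ring.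
by rewrite ab1 mul1r.
Qed.

End Givens.

Lemma givensK p q a b : q != p -> a ^+ 2 + b ^+ 2 = 1 ->
  cancel (givens p q a b) (givens p q a (- b)).
Proof.
move=> pq ab1 x; apply: matrix_pairP => r; rewrite !givensE !eqxx (negbTE pq).
case: eqP => [->|_].
  transitivity ((a ^+ 2 + b ^+ 2) * x p.1 p.2); first by ring.
  by rewrite ab1 mul1r.
case: eqP => [->|//].
transitivity ((a ^+ 2 + b ^+ 2) * x q.1 q.2); first by ring.
by rewrite ab1 mul1r.
Qed.

Variable mu : probability V R.
Hypothesis gmu : gaussian_law mu.
Local Open Scope ereal_scope.

Definition law_invariant (f : V -> V) : Prop :=
  forall F : V -> \bar R, measurable_fun setT F -> (forall x, 0 <= F x) ->
  \int[mu]_x F (f x) = \int[mu]_x F x.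

Lemma measurable_resample p (F : V -> \bar R) :
  measurable_fun setT F -> (forall x, 0 <= F x) ->
  measurable_fun setT (fun x => \int[gauss1 R]_t F (upd p t x)).
Proof.
move=> mF F0.
have mFu : measurable_fun setT (fun z : R * V => F (upd p z.1 z.2)).
  by apply: measurableT_comp => //; exact: measurable_upd.
exact: (@measurable_fun_fubini_tonelli_G _ _ _ _ R (gauss1 R) _ mFu (fun=> F0 _)).
Qed.

Lemma resample2 p q (F : V -> \bar R) :
  measurable_fun setT F -> (forall x, 0 <= F x) ->
  \int[mu]_x F x =
  \int[mu]_x \int[gauss1 R]_t \int[gauss1 R]_s F (upd q s (upd p t x)).
Proof.
move=> mF F0; rewrite (resample gmu q)//.
by rewrite (resample gmu p)//; first exact: measurable_resample; move=> x;
  exact: integral_ge0.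
Qed.

Lemma givens_invariant p q a b : q != p -> (0 <= a)%R ->
  (a ^+ 2 + b ^+ 2 = 1)%R -> law_invariant (givens p q a b).
Proof.
move=> pq a0 ab1 F mF F0.
have mg := measurable_isometry (givens_isometry pq ab1).
have mFg : measurable_fun setT (F \o givens p q a b) by exact: measurableT_comp.
rewrite (resample2 p q mFg (fun=> F0 _)) (resample2 p q mF F0).
apply: eq_integral => x _ /=.
pose K (z : R * R) := F (upd q z.2 (upd p z.1 x)).
have mK : measurable_fun setT K.
  apply: measurableT_comp => //; apply: measurable_fun_matrixP => i j.
  rewrite (_ : (fun _ => _) = (fun t : R * R => if (i, j) == q then t.2 else
    if (i, j) == p then t.1 else x i j)); last first.
    by apply/funext => t; rewrite !mxE.
  case: ((i, j) == q); first exact: measurable_snd.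
  by case: ((i, j) == p); [exact: measurable_fst|exact: measurable_cst].
rewrite -(gauss1_rotation a0 ab1 mK (fun=> F0 _)).
apply: eq_integral => t _; apply: eq_integral => s _.
rewrite /K; congr F; apply: matrix_pairP => r.
have pq' : p != q by rewrite eq_sym.
rewrite !(givensE, updE) !eqxx (negbTE pq').
case: (eqVneq r q) => [->|rq]; first by rewrite (negbTE pq).
by case: (eqVneq r p).
Qed.

Lemma flip_invariant p : law_invariant (flip p).
Proof.
move=> F mF F0.
have mFf : measurable_fun setT (F \o flip p).
  by apply: measurableT_comp => //; exact: measurable_isometry (flip_isometry _).
rewrite (resample gmu p mFf (fun=> F0 _)) (resample gmu p mF F0).
apply: eq_integral => x _ /=.
have mK : measurable_fun setT (fun t => F (upd p t x)).
  apply: measurableT_comp => //; apply: measurable_fun_matrixP => i j.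
  rewrite (_ : (fun _ => _) = (fun t => if (i, j) == p then t else x i j)).
    by case: ((i, j) == p); [exact: measurable_id|exact: measurable_cst].
  by apply/funext => t; rewrite mxE.
rewrite -(gauss1_opp mK (fun=> F0 _)); apply: eq_integral => t _; congr F.
by apply: matrix_pairP => r; rewrite /flip !updE eqxx; case: eqP.
Qed.

Let E p : V := delta_mx p.1 p.2.

Let E_entry p q : E p q.1 q.2 = (q == p)%:R.
Proof. by rewrite mxE -pair_eqE. Qed.

(** Plane rotations sweep a unit vector supported on [p :: s] to the basis
    vector [E p]. *)
Let sweep s p v : uniq (p :: s) ->
  (forall q, q \notin p :: s -> v q.1 q.2 = 0%R) -> mx_inner v v = 1%R ->
  exists g h : V -> V, [/\ linear_isometry g, law_invariant h, cancel g h,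
    measurable_fun setT h & (forall q, q \notin p :: s -> g (E q) = E q)
    /\ g v = E p].
Proof.
elim: s v => [|q s IH] v /=.
  move=> _ v0 v1.
  have vE : v = v p.1 p.2 *: E p.
    apply: matrix_pairP => q; rewrite mxE E_entry.
    have [->|qp] := eqVneq q p; first by rewrite mulr1.
    by rewrite mulr0 v0// inE.
  have : (v p.1 p.2 ^+ 2 = 1)%R.
    move: v1; rewrite {1 2}vE mx_innerZl mx_innerZr mx_inner_delta E_entry eqxx.
    by rewrite mulr1 expr2.
  move/eqP; rewrite sqrf_eq1 => /orP[/eqP v1'|/eqP v1'].
    exists id, id; split=> //; split => //.
    by rewrite vE v1' scale1r.
  exists (flip p), (flip p); split.
  - exact: flip_isometry.
  - exact: flip_invariant.
  - exact: flipK.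
  - exact: measurable_isometry (flip_isometry _).
  split=> [q|].
    rewrite inE => qp; apply: matrix_pairP => r; rewrite /flip updE.
    by case: eqP => [->|//]; rewrite E_entry eq_sym (negbTE qp) oppr0.
  rewrite vE v1' isometry_scale; last exact: flip_isometry.
  apply: matrix_pairP => r; rewrite mxE /flip updE !E_entry.
  by case: (eqVneq r p) => [_|_] /=; rewrite ?eqxx/=; ring.
rewrite inE negb_or => /and3P[/andP[pq ps] qs us] v0 v1.
have [a [b [a0 ab1 rot]]] : exists a b : R, [/\ (0 <= a)%R, (a ^+ 2 + b ^+ 2 = 1)%R
    & (a * v q.1 q.2 - b * v p.1 p.2 = 0)%R].
  set y := v q.1 q.2; set x := v p.1 p.2.
  have [r0|r0] := eqVneq (x ^+ 2 + y ^+ 2)%R 0%R.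
    have y0 : y = 0%R.
      move/eqP: r0; rewrite paddr_eq0 ?sqr_ge0// !sqrf_eq0.
      by case/andP => _ /eqP.
    by exists 1%R, 0%R; split => //; rewrite ?y0; ring.
  have rp : (0 < x ^+ 2 + y ^+ 2)%R by rewrite lt0r r0 addr_ge0 ?sqr_ge0.
  have sr := sqr_sqrtr (ltW rp); set r := Num.sqrt _ in sr.
  have rp' : (0 < r)%R by rewrite sqrtr_gt0.
  have rn : r != 0%R by rewrite gt_eqF.
  have nrm : ((x / r) ^+ 2 + (y / r) ^+ 2 = 1)%R.
    by rewrite !expr_div_n -mulrDl sr divff.
  have [x0|x0] := leP 0%R x.
    exists (x / r)%R, (y / r)%R; split=> //; first by rewrite divr_ge0// ltW.
    by field.
  exists (- x / r)%R, (- y / r)%R; split; last by field.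
    by rewrite divr_ge0// ?ltW// oppr_gt0.
  by rewrite !mulNr !sqrrN.
have qp : q != p by rewrite eq_sym.
have hg := givens_isometry qp ab1.
set w := givens p q a b v.
have w0 r : r \notin p :: s -> w r.1 r.2 = 0%R.
  rewrite inE negb_or /w => /andP[rp rs]; rewrite givensE (negbTE rp).
  case: eqP => [//|/eqP rq]; apply: v0.
  by rewrite !inE !negb_or rp rq.
have w1 : mx_inner w w = 1%R by rewrite hg.2.
have [|g [h [gi hi gh mh [gE gw]]]] := IH w _ w0 w1; first by rewrite /= ps us.
have ab1' : (a ^+ 2 + (- b) ^+ 2 = 1)%R by rewrite sqrrN.
have hgi := givens_isometry qp ab1'.
exists (g \o givens p q a b), (givens p q a (- b) \o h); split.
- exact: isometry_comp.
- move=> F mF F0 /=.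
  have mFg : measurable_fun setT (F \o givens p q a (- b)).
    by apply: measurableT_comp => //; exact: measurable_isometry.
  rewrite (hi (F \o givens p q a (- b)) mFg (fun=> F0 _)).
  exact: givens_invariant.
- by move=> x /=; rewrite gh givensK.
- by apply: measurableT_comp => //; exact: measurable_isometry.
- split=> // r; rewrite !inE !negb_or => /and3P[rp rq rs] /=.
  rewrite (_ : givens _ _ _ _ _ = E r); first by apply: gE; rewrite inE negb_or rp.
  apply: matrix_pairP => k; rewrite givensE !E_entry (eq_sym p) (negbTE rp).
  rewrite (eq_sym q) (negbTE rq) !mulr0 subrr addr0.
  by case: eqP => [->|_]; [rewrite eq_sym (negbTE rp)|
    case: eqP => [->|//]; rewrite eq_sym (negbTE rq)].
Qed.

(** Plane rotations and sign changes generate the orthogonal group, so the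
    invariance under these two extends to every linear isometry. *)
Theorem gaussian_isometry_invariant f : linear_isometry f -> law_invariant f.
Proof.
suff H s : uniq s -> forall f, linear_isometry f ->
    (forall q, q \notin s -> f (E q) = E q) -> law_invariant f.
  move=> hf; apply: (H (enum {: 'I_m * 'I_n})) => //; first exact: enum_uniq.
  by move=> q; rewrite mem_enum.
elim: s => [|p s IH] us {}f hf fE.
  move=> F mF F0; apply: eq_integral => x _; congr F.
  rewrite {1}(matrix_sum_delta_pair x) isometry_sum//.
  rewrite {2}(matrix_sum_delta_pair x); apply: eq_bigr => q _.
  by rewrite isometry_scale// fE.
have v0 q : q \notin p :: s -> f (E p) q.1 q.2 = 0%R.
  move=> qs; rewrite -mx_inner_delta -/(E q) -(fE _ qs) isometry_inner//.
  by rewrite mx_inner_delta E_entry; case: eqP qs => // ->; rewrite inE eqxx.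
have v1 : mx_inner (f (E p)) (f (E p)) = 1%R.
  by rewrite hf.2 mx_inner_delta E_entry eqxx.
have [g [h [gi hi gh mh [gE gv]]]] := sweep us v0 v1.
have us' : uniq s by case/andP: us.
have hgf : law_invariant (g \o f).
  apply: IH => //; first exact: isometry_comp.
  move=> q qs /=; have [->//|qp] := eqVneq q p.
  have qps : q \notin p :: s by rewrite inE negb_or qp.
  by rewrite fE// gE.
move=> F mF F0.
have mFh : measurable_fun setT (F \o h) by exact: measurableT_comp.
rewrite -(hi F mF F0) -(hgf (F \o h) mFh (fun=> F0 _)).
by apply: eq_integral => x _ /=; rewrite gh.
Qed.

End OrthogonalInvariance.

(** * Exponential integrals of Gaussian matrices *)

Section GaussianIntegrals.
Context {R : realType} {m n : nat}.
Local Notation V := 'M[R]_(m, n).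
Variable mu : probability V R.
Hypothesis gmu : gaussian_law mu.
Local Open Scope ereal_scope.

Definition constant_along (s : seq ('I_m * 'I_n)) T (G : V -> T) : Prop :=
  forall p t x, p \in s -> G (upd p t x) = G x.

(** The coordinates in [s] are integrated out one at a time, the coefficients
    [u] and the factor [F] being constant along them. *)
Lemma gaussian_mgf_linear (s : seq ('I_m * 'I_n)) (F : V -> \bar R)
    (u : 'I_m * 'I_n -> V -> R) :
  uniq s -> measurable_fun setT F -> (forall x, 0 <= F x) ->
  constant_along s F ->
  (forall p, measurable_fun setT (u p)) ->
  (forall p, constant_along s (u p)) ->
  \int[mu]_x (F x * (expR (\sum_(p <- s) x p.1 p.2 * u p x))%:E) =
  \int[mu]_x (F x * (expR (\sum_(p <- s) u p x ^+ 2 / 2))%:E).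
Proof.
move=> us mF F0 cF mu_ cu; elim: s F us mF F0 cF cu => [|p s IH] F us mF F0 cF cu.
  by under eq_integral do rewrite big_nil; under [in RHS]eq_integral do rewrite big_nil.
have /andP[ps us'] := us.
pose G x := F x * (expR (\sum_(q <- s) x q.1 q.2 * u q x))%:E.
have mG : measurable_fun setT G.
  apply: emeasurable_funM => //; apply/measurable_EFinP; apply: measurableT_comp => //.
  apply: measurable_sum => q; apply: measurable_funM => //; exact: measurable_entry.
have G0 x : 0 <= G x by rewrite mule_ge0// lee_fin expR_ge0.
have Gp t x : G (upd p t x) = G x.
  rewrite /G cF ?mem_head//; congr (_ * (expR _)%:E).
  apply: eq_big_seq => q qs; rewrite cu ?mem_head// updE; congr (_ * _)%R.
  by case: eqP qs => // ->; rewrite (negbTE ps).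
transitivity (\int[mu]_x (G x * (expR (x p.1 p.2 * u p x))%:E)).
  apply: eq_integral => x _; rewrite /G big_cons expRD -muleA -EFinM; congr (_ * _%:E).
  by rewrite mulrC.
rewrite (resample gmu p); last 2 first.
- apply: emeasurable_funM => //; apply/measurable_EFinP; apply: measurableT_comp => //.
  apply: measurable_funM => //; exact: measurable_entry.
- by move=> x; rewrite mule_ge0// lee_fin expR_ge0.
transitivity (\int[mu]_x (F x * (expR (u p x ^+ 2 / 2))%:E *
    (expR (\sum_(q <- s) x q.1 q.2 * u q x))%:E)).
  apply: eq_integral => x _.
  transitivity (\int[gauss1 R]_t (G x * (expR (u p x * t))%:E)).
    apply: eq_integral => t _; rewrite Gp cu ?mem_head// updE eqxx.
    by rewrite (mulrC t).
  rewrite ge0_integralZl//; last first.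
    apply/measurable_EFinP; apply: measurableT_comp => //; exact: measurable_funM.
  by rewrite gauss1_mgf /G muleAC.
pose F' x := F x * (expR (u p x ^+ 2 / 2))%:E.
have mF' : measurable_fun setT F'.
  apply: emeasurable_funM => //; apply/measurable_EFinP.
  apply: measurableT_comp => //.
  by apply: measurable_funM => //; apply: measurable_funX.
have F'0 x : 0 <= F' x by rewrite mule_ge0// lee_fin expR_ge0.
have cF' : constant_along s F'.
  by move=> q t x qs; rewrite /F' cF ?cu// inE qs orbT.
have cu' q : constant_along s (u q).
  by move=> r t x rs; apply: cu; rewrite inE rs orbT.
apply: (eq_trans (IH F' us' mF' F'0 cF' cu')).
by apply: eq_integral => x _; rewrite big_cons expRD EFinM muleA.
Qed.

(** The square is linearized by an auxiliary Gaussian variable [g], because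
    [expR (c * w ^+ 2)] is the mean of [expR (sqrt (2 * c) * w * g)]; then the
    matrix is integrated first, and [g] last. *)
Lemma gaussian_mgf_square (c : R) (s : seq ('I_m * 'I_n)) (F : V -> \bar R)
    (u : 'I_m * 'I_n -> V -> R) :
  (0 <= c)%R -> uniq s -> measurable_fun setT F -> (forall x, 0 <= F x) ->
  constant_along s F ->
  (forall p, measurable_fun setT (u p)) ->
  (forall p, constant_along s (u p)) ->
  (forall x, (2 * c * \sum_(p <- s) u p x ^+ 2 < 1)%R) ->
  \int[mu]_x (F x * (expR (c * (\sum_(p <- s) x p.1 p.2 * u p x) ^+ 2))%:E) =
  \int[mu]_x (F x *
    ((Num.sqrt (1 - 2 * c * \sum_(p <- s) u p x ^+ 2))^-1)%:E).
Proof.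
move=> c0 us mF F0 cF mu_ cu ub.
pose k := Num.sqrt (2 * c)%R.
have kE : (k ^+ 2 = 2 * c)%R by rewrite sqr_sqrtr// mulr_ge0.
pose H (z : R * V) := F z.2 *
  (expR (\sum_(p <- s) z.2 p.1 p.2 * (k * z.1 * u p z.2)))%:E.
have mH : measurable_fun setT H.
  apply: emeasurable_funM; first exact: (measurableT_comp mF measurable_snd).
  apply/measurable_EFinP; apply: measurableT_comp => //.
  apply: measurable_sum => q; apply: measurable_funM.
    exact: (measurableT_comp (measurable_entry _ _) measurable_snd).
  apply: measurable_funM; first exact: measurable_funM.
  exact: (measurableT_comp (mu_ q) measurable_snd).
have H0 z : 0 <= H z by rewrite mule_ge0// lee_fin expR_ge0.
transitivity (\int[mu]_x \int[gauss1 R]_g H (g, x)).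
  apply: eq_integral => x _.
  transitivity (\int[gauss1 R]_g (F x *
      (expR ((k * \sum_(p <- s) x p.1 p.2 * u p x) * g))%:E)); last first.
    apply: eq_integral => g _; rewrite /H /=; congr (_ * (expR _)%:E).
    by rewrite mulr_sumr mulr_suml; apply: eq_bigr => p _; ring.
  rewrite ge0_integralZl//; last first.
    apply/measurable_EFinP; apply: measurableT_comp => //;
    by apply: measurable_funM => //; exact: measurable_funX.
  rewrite gauss1_mgf; by congr (_ * (expR _)%:E); rewrite exprMn kE; field.
apply: (eq_trans (esym (@fubini_tonelli _ _ _ _ R (gauss1 R) mu _ mH H0))).
transitivity (\int[gauss1 R]_g \int[mu]_x (F x *
    (expR ((c * \sum_(p <- s) u p x ^+ 2) * g ^+ 2))%:E)).
  apply: eq_integral => g _.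
  have mu' p : measurable_fun setT (fun x => k * g * u p x)%R.
    exact: measurable_funM.
  have cu' p : constant_along s (fun x => k * g * u p x)%R.
    by move=> q t x qs; rewrite cu.
  apply: (eq_trans (gaussian_mgf_linear us mF F0 cF mu' cu')).
  apply: eq_integral => x _; congr (_ * (expR _)%:E).
  rewrite mulr_sumr mulr_suml; apply: eq_bigr => p _.
  by rewrite !exprMn kE; field.
pose K (z : R * V) := F z.2 *
  (expR ((c * \sum_(p <- s) u p z.2 ^+ 2) * z.1 ^+ 2))%:E.
have mK : measurable_fun setT K.
  apply: emeasurable_funM; first exact: (measurableT_comp mF measurable_snd).
  apply/measurable_EFinP; apply: measurableT_comp => //.
  apply: measurable_funM; last exact: measurable_funX.
  apply: measurable_funM => //; apply: measurable_sum => q.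
  apply: measurable_funX; exact: (measurableT_comp (mu_ q) measurable_snd).
have K0 z : 0 <= K z by rewrite mule_ge0// lee_fin expR_ge0.
apply: (eq_trans (@fubini_tonelli _ _ _ _ R (gauss1 R) mu _ mK K0)).
apply: eq_integral => x _; rewrite /K /=.
rewrite ge0_integralZl//; last first.
    apply/measurable_EFinP; apply: measurableT_comp => //;
    by apply: measurable_funM => //; exact: measurable_funX.
rewrite gauss1_sqr_mgf ?mulrA//.
by have := ub x; rewrite -mulrA; lra.
Qed.

Lemma gaussian_mgf_sumsq (c : R) (s : seq ('I_m * 'I_n)) :
  uniq s -> (c < 1 / 2)%R ->
  \int[mu]_x (expR (c * \sum_(p <- s) x p.1 p.2 ^+ 2))%:E =
  ((Num.sqrt (1 - 2 * c))^-1 ^+ size s)%:E.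
Proof.
move=> us c2; elim: s us => [|p s IH] us.
  under eq_integral do rewrite big_nil mulr0 expR0.
  by rewrite expr0 integral_cst// mul1e; exact: probability_setT.
have /andP[ps us'] := us.
have mG : measurable_fun setT
    (fun x : V => (expR (c * \sum_(q <- s) x q.1 q.2 ^+ 2))%:E).
  apply/measurable_EFinP; apply: measurableT_comp => //.
  apply: measurable_funM => //; apply: measurable_sum => q.
  apply: measurable_funX; exact: measurable_entry.
rewrite (resample gmu p); last 2 first.
- apply/measurable_EFinP; apply: measurableT_comp => //.
  apply: measurable_funM => //; apply: measurable_sum => q.
  apply: measurable_funX; exact: measurable_entry.
- by move=> x; rewrite lee_fin expR_ge0.
transitivity (\int[mu]_x (((Num.sqrt (1 - 2 * c))^-1)%:E *
    (expR (c * \sum_(q <- s) x q.1 q.2 ^+ 2))%:E)).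
  apply: eq_integral => x _.
  transitivity (\int[gauss1 R]_t ((expR (c * \sum_(q <- s) x q.1 q.2 ^+ 2))%:E *
     (expR (c * t ^+ 2))%:E)).
    apply: eq_integral => t _; rewrite big_cons mulrDr expRD EFinM muleC.
    rewrite updE eqxx; congr (((expR (c * _))%:E * _)).
    apply: eq_big_seq => q qs; rewrite updE.
    by case: eqP qs => // ->; rewrite (negbTE ps).
  rewrite ge0_integralZl//; last first.
    apply/measurable_EFinP; apply: measurableT_comp => //;
    by apply: measurable_funM => //; exact: measurable_funX.
  by rewrite gauss1_sqr_mgf// muleC.
rewrite ge0_integralZl//.
by rewrite IH// -EFinM exprS.
Qed.

End GaussianIntegrals.

(** * Pairs of independent samples *)

Section GaussianLaws.
Context {R : realType}.
Local Open Scope ereal_scope.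

Lemma gaussian_law_unique m n (m1 m2 : probability 'M[R]_(m, n) R) :
  gaussian_law m1 -> gaussian_law m2 ->
  forall A, measurable A -> m1 A = m2 A.
Proof.
by move=> g1 g2; apply: matrix_measure_unique => B mB; rewrite g1 ?g2.
Qed.

Section RowMx.
Context {d m n : nat}.
Variables (mu1 : probability 'M[R]_(d, m) R) (mu2 : probability 'M[R]_(d, n) R).

Definition join_samples (z : 'M[R]_(d, m) * 'M[R]_(d, n)) : 'M[R]_(d, m + n) :=
  row_mx z.1 z.2.

Lemma measurable_join_samples : measurable_fun setT join_samples.
Proof.
apply: measurable_fun_matrixP => i j.
under eq_fun do rewrite mxE.
case: (fintype.split j) => k.
  exact: (measurableT_comp (measurable_entry i k) measurable_fst).
exact: (measurableT_comp (measurable_entry i k) measurable_snd).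
Qed.

HB.instance Definition _ :=
  @isMeasurableFun.Build _ _ _ _ join_samples measurable_join_samples.

(** A pair is stored as one wide matrix, so that isometries mixing the two
    samples are isometries of a single matrix space. *)
Definition joint_law : probability 'M[R]_(d, m + n) R :=
  distribution [the probability _ _ of mu1 \x mu2] join_samples.

Lemma gaussian_joint_law :
  gaussian_law mu1 -> gaussian_law mu2 -> gaussian_law joint_law.
Proof.
move=> g1 g2 B mB.
pose B1 (p : 'I_d * 'I_m) := B (p.1, lshift n p.2).
pose B2 (p : 'I_d * 'I_n) := B (p.1, rshift m p.2).
have mB1 p : measurable (B1 p) by exact: mB.
have mB2 p : measurable (B2 p) by exact: mB.
have E : join_samples @^-1` box B = box B1 `*` box B2.
  apply/seteqP; split=> [[x y]/= h|[x y]/= [h1 h2] [i j]/=].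
    split=> [[i j]|[i j]].
      by have := h (i, lshift n j); rewrite /= /join_samples row_mxEl.
    by have := h (i, rshift m j); rewrite /= /join_samples row_mxEr.
  rewrite /join_samples mxE /=; case: splitP => k jk.
    have -> : j = lshift n k by exact: val_inj.
    exact: (h1 (i, k)).
  have -> : j = rshift m k by exact: val_inj.
  exact: (h2 (i, k)).
transitivity ((mu1 \x mu2) (join_samples @^-1` box B)) => //.
rewrite E; apply: (eq_trans (product_measure1E mu1 mu2
  (measurable_box mB1) (measurable_box mB2))).
apply: (eq_trans (congr2 mule (g1 _ mB1) (g2 _ mB2))).
rewrite -EFinM; congr EFin.
rewrite !prod_pair /=.
rewrite -big_split/=; apply: eq_bigr => i _.
by rewrite big_split_ord.
Qed.

Lemma integral_joint_law (F : 'M[R]_(d, m + n) -> \bar R) :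
  measurable_fun setT F -> (forall x, 0 <= F x) ->
  \int[joint_law]_x F x = \int[mu1]_x \int[mu2]_y F (row_mx x y).
Proof.
move=> mF F0; rewrite ge0_integral_distribution//.
have mFj : measurable_fun setT (F \o join_samples).
  by apply: measurableT_comp => //; exact: measurable_join_samples.
exact: (@fubini_tonelli1 _ _ _ _ R mu1 mu2 _ mFj (fun=> F0 _)).
Qed.

Lemma joint_law_fst A : measurable A -> joint_law (lsubmx @^-1` A) = mu1 A.
Proof.
move=> mA; transitivity ((mu1 \x mu2) (A `*` setT)).
  rewrite /joint_law /= /distribution /pushforward /=; congr (_ _).
  apply/seteqP; split=> [[x y]|[x y]]; rewrite /= /join_samples row_mxKl//.
  by case.
apply: (eq_trans (product_measure1E mu1 mu2 mA measurableT)).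
apply: (eq_trans (congr1 (mule (mu1 A)) (probability_setT mu2))).
exact: mule1.
Qed.

Lemma joint_law_snd A : measurable A -> joint_law (rsubmx @^-1` A) = mu2 A.
Proof.
move=> mA; transitivity ((mu1 \x mu2) (setT `*` A)).
  rewrite /joint_law /= /distribution /pushforward /=; congr (_ _).
  apply/seteqP; split=> [[x y]|[x y]]; rewrite /= /join_samples row_mxKr//.
  by case.
apply: (eq_trans (product_measure1E mu1 mu2 measurableT mA)).
apply: (eq_trans (congr1 (mule^~ (mu2 A)) (probability_setT mu1))).
exact: mul1e.
Qed.

End RowMx.

End GaussianLaws.

(** * Frobenius geometry and matrices near the identity *)

Section FrobeniusNorm.
Context {R : realType}.

Lemma mx_innerMl m n k (A : 'M[R]_(m, n)) (B : 'M[R]_(n, k)) C :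
  mx_inner (A *m B) C = mx_inner A (C *m B^T).
Proof. by rewrite /mx_inner trmx_mul trmxK mulmxA. Qed.

Lemma mx_innerMr m n k (A : 'M[R]_(m, n)) (B : 'M[R]_(n, k)) C :
  mx_inner (A *m B) C = mx_inner B (A^T *m C).
Proof. by rewrite /mx_inner trmx_mul trmxK -mulmxA mxtrace_mulC mulmxA. Qed.

Lemma mx_innerT m n (A B : 'M[R]_(m, n)) : mx_inner A^T B^T = mx_inner A B.
Proof. by rewrite [RHS]mx_innerC /mx_inner trmxK mxtrace_mulC. Qed.

Lemma mx_inner_eq0 m n (A : 'M[R]_(m, n)) : mx_inner A A = 0 -> A = 0.
Proof.
rewrite mx_innerE => /eqP; rewrite psumr_eq0 => [|p _]; last first.
  by rewrite -expr2 sqr_ge0.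
move=> /allP h; apply/matrixP => i j; rewrite mxE.
have /= := h (i, j) (mem_index_enum _).
by rewrite mulf_eq0 orbb => /eqP.
Qed.

Lemma mx_inner1 n (A : 'M[R]_n) : mx_inner A 1%:M = \tr A.
Proof. by rewrite /mx_inner trmx1 mulmx1. Qed.

Lemma mx_inner_sqr_le m n (A B : 'M[R]_(m, n)) :
  mx_inner A B ^+ 2 <= mx_inner A A * mx_inner B B.
Proof.
set a := mx_inner A A; set b := mx_inner B B; set c := mx_inner A B.
have [b0|b0] := eqVneq b 0.
  have B0 := mx_inner_eq0 b0.
  by rewrite /c B0 /mx_inner trmx0 mulmx0 mxtrace0 expr0n mulr_ge0 ?mx_inner_ge0.
have bp : 0 < b by rewrite lt0r b0 mx_inner_ge0.
have : 0 <= mx_inner (b *: A - c *: B) (b *: A - c *: B) by exact: mx_inner_ge0.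
rewrite !(mx_innerBl, mx_innerBr, mx_innerZl, mx_innerZr) (mx_innerC B A).
rewrite -/a -/b -/c => h.
rewrite -subr_ge0 -(pmulr_rge0 _ bp); apply: le_trans h _.
by rewrite le_eqVlt; apply/orP; left; apply/eqP; ring.
Qed.

Lemma frob_norm_ge0 m n (A : 'M[R]_(m, n)) : 0 <= frob_norm A.
Proof. exact: sqrtr_ge0. Qed.

Lemma frob_norm_sqr m n (A : 'M[R]_(m, n)) : frob_norm A ^+ 2 = mx_inner A A.
Proof. by rewrite sqr_sqrtr// mx_inner_ge0. Qed.

Lemma frob_norm_le m n (A : 'M[R]_(m, n)) c :
  0 <= c -> mx_inner A A <= c ^+ 2 -> frob_norm A <= c.
Proof.
move=> c0; rewrite -frob_norm_sqr => h.
by rewrite -(@ler_pXn2r _ 2)// nnegrE frob_norm_ge0.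
Qed.

Lemma mx_inner_le m n (A B : 'M[R]_(m, n)) :
  mx_inner A B <= frob_norm A * frob_norm B.
Proof.
have [h|h] := leP (mx_inner A B) 0.
  by apply: le_trans h _; rewrite mulr_ge0 ?frob_norm_ge0.
rewrite -(@ler_pXn2r _ 2)// ?nnegrE ?mulr_ge0 ?frob_norm_ge0// ?(ltW h)//.
by rewrite exprMn !frob_norm_sqr; exact: mx_inner_sqr_le.
Qed.

Lemma frob_normD m n (A B : 'M[R]_(m, n)) :
  frob_norm (A + B) <= frob_norm A + frob_norm B.
Proof.
apply: frob_norm_le; first by rewrite addr_ge0 ?frob_norm_ge0.
rewrite !(mx_innerDl, mx_innerDr) (mx_innerC B) sqrrD !frob_norm_sqr.
have := mx_inner_le A B; lra.
Qed.

Lemma frob_normZ m n (A : 'M[R]_(m, n)) c :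
  frob_norm (c *: A) = `|c| * frob_norm A.
Proof.
rewrite /frob_norm mx_innerZl mx_innerZr mulrA -expr2 sqrtrM ?sqr_ge0//.
by rewrite sqrtr_sqr.
Qed.

Lemma frob_normN m n (A : 'M[R]_(m, n)) : frob_norm (- A) = frob_norm A.
Proof. by rewrite /frob_norm mx_innerNl mx_innerNr opprK. Qed.

Lemma frob_normB m n (A B : 'M[R]_(m, n)) :
  frob_norm (A - B) <= frob_norm A + frob_norm B.
Proof. by rewrite -(frob_normN B) frob_normD. Qed.

Lemma frob_normT m n (A : 'M[R]_(m, n)) : frob_norm A^T = frob_norm A.
Proof. by rewrite /frob_norm mx_innerT. Qed.

Lemma mx_inner_col m n (A : 'M[R]_(m, n)) :
  mx_inner A A = \sum_j mx_inner (col j A) (col j A).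
Proof.
rewrite mx_innerE -(pair_bigA _ (fun i j => A i j * A i j))/= exchange_big/=.
apply: eq_bigr => j _.
rewrite mx_innerE -(pair_bigA _ (fun i k => (col j A) i k * (col j A) i k))/=.
by apply: eq_bigr => i _; rewrite big_ord1 !mxE.
Qed.

(** A bound on the operator norm, free of suprema and square roots. *)
Definition op_le m n (c : R) (M : 'M[R]_(m, n)) : Prop :=
  forall x : 'cV[R]_n, mx_inner (M *m x) (M *m x) <= c ^+ 2 * mx_inner x x.

Lemma frob_norm_mulmxl m n k c (M : 'M[R]_(m, n)) (A : 'M[R]_(n, k)) :
  0 <= c -> op_le c M -> frob_norm (M *m A) <= c * frob_norm A.
Proof.
move=> c0 h; apply: frob_norm_le; first by rewrite mulr_ge0 ?frob_norm_ge0.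
rewrite exprMn frob_norm_sqr !mx_inner_col mulr_sumr; apply: ler_sum => j _.
by rewrite colE -mulmxA -colE.
Qed.

Lemma op_leT m n c (M : 'M[R]_(m, n)) : 0 <= c -> op_le c M -> op_le c M^T.
Proof.
move=> c0 h x; set y := M^T *m x.
have e : mx_inner y y = mx_inner x (M *m y).
  by rewrite {1}/y mx_innerMr trmxK.
have [y0|y0] := eqVneq (mx_inner y y) 0.
  by rewrite y0 mulr_ge0 ?sqr_ge0 ?mx_inner_ge0.
have yp : 0 < mx_inner y y by rewrite lt0r y0 mx_inner_ge0.
rewrite -(ler_pM2r yp) -expr2 {1}e.
apply: le_trans (mx_inner_sqr_le _ _) _.
rewrite mulrC -mulrA (mulrC (mx_inner x x)) mulrA.
by rewrite ler_wpM2r ?mx_inner_ge0.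
Qed.

Lemma frob_norm_mulmxr m n k c (A : 'M[R]_(m, n)) (M : 'M[R]_(n, k)) :
  0 <= c -> op_le c M -> frob_norm (A *m M) <= c * frob_norm A.
Proof.
move=> c0 h; rewrite -frob_normT trmx_mul -(frob_normT A).
by apply: frob_norm_mulmxl => //; exact: op_leT.
Qed.

Lemma op_le_orth n (U : 'M[R]_n) : U^T *m U = 1%:M -> op_le 1 U.
Proof. by move=> h x; rewrite mx_innerMr mulmxA h mul1mx expr1n mul1r. Qed.

Lemma op_leM m n k b c (M : 'M[R]_(m, n)) (N : 'M[R]_(n, k)) :
  op_le b M -> op_le c N -> op_le (b * c) (M *m N).
Proof.
move=> hM hN x; rewrite -mulmxA exprMn; apply: le_trans (hM _) _.
by rewrite -[leRHS]mulrA ler_wpM2l ?sqr_ge0//; exact: hN.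
Qed.

Lemma op_le_frob m n (A : 'M[R]_(m, n)) : op_le (frob_norm A) A.
Proof.
move=> x; rewrite frob_norm_sqr mx_innerE.
rewrite -(pair_bigA _ (fun i j => (A *m x) i j * (A *m x) i j))/=.
rewrite (mx_innerE A) -(pair_bigA _ (fun i j => A i j * A i j))/= mulr_suml.
apply: ler_sum => i _; rewrite big_ord1.
have e : (A *m x) i 0 = mx_inner (row i A)^T x.
  rewrite mx_innerE -(pair_bigA _ (fun j k => (row i A)^T j k * x j k))/= mxE.
  by apply: eq_bigr => j _; rewrite big_ord1 !mxE.
rewrite e -expr2; apply: le_trans (mx_inner_sqr_le _ _) _.
rewrite ler_wpM2r ?mx_inner_ge0// mx_innerT mx_innerE.
rewrite -(pair_bigA _ (fun k j => (row i A) k j * (row i A) k j))/= big_ord1.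
by rewrite le_eqVlt (eq_bigr (fun j => A i j * A i j)) ?eqxx// => j _; rewrite !mxE.
Qed.

Definition qform n (S : 'M[R]_n) (x : 'cV[R]_n) : R := mx_inner x (S *m x).

Lemma qformE n (S : 'M[R]_n) x : qform S x = (x^T *m S *m x) 0 0.
Proof.
rewrite /qform mx_innerC /mx_inner mxtrace_mulC -mulmxA /mxtrace.
by rewrite big_ord1.
Qed.

Lemma qformD n (S : 'M[R]_n) x y : S^T = S ->
  qform S (x + y) = qform S x + 2 * mx_inner y (S *m x) + qform S y.
Proof.
move=> sS; rewrite /qform mulmxDr !(mx_innerDl, mx_innerDr).
have -> : mx_inner x (S *m y) = mx_inner y (S *m x).
  by rewrite mx_innerC mx_innerMr sS.
ring.
Qed.

Lemma qformN n (S : 'M[R]_n) x : qform S (- x) = qform S x.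
Proof. by rewrite /qform mulmxN mx_innerNl mx_innerNr opprK. Qed.

Lemma qformZ n (S : 'M[R]_n) a x : qform S (a *: x) = a ^+ 2 * qform S x.
Proof. by rewrite /qform -scalemxAr mx_innerZl mx_innerZr mulrA -expr2. Qed.

(** For a symmetric matrix the operator norm is read off the quadratic form
    (polarization). *)
Lemma op_le_qform n c (S : 'M[R]_n) : 0 < c -> S^T = S ->
  (forall x, `|qform S x| <= c * mx_inner x x) -> op_le c S.
Proof.
move=> c0 sS h x; set y := c^-1 *: (S *m x).
have h1 := h (x + y); have h2 := h (x + - y).
move: h1 h2; rewrite !qformD// qformN !ler_norml => /andP[_ h1] /andP[h2 _].
have e : mx_inner y (S *m x) = c^-1 * mx_inner (S *m x) (S *m x).
  by rewrite /y mx_innerZl.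
have ey : mx_inner y y = c^-1 * (c^-1 * mx_inner (S *m x) (S *m x)).
  by rewrite /y mx_innerZl mx_innerZr.
move: h1 h2; rewrite !mx_innerNl !(mx_innerDl, mx_innerDr) !(mx_innerNl, mx_innerNr).
rewrite (mx_innerC y x) e ey; set w := mx_inner (S *m x) _.
set i := mx_inner x y; set xx := mx_inner x x => h1 h2.
have h3 : 4 * (c^-1 * w) <= c * (2 * xx + 2 * (c^-1 * (c^-1 * w))) by lra.
have h4 : 2 * w <= 2 * (c ^+ 2 * xx).
  have := h3; rewrite -(ler_pM2l c0) => h5.
  have e1 : c * (4 * (c^-1 * w)) = 4 * w by field; rewrite gt_eqF.
  have e2 : c * (c * (2 * xx + 2 * (c^-1 * (c^-1 * w)))) = 2 * (c ^+ 2 * xx) + 2 * w.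
    by field; rewrite gt_eqF.
  by move: h5; rewrite e1 e2; lra.
lra.
Qed.

(** This bounds the operator norm of [S - 1] by [e]; the quadratic form is the
    quantity that a finite net can control. *)
Definition near_id n (e : R) (S : 'M[R]_n) : Prop :=
  S^T = S /\ forall x, `|qform (S - 1%:M) x| <= e * mx_inner x x.

Lemma qformB1 n (S : 'M[R]_n) x : qform (S - 1%:M) x = qform S x - mx_inner x x.
Proof. by rewrite /qform mulmxBl mul1mx mx_innerBr. Qed.

Section NearId.
Variables (n : nat) (S : 'M[R]_n).
Hypothesis hS : near_id (1 / 2) S.

Lemma near_id_qform_ge x : 1 / 2 * mx_inner x x <= qform S x.
Proof.
have := hS.2 x; rewrite qformB1 ler_norml => /andP[h _]; lra.
Qed.

Lemma near_id_qform_le x : qform S x <= 3 / 2 * mx_inner x x.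
Proof.
have := hS.2 x; rewrite qformB1 ler_norml => /andP[_ h]; lra.
Qed.

Lemma near_id_op_le : op_le (3 / 2) S.
Proof.
apply: op_le_qform; [lra|exact: hS.1|move=> x].
have h0 := mx_inner_ge0 x; have h1 := near_id_qform_ge x.
have h2 := near_id_qform_le x; rewrite ger0_norm//; lra.
Qed.

(** [|x|^2 / 2 <= <x, S x> <= |x| |S x|]. *)
Lemma near_id_mul_ge (x : 'cV[R]_n) :
  mx_inner x x <= 4 * mx_inner (S *m x) (S *m x).
Proof.
have [x0|x0] := eqVneq (mx_inner x x) 0.
  by rewrite x0 mulr_ge0// mx_inner_ge0.
have xp : 0 < mx_inner x x by rewrite lt0r x0 mx_inner_ge0.
have h := near_id_qform_ge x.
have h2 : (1 / 2 * mx_inner x x) ^+ 2 <= qform S x ^+ 2.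
  by rewrite ler_pXn2r// nnegrE; lra.
have h3 := mx_inner_sqr_le x (S *m x); rewrite -/(qform S x) in h3.
rewrite -(ler_pM2l xp); move: h2; rewrite exprMn !expr2 in h3 *; lra.
Qed.

Lemma near_id_unitmx : S \in unitmx.
Proof.
rewrite -unitmx_tr -row_free_unit -kermx_eq0; apply/eqP/row_matrixP => i.
set v := row i _.
have v0 : S *m v^T = 0.
  apply: trmx_inj; rewrite trmx_mul trmxK trmx0.
  by rewrite /v -row_mul mulmx_ker row0.
have := near_id_mul_ge v^T; rewrite v0 /mx_inner trmx0 mulmx0 mxtrace0 mulr0.
rewrite -/(mx_inner v^T v^T) => h.
have : v^T = 0 by apply: mx_inner_eq0; apply/eqP; rewrite eq_le h mx_inner_ge0.
by move=> /(congr1 trmx); rewrite trmxK trmx0 row0.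
Qed.

Lemma near_id_inv_sym : (invmx S)^T = invmx S.
Proof. by rewrite trmx_inv hS.1. Qed.

Lemma near_id_inv_op_le : op_le 2 (invmx S).
Proof.
move=> x; have := near_id_mul_ge (invmx S *m x).
rewrite mulmxA mulmxV ?near_id_unitmx// mul1mx => h.
by rewrite (_ : 2 ^+ 2 = 4)//; ring.
Qed.

Lemma near_id_inv_frob : frob_norm (invmx S - 1%:M) <= 2 * frob_norm (S - 1%:M).
Proof.
have -> : invmx S - 1%:M = invmx S *m (1%:M - S).
  by rewrite mulmxBr mulmx1 mulVmx// near_id_unitmx.
rewrite -(frob_normN (S - _)) opprB.
by apply: frob_norm_mulmxl => //; exact: near_id_inv_op_le.
Qed.

Lemma near_id_tr_ge : n%:R / 2 <= \tr S.
Proof.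
rewrite /mxtrace (_ : _ / 2 = \sum_(i < n) (1 / 2)); last first.
  by rewrite sumr_const card_ord -[RHS]mulr_natl div1r.
apply: ler_sum => i _; have := near_id_qform_ge (delta_mx i 0).
rewrite (mx_inner_delta _ (i, 0)) /= mxE !eqxx /= mulr1 => h.
apply: le_trans h _; rewrite qformE trmx_delta -rowE -colE !mxE.
by [].
Qed.

(** With [y = S^-1 e_i], the diagonal entry is [<y, S y> >= |y|^2 / 2], while
    [1 = |S y|^2 <= 9 / 4 * |y|^2]; this gives [2 / 9] for each entry. *)
Lemma near_id_tr_inv_ge : n%:R / 5 <= \tr (invmx S).
Proof.
rewrite /mxtrace (_ : _ / 5 = \sum_(i < n) (1 / 5)); last first.
  by rewrite sumr_const card_ord -[RHS]mulr_natl div1r.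
apply: ler_sum => i _; pose e : 'cV[R]_n := delta_mx i 0.
pose y := invmx S *m e.
have Sy : S *m y = e by rewrite mulmxA mulmxV ?near_id_unitmx// mul1mx.
have ee : mx_inner e e = 1 by rewrite (mx_inner_delta _ (i, 0)) /= mxE !eqxx.
have yi : (invmx S) i i = qform S y.
  rewrite /qform Sy (mx_inner_delta _ (i, 0)) /= /y /e -colE mxE//.
have h1 := near_id_op_le y; rewrite Sy ee in h1.
have h2 := near_id_qform_ge y.
by rewrite yi; lra.
Qed.

End NearId.

End FrobeniusNorm.

(** * Matrices of determinant one *)

Ltac ring_mx := apply/matrixP => ? ?; rewrite !mxE; ring.

Section Cholesky.
Context {R : realType}.

Lemma mx_inner_col_mx m1 m2 n (A C : 'M[R]_(m1, n)) (B D : 'M[R]_(m2, n)) :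
  mx_inner (col_mx A B) (col_mx C D) = mx_inner A C + mx_inner B D.
Proof. by rewrite /mx_inner tr_col_mx mul_col_row mxtrace_block. Qed.

(** Induction on the size, through the Schur complement of the first entry. *)
Lemma cholesky n (P : 'M[R]_n) : P^T = P ->
  (forall x, x != 0 -> 0 < qform P x) ->
  exists L : 'M[R]_n, [/\ \det L = \prod_i L i i, forall i, 0 < L i i
    & L *m L^T = P].
Proof.
elim: n P => [|n IH] P sP pP.
  exists 0; split; first by rewrite det_mx00 big_ord0.
    by case.
  by apply/matrixP => -[].
move: P sP pP; rewrite -[n.+1]/(1 + n)%N => P sP pP.
pose al := P 0 0; pose b : 'M[R]_(n, 1) := dlsubmx P; pose Q : 'M[R]_n := drsubmx P.
have aE : ulsubmx P = al%:M.
  by apply/matrixP => i j; rewrite !ord1 !mxE eqxx mulr1n; congr (P _ _); exact: val_inj.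
have bE : ursubmx P = b^T by rewrite /b trmx_dlsub sP.
have QE : Q^T = Q by rewrite /Q trmx_drsub sP.
have PE : P = block_mx al%:M b^T b Q by rewrite -aE -bE submxK.
have qE (y : 'M[R]_1) (x : 'cV[R]_n) : qform P (col_mx y x) =
    mx_inner y (al *: y + b^T *m x) + mx_inner x (b *m y + Q *m x).
  by rewrite /qform PE mul_block_col mul_scalar_mx mx_inner_col_mx.
have al0 : 0 < al.
  have := pP (col_mx 1%:M 0); rewrite qE !mulmx0 addr0 mulmx1.
  rewrite {1}/mx_inner [X in _ + X]/mx_inner mul0mx mxtrace0 addr0.
  rewrite linearZ /= trmx1 mul1mx mxtraceZ mxtrace1 mulr1; apply.
  apply/eqP => /(congr1 (fun M : 'cV[R]_(1 + n) => usubmx M)).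
  rewrite col_mxKu linear0 => /matrixP /(_ 0 0)/eqP.
  by rewrite !mxE eqxx oner_eq0.
have aln : al != 0 by rewrite gt_eqF.
pose Q' := Q - al^-1 *: (b *m b^T).
have sQ' : Q'^T = Q'.
  by rewrite /Q' linearB linearZ /= trmx_mul trmxK QE.
have pQ' x : x != 0 -> 0 < qform Q' x.
  move=> x0; pose y : 'M[R]_1 := - al^-1 *: (b^T *m x).
  have := pP (col_mx y x); rewrite qE.
  have -> : al *: y + b^T *m x = 0.
    by rewrite /y scalerA mulrN divff// scaleN1r addNr.
  have -> : b *m y + Q *m x = Q' *m x.
    rewrite /y /Q' mulmxBl -scalemxAr -scalemxAl mulmxA addrC.
    by rewrite scaleNr.
  rewrite {1}/mx_inner trmx0 mulmx0 mxtrace0 add0r; apply.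
  apply: contraNneq x0 => /(congr1 (fun M : 'cV[R]_(1 + n) => dsubmx M)).
  by rewrite col_mxKd linear0 => ->.
have [L' [dL' pL' L'E]] := IH Q' sQ' pQ'.
pose r := Num.sqrt al; have r0 : 0 < r by rewrite sqrtr_gt0.
have rn : r != 0 by rewrite gt_eqF.
have rr : r * r = al by rewrite -expr2 sqr_sqrtr// ltW.
pose L : 'M[R]_(1 + n) := block_mx r%:M 0 (r^-1 *: b) L'.
have L0 : L (lshift n 0) (lshift n 0) = r by rewrite block_mxEul mxE eqxx.
have LS i : L (rshift 1 i) (rshift 1 i) = L' i i by rewrite block_mxEdr.
exists L; split.
- rewrite det_lblock det_scalar1 dL' big_split_ord /= big_ord1 L0.
  by congr (_ * _); apply: eq_bigr => i _; rewrite LS.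
- move=> i; rewrite -(splitK i); case: (fintype.split i) => j /=.
    by rewrite ord1 L0.
  by rewrite LS.
- rewrite PE /L tr_block_mx mulmx_block !trmx0 !mul0mx !mulmx0 !addr0.
  rewrite tr_scalar_mx -scalar_mxM rr; congr block_mx.
  + by rewrite mul_scalar_mx linearZ /= scalerA divff// scale1r.
  + by rewrite mul_mx_scalar scalerA divff// scale1r.
  + rewrite linearZ /= -scalemxAl -scalemxAr scalerA -invfM rr L'E /Q'.
    by rewrite addrC subrK.
Qed.

(** Multiply the inequalities [l i <= expR (l i - 1)]. *)
Lemma prod1_sum_ge n (l : 'I_n -> R) : (forall i, 0 < l i) ->
  \prod_i l i = 1 -> n%:R <= \sum_i l i.
Proof.
move=> l0 l1.
have : \prod_i l i <= \prod_i expR (l i - 1).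
  apply: ler_prod => i _; rewrite ltW//=.
  by have := expR_ge1Dx (l i - 1); rewrite addrC subrK.
rewrite l1 -expR_sum -expR0 ler_expR sumrB sumr_const card_ord.
by rewrite subr_ge0.
Qed.

(** Up to an orthogonal factor, a matrix of determinant one is as close to the
    identity as its Frobenius norm is to the least possible value: take the
    Cholesky factor [L] of [G G^T], whose diagonal has product one. *)
Lemma near_orthogonal_factor n (G : 'M[R]_n) : \det G ^+ 2 = 1 ->
  exists L U : 'M[R]_n, [/\ U^T *m U = 1%:M, U *m U^T = 1%:M, G = L *m U
    & mx_inner (L - 1%:M) (L - 1%:M) <= mx_inner G G - n%:R].
Proof.
move=> dG.
have uG : G \in unitmx.
  rewrite unitmxE unitfE; apply/eqP => dG0; move: dG.
  by rewrite dG0 expr0n => /esym/eqP; rewrite oner_eq0.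
have [|x x0|L [dL pL LE]] := @cholesky n (G *m G^T).
- by rewrite trmx_mul trmxK.
- rewrite /qform -mulmxA mx_innerC mx_innerMr lt0r mx_inner_ge0 andbT.
  apply: contraNneq x0 => /mx_inner_eq0 h.
  have : invmx G^T *m (G^T *m x) = 0 by rewrite h mulmx0.
  by rewrite mulKmx ?unitmx_tr// => ->.
have pd : 0 < \prod_i L i i by exact: prodr_gt0.
have dL1 : \prod_i L i i = 1.
  have : \det L ^+ 2 = 1 by rewrite expr2 -{2}det_tr -det_mulmx LE det_mulmx det_tr.
  rewrite dL => /eqP; rewrite sqrf_eq1 => /orP[/eqP//|/eqP h].
  by move: pd; rewrite h; lra.
have uL : L \in unitmx by rewrite unitmxE dL dL1 unitr1.
pose U := invmx L *m G.
have UU : U *m U^T = 1%:M.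
  rewrite /U trmx_mul -mulmxA (mulmxA G) -LE -mulmxA trmx_inv.
  by rewrite mulmxV ?unitmx_tr// mulmx1 mulVmx.
exists L, U; split => //; first exact: mulmx1C.
  by rewrite /U mulKVmx.
have trL : n%:R <= \tr L by exact: prod1_sum_ge.
have LL : mx_inner L L = mx_inner G G by rewrite /mx_inner LE.
rewrite !(mx_innerBl, mx_innerBr) LL (mx_innerC 1%:M L) !mx_inner1 mxtrace1.
lra.
Qed.

Section Distortion.
Variables (n : nat) (G : 'M[R]_n).
Hypothesis dG : \det G ^+ 2 = 1.
Let D := mx_inner G G - n%:R.

Lemma distortion_ge0 : 0 <= D.
Proof.
have [L [U [_ _ _ h]]] := near_orthogonal_factor dG.
exact: le_trans (mx_inner_ge0 _) h.
Qed.

Let factor : exists L U : 'M[R]_n, [/\ U^T *m U = 1%:M, U *m U^T = 1%:M,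
  G = L *m U & frob_norm (L - 1%:M) <= Num.sqrt D].
Proof.
have [L [U [h1 h2 h3 h4]]] := near_orthogonal_factor dG.
exists L, U; split => //; apply: frob_norm_le; first exact: sqrtr_ge0.
by rewrite sqr_sqrtr// distortion_ge0.
Qed.

Let sqrtD2 : Num.sqrt D * Num.sqrt D = D.
Proof. by rewrite -expr2 sqr_sqrtr// distortion_ge0. Qed.

Let frob_le_mul m k l (A : 'M[R]_(m, k)) (B : 'M[R]_(k, l)) :
  frob_norm (A *m B) <= frob_norm A * frob_norm B.
Proof.
by apply: frob_norm_mulmxl; [exact: frob_norm_ge0|exact: op_le_frob].
Qed.

Lemma distortion_frob : frob_norm (G *m G^T - 1%:M) <= 2 * Num.sqrt D + D.
Proof.
have [L [U [h1 h2 GE hL]]] := factor; pose K := L - 1%:M.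
have KT : K^T = L^T - 1%:M by rewrite /K linearB /= trmx1.
have -> : G *m G^T - 1%:M = (K + K^T) + K *m K^T.
  rewrite GE trmx_mul mulmxA -(mulmxA L) h2 mulmx1 KT /K.
  rewrite mulmxBl !mulmxBr !mul1mx mulmx1; move: (L *m L^T) => LL.
  ring_mx.
have h3 := frob_normD (K + K^T) (K *m K^T).
have h4 := frob_normD K K^T; have h5 := frob_le_mul K K^T.
rewrite frob_normT in h4 h5.
have h6 : frob_norm K * frob_norm K <= D.
  by rewrite -sqrtD2; apply: ler_pM => //; exact: frob_norm_ge0.
by rewrite -/K in hL; lra.
Qed.

(** Conjugation by [U] fixes the identity, so it moves [V] by at most twice its
    distance to the identity; the other terms are the cost of [L]. *)
Lemma distortion_conj (V : 'M[R]_n) : op_le 2 V -> V^T = V ->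
  frob_norm (G^T *m V *m G - V) <=
    2 * frob_norm (V - 1%:M) + 4 * Num.sqrt D + 2 * D.
Proof.
move=> oV sV; have [L [U [h1 h2 GE hL]]] := factor; pose K := L - 1%:M.
have oU : op_le 1 U by exact: op_le_orth.
have oUT : op_le 1 U^T by exact: op_leT.
have LE : L = 1%:M + K by rewrite /K addrC subrK.
have GT : G^T = U^T *m L^T by rewrite GE trmx_mul.
pose N1 := (K^T *m V + V *m K) + K^T *m V *m K.
have LT : L^T = 1%:M + K^T by rewrite LE linearD /= trmx1.
have e1 : L^T *m V *m L = V + N1.
  rewrite LT LE mulmxDl mul1mx mulmxDr mulmx1 mulmxDl /N1.
  move: (K^T *m V *m K) (K^T *m V) (V *m K) => X1 X2 X3; ring_mx.
have e2 : U^T *m V *m U - V = U^T *m (V - 1%:M) *m U - (V - 1%:M).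
  rewrite mulmxBr mulmx1 mulmxBl h1.
  move: (U^T *m V *m U) => X1; ring_mx.
have -> : G^T *m V *m G - V =
    U^T *m N1 *m U + (U^T *m (V - 1%:M) *m U - (V - 1%:M)).
  rewrite -e2 GT {1}GE (_ : _ *m (L *m U) = U^T *m (L^T *m V *m L) *m U).
    rewrite e1 mulmxDr mulmxDl.
    move: (U^T *m V *m U) (U^T *m N1 *m U) => X1 X2; ring_mx.
  by rewrite !mulmxA.
have c1 (M : 'M[R]_n) : frob_norm (U^T *m M *m U) <= frob_norm M.
  have := frob_norm_mulmxr (U^T *m M) ler01 oU; rewrite mul1r => h.
  apply: le_trans h _.
  by have := frob_norm_mulmxl M ler01 oUT; rewrite mul1r.
have h3 := frob_normD (U^T *m N1 *m U) (U^T *m (V - 1%:M) *m U - (V - 1%:M)).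
have h4 := frob_normB (U^T *m (V - 1%:M) *m U) (V - 1%:M).
have h5 := c1 N1; have h6 := c1 (V - 1%:M).
have h7 := frob_normD (K^T *m V + V *m K) (K^T *m V *m K).
have h8 := frob_normD (K^T *m V) (V *m K).
have h9 := frob_norm_mulmxr K^T (ler0n R 2) oV.
have h10 := frob_norm_mulmxl K (ler0n R 2) oV.
have h11 := frob_le_mul (K^T *m V) K.
have h12 : frob_norm (K^T *m V) * frob_norm K <= 2 * D.
  have := frob_norm_ge0 K => k0; rewrite -/K in hL; rewrite frob_normT in h9.
  apply: (@le_trans _ _ (2 * frob_norm K * frob_norm K)).
    by rewrite ler_wpM2r.
  by rewrite -mulrA ler_wpM2l// -sqrtD2; apply: ler_pM.
rewrite frob_normT in h9; rewrite -/K in hL; rewrite -/N1 in h7; lra.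
Qed.

(** With [E = L - 1], [G G^T - 1 = E L^T + E^T]. Each term meets [E] between
    [A] and either [A] or [A L], two matrices of norm at most one, so the inverse
    of [A] does not enter. *)
Lemma distortion_loss m (A : 'M[R]_(m, n)) : op_le 1 A -> op_le 1 (A *m G) ->
  frob_norm (A *m (G *m G^T - 1%:M) *m A^T) <= 2 * Num.sqrt D.
Proof.
move=> oA oAG; have [L [U [h1 h2 GE hL]]] := factor; pose K := L - 1%:M.
pose B := A *m L.
have oB : op_le 1 B.
  have -> : B = A *m G *m U^T by rewrite GE -!mulmxA h2 mulmx1.
  rewrite -[X in op_le X _](mulr1 1); apply: op_leM => //.
  by apply: op_leT => //; exact: op_le_orth.
have -> : A *m (G *m G^T - 1%:M) *m A^T = A *m K *m B^T + A *m (A *m K)^T.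
  have KT : K^T = L^T - 1%:M by rewrite /K linearB /= trmx1.
  rewrite GE trmx_mul mulmxA -(mulmxA L) h2 mulmx1 /B !trmx_mul KT /K.
  rewrite !(mulmxBr, mulmxBl) !(mulmx1, mul1mx) !mulmxA.
  move: (A *m L *m L^T *m A^T) (A *m L^T *m A^T) (A *m A^T) => X1 X2 X3.
  ring_mx.
have h3 := frob_normD (A *m K *m B^T) (A *m (A *m K)^T).
have h4 := frob_norm_mulmxr (A *m K) ler01 (op_leT ler01 oB).
have h5 := frob_norm_mulmxl (A *m K)^T ler01 oA.
have h6 := frob_norm_mulmxl K ler01 oA.
rewrite frob_normT in h5; rewrite -/K in hL; lra.
Qed.

End Distortion.
End Cholesky.

(** * Concentration along a quarter circle *)

Section MeasurableMatrix.
Context {R : realType} d (T : measurableType d).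

Lemma measurable_mx_entry m n (f : T -> 'M[R]_(m, n)) i j :
  measurable_fun setT f -> measurable_fun setT (fun x => f x i j).
Proof. by move=> mf; exact: (measurableT_comp (measurable_entry i j) mf). Qed.

Lemma measurable_mx_inner m n (f g : T -> 'M[R]_(m, n)) :
  measurable_fun setT f -> measurable_fun setT g ->
  measurable_fun setT (fun x => mx_inner (f x) (g x)).
Proof.
move=> mf mg; under eq_fun do rewrite mx_innerE.
by apply: measurable_sum => p; apply: measurable_funM; exact: measurable_mx_entry.
Qed.

Lemma measurable_mulmx m n k (f : T -> 'M[R]_(m, n)) (g : T -> 'M[R]_(n, k)) :
  measurable_fun setT f -> measurable_fun setT g ->
  measurable_fun setT (fun x => f x *m g x).
Proof.
move=> mf mg; apply: measurable_fun_matrixP => i j.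
under eq_fun do rewrite mxE.
by apply: measurable_sum => p; apply: measurable_funM; exact: measurable_mx_entry.
Qed.

Lemma measurable_trmx m n (f : T -> 'M[R]_(m, n)) :
  measurable_fun setT f -> measurable_fun setT (fun x => (f x)^T).
Proof.
move=> mf; apply: measurable_fun_matrixP => i j.
by under eq_fun do rewrite mxE; exact: measurable_mx_entry.
Qed.

Lemma measurable_addmx m n (f g : T -> 'M[R]_(m, n)) :
  measurable_fun setT f -> measurable_fun setT g ->
  measurable_fun setT (fun x => f x + g x).
Proof.
move=> mf mg; apply: measurable_fun_matrixP => i j.
under eq_fun do rewrite mxE.
by apply: measurable_funD; exact: measurable_mx_entry.
Qed.

Lemma measurable_scalemx m n (a : T -> R) (f : T -> 'M[R]_(m, n)) :
  measurable_fun setT a -> measurable_fun setT f ->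
  measurable_fun setT (fun x => a x *: f x).
Proof.
move=> ma mf; apply: measurable_fun_matrixP => i j.
under eq_fun do rewrite mxE.
by apply: measurable_funM => //; exact: measurable_mx_entry.
Qed.

Lemma measurable_lsubmx m n k (f : T -> 'M[R]_(m, n + k)) :
  measurable_fun setT f -> measurable_fun setT (fun x => lsubmx (f x)).
Proof.
move=> mf; apply: measurable_fun_matrixP => i j.
by under eq_fun do rewrite mxE; exact: measurable_mx_entry.
Qed.

Lemma measurable_rsubmx m n k (f : T -> 'M[R]_(m, n + k)) :
  measurable_fun setT f -> measurable_fun setT (fun x => rsubmx (f x)).
Proof.
move=> mf; apply: measurable_fun_matrixP => i j.
by under eq_fun do rewrite mxE; exact: measurable_mx_entry.
Qed.

End MeasurableMatrix.

Lemma measurable_lsub (R : realType) d m n : measurable_fun setT (@lsubmx R d m n).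
Proof. exact: (measurable_lsubmx (f := fun Z : 'M[R]_(d, m + n) => Z)). Qed.

Lemma measurable_rsub (R : realType) d m n : measurable_fun setT (@rsubmx R d m n).
Proof. exact: (measurable_rsubmx (f := fun Z : 'M[R]_(d, m + n) => Z)). Qed.

Section Arc.
Context {R : realType}.
Implicit Types u v : R.

(** Rational parametrization of the quarter circle, which keeps all estimates
    algebraic. *)
Definition arcc u := (1 - u ^+ 2) / (1 + u ^+ 2).
Definition arcs u := 2 * u / (1 + u ^+ 2).
Definition arc_sin u v := arcc u * arcs v - arcs u * arcc v.
Definition arc_cos u v := arcc u * arcc v + arcs u * arcs v.

Let den u : 0 < 1 + u ^+ 2. Proof. by have := sqr_ge0 u; lra. Qed.
Let den0 u : 1 + u ^+ 2 != 0. Proof. by rewrite gt_eqF. Qed.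

Lemma arc_sqr u : arcc u ^+ 2 + arcs u ^+ 2 = 1.
Proof. by rewrite /arcc /arcs; field. Qed.

Lemma arcc_ge0 u : 0 <= u <= 1 -> 0 <= arcc u.
Proof.
move=> /andP[u0 u1]; apply: divr_ge0; last exact: ltW.
by rewrite subr_ge0 expr_le1.
Qed.

Lemma arcs_ge0 u : 0 <= u -> 0 <= arcs u.
Proof. by move=> u0; apply: divr_ge0; [rewrite mulr_ge0|exact: ltW]. Qed.

Lemma arc_sincos u v : arc_cos u v ^+ 2 + arc_sin u v ^+ 2 = 1.
Proof. by rewrite /arc_cos /arc_sin /arcc /arcs; field; rewrite !den0. Qed.

Lemma arc_cos_ge0 u v : 0 <= u <= 1 -> 0 <= v <= 1 -> 0 <= arc_cos u v.
Proof.
move=> u01 v01; have /andP[u0 _] := u01; have /andP[v0 _] := v01.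
by rewrite addr_ge0// mulr_ge0// ?arcc_ge0// arcs_ge0.
Qed.

Lemma arc_sinE u v :
  arc_sin u v = 2 * (v - u) * (1 + u * v) / ((1 + u ^+ 2) * (1 + v ^+ 2)).
Proof. by rewrite /arc_sin /arcc /arcs; field; rewrite !den0. Qed.

Lemma arc_sin_ge0 u v : 0 <= u -> u <= v -> 0 <= arc_sin u v.
Proof.
move=> u0 uv; have v0 := le_trans u0 uv; rewrite arc_sinE; apply: divr_ge0.
  by rewrite !mulr_ge0// ?subr_ge0// addr_ge0// mulr_ge0.
by rewrite mulr_ge0// ltW.
Qed.

Lemma arc_sin_le u v : 0 <= u -> u <= v -> arc_sin u v <= 2 * (v - u).
Proof.
move=> u0 uv; have v0 := le_trans u0 uv; rewrite arc_sinE.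
rewrite ler_pdivrMr ?mulr_gt0// ler_wpM2l//.
  by rewrite mulr_ge0// subr_ge0.
have h1 : 0 <= (u - v) ^+ 2 by exact: sqr_ge0.
have h2 : 0 <= u ^+ 2 * v ^+ 2 by rewrite mulr_ge0 ?sqr_ge0.
have h3 : 0 <= u * v by rewrite mulr_ge0.
have h4 : (u - v) ^+ 2 = u ^+ 2 - 2 * (u * v) + v ^+ 2 by ring.
have h5 : (1 + u ^+ 2) * (1 + v ^+ 2) = 1 + u ^+ 2 + v ^+ 2 + u ^+ 2 * v ^+ 2 by ring.
by rewrite h5; lra.
Qed.

Lemma arc_sin_le1 u v : arc_sin u v <= 1.
Proof.
have := arc_sincos u v; have := sqr_ge0 (arc_cos u v).
set s := arc_sin u v => h1 h2; have h3 : 0 <= (1 - s) ^+ 2 by exact: sqr_ge0.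
have e : (1 - s) ^+ 2 = 1 - 2 * s + s ^+ 2 by ring.
lra.
Qed.

Lemma arc_cos_close u v : 0 <= u <= 1 -> 0 <= v <= 1 ->
  0 <= 1 - arc_cos u v <= arc_sin u v ^+ 2.
Proof.
move=> u01 v01; have c0 := arc_cos_ge0 u01 v01; have e := arc_sincos u v.
have c1 : arc_cos u v <= 1.
  have h : arc_cos u v ^+ 2 <= 1 by have := sqr_ge0 (arc_sin u v); lra.
  by rewrite -(@ler_pXn2r _ 2)// ?nnegrE// expr1n.
apply/andP; split; first by rewrite subr_ge0.
have h : 0 <= arc_cos u v * (1 - arc_cos u v) by rewrite mulr_ge0// subr_ge0.
have e2 : arc_cos u v * (1 - arc_cos u v) = arc_cos u v - arc_cos u v ^+ 2 by ring.
lra.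
Qed.

(** Sum the tangent line inequalities at the mean. *)
Lemma expR_average N (y : 'I_N -> R) : (0 < N)%N ->
  expR (N%:R^-1 * \sum_k y k) <= N%:R^-1 * \sum_k expR (y k).
Proof.
move=> N0; set yb := N%:R^-1 * _.
have Nn : (N%:R : R) != 0 by rewrite pnatr_eq0 -lt0n.
have h k : expR yb * (1 + (y k - yb)) <= expR (y k).
  rewrite (_ : expR (y k) = expR yb * expR (y k - yb)); last first.
    by rewrite -expRD addrC subrK.
  rewrite ler_wpM2l ?expR_ge0//.
  exact: expR_ge1Dx.
have : \sum_k expR yb * (1 + (y k - yb)) <= \sum_k expR (y k).
  by apply: ler_sum => k _; exact: h.
rewrite -mulr_sumr big_split/= sumrB !sumr_const card_ord => h2.
have e : \sum_k y k = N%:R * yb by rewrite /yb mulrA divff// mul1r.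
rewrite e -(mulr_natl yb) subrr addr0 in h2.
rewrite -(ler_pM2l (_ : 0 < N%:R)) ?ltr0n// mulrA divff// mul1r.
by rewrite mulrC.
Qed.

End Arc.

Section Chain.
Context {R : realType} {d m : nat}.
Variable mu : probability 'M[R]_(d, m) R.
Hypothesis gmu : gaussian_law mu.

Lemma gaussian_mgf_inner (v : 'M[R]_(d, m)) :
  (\int[mu]_x (expR (mx_inner v x))%:E = (expR (mx_inner v v / 2))%:E)%E.
Proof.
have h := @gaussian_mgf_linear R d m mu gmu (index_enum _) (fun=> 1%E)
  (fun p _ => v p.1 p.2) (index_enum_uniq _) (measurable_cst _) (fun=> lee01)
  (fun _ _ _ _ => erefl) (fun=> measurable_cst _) (fun _ _ _ _ _ => erefl).
transitivity (\int[mu]_x (1 * (expR (\sum_p x p.1 p.2 * v p.1 p.2))%:E))%E.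
  by apply: eq_integral => x _; rewrite mul1e mx_innerC mx_innerE.
apply: (eq_trans h).
transitivity (\int[mu]_x (expR (mx_inner v v / 2))%:E)%E.
  apply: eq_integral => x _; rewrite mul1e mx_innerE mulr_suml.
  by congr (expR _)%:E; apply: eq_bigr => p _; rewrite expr2.
rewrite integral_cst//; apply: (eq_trans (congr1 (mule _) (probability_setT mu))).
exact: mule1.
Qed.

Local Notation nu := (joint_law mu mu).

Definition rotate_pair (a b : R) (z : 'M[R]_(d, m + m)) : 'M[R]_(d, m + m) :=
  row_mx (a *: lsubmx z + b *: rsubmx z) (a *: rsubmx z - b *: lsubmx z).

Lemma mx_inner_row_mx (A C : 'M[R]_(d, m)) (B D : 'M[R]_(d, m)) :
  mx_inner (row_mx A B) (row_mx C D) = mx_inner A C + mx_inner B D.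
Proof. by rewrite /mx_inner tr_row_mx mul_row_col mxtraceD. Qed.

Lemma rotate_pair_isometry a b : a ^+ 2 + b ^+ 2 = 1 ->
  linear_isometry (rotate_pair a b).
Proof.
move=> ab1; split=> [c u v|u].
  rewrite /rotate_pair scale_row_mx add_row_mx.
  by congr row_mx; apply/matrixP => i j; rewrite !mxE; ring.
rewrite -[in RHS](hsubmxK u) !mx_inner_row_mx.
rewrite !(mx_innerDl, mx_innerDr, mx_innerNl, mx_innerNr).
rewrite !(mx_innerZl, mx_innerZr) (mx_innerC (rsubmx u) (lsubmx u)).
set x := mx_inner _ _; set y := mx_inner (lsubmx u) (rsubmx u).
set w := mx_inner (rsubmx u) _.
transitivity ((a ^+ 2 + b ^+ 2) * (x + w)); first by ring.
by rewrite ab1 mul1r.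
Qed.

Lemma rotate_pair_invariant a b (F : 'M[R]_(d, m + m) -> \bar R) :
  a ^+ 2 + b ^+ 2 = 1 -> measurable_fun setT F -> (forall x, 0 <= F x)%E ->
  (\int[nu]_z F (rotate_pair a b z) = \int[nu]_z F z)%E.
Proof.
move=> ab1; apply: gaussian_isometry_invariant.
  exact: gaussian_joint_law.
exact: rotate_pair_isometry.
Qed.

Lemma measurable_rotate_pair a b : a ^+ 2 + b ^+ 2 = 1 ->
  measurable_fun setT (rotate_pair a b).
Proof. by move=> ab1; exact: measurable_isometry (rotate_pair_isometry ab1). Qed.

Section ChainBound.
Variables (psi : 'M[R]_(d, m) -> R) (g : 'M[R]_(d, m) -> 'M[R]_(d, m)).
Hypothesis mpsi : measurable_fun setT psi.
Hypothesis mg : measurable_fun setT g.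
Variables (E : set 'M[R]_(d, m + m)) (K L : R).
Hypothesis mE : measurable E.
Hypothesis K0 : 0 <= K.
Hypothesis L0 : 0 < L.

(** Together with [arc_velocity], its derivative in the angle, this is the image
    of the pair by [rotate_pair], hence again a pair of independent samples. *)
Definition arc_point (u : R) (z : 'M[R]_(d, m + m)) : 'M[R]_(d, m) :=
  arcc u *: lsubmx z + arcs u *: rsubmx z.

Definition arc_velocity (u : R) (z : 'M[R]_(d, m + m)) : 'M[R]_(d, m) :=
  arcc u *: rsubmx z - arcs u *: lsubmx z.

Hypothesis step : forall z u v, E z -> 0 <= u -> u <= v -> v <= 1 ->
  psi (arc_point v z) - psi (arc_point u z) <=
    arc_sin u v * mx_inner (g (arc_point u z)) (arc_velocity u z)
    + K * arc_sin u v ^+ 2.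
Hypothesis grad : forall z u, E z -> 0 <= u <= 1 ->
  mx_inner (g (arc_point u z)) (g (arc_point u z)) <= L ^+ 2.

Let A : set 'M[R]_(d, m) := [set x | mx_inner (g x) (g x) <= L ^+ 2].

Let mA : measurable A.
Proof. by apply: measurable_le_set => //; exact: measurable_mx_inner. Qed.

Let H (c : R) (z : 'M[R]_(d, m + m)) : \bar R :=
  (\1_A (lsubmx z) * expR (c * mx_inner (g (lsubmx z)) (rsubmx z)))%:E.

Let mls : measurable_fun setT (fun z : 'M[R]_(d, m + m) => lsubmx z).
Proof. exact: measurable_lsubmx. Qed.

Let mrs : measurable_fun setT (fun z : 'M[R]_(d, m + m) => rsubmx z).
Proof. exact: measurable_rsubmx. Qed.

Let mH c : measurable_fun setT (H c).
Proof.
apply/measurable_EFinP; apply: measurable_funM.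
  have mi : measurable_fun setT (\1_A : _ -> R) by exact: measurable_indic.
  exact: (measurableT_comp mi mls).
apply: measurableT_comp => //; apply: measurable_funM => //.
by apply: measurable_mx_inner => //; exact: (measurableT_comp mg mls).
Qed.

Let H0 c z : (0 <= H c z)%E.
Proof. by rewrite lee_fin mulr_ge0// expR_ge0. Qed.

Let HL c : (\int[nu]_z H c z <= (expR (c ^+ 2 * L ^+ 2 / 2))%:E)%E.
Proof.
rewrite (integral_joint_law mu mu (mH c) (H0 c)).
apply: (@le_trans _ _ (\int[mu]_x (expR (c ^+ 2 * L ^+ 2 / 2))%:E)%E); last first.
  rewrite integral_cst//.
  by rewrite (eq_trans (congr1 (mule _) (probability_setT mu)) (mule1 _)).
have mH2 : measurable_fun setT
    (fun z : 'M[R]_(d, m) * 'M[R]_(d, m) => H c (row_mx z.1 z.2)).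
  exact: (measurableT_comp (mH c) (@measurable_join_samples R d m m)).
apply: ge0_le_integral => //.
- by move=> x _; exact: integral_ge0.
- exact: (@measurable_fun_fubini_tonelli_F _ _ _ _ R mu _ mH2 (fun=> H0 _ _)).
move=> x _; have [xA|xA] := pselect (A x); last first.
  rewrite integral0_eq ?lee_fin ?expR_ge0// => y _.
  by rewrite /H row_mxKl indicE memNset// mul0r.
have -> : (\int[mu]_y H c (row_mx x y) =
    \int[mu]_y (expR (mx_inner (c *: g x) y))%:E)%E.
  apply: eq_integral => y _.
  by rewrite /H row_mxKl row_mxKr indicE mem_set// mul1r mx_innerZl.
rewrite gaussian_mgf_inner lee_fin ler_expR mx_innerZl mx_innerZr mulrA -expr2.
by rewrite ler_wpM2r ?invr_ge0// ler_wpM2l// sqr_ge0.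
Qed.

Let pt N (k : nat) : R := k%:R / N%:R.

Let ab1 (u : R) := arc_sqr u.

Let pointE u z : arc_point u z = lsubmx (rotate_pair (arcc u) (arcs u) z).
Proof. by rewrite row_mxKl. Qed.

Let velocityE u z : arc_velocity u z = rsubmx (rotate_pair (arcc u) (arcs u) z).
Proof. by rewrite row_mxKr. Qed.

Let point0 z : arc_point 0 z = lsubmx z.
Proof.
rewrite /arc_point /arcc /arcs expr0n /= mulr0 subr0 addr0 mul0r divr1.
by rewrite scale0r addr0 scale1r.
Qed.

Let point1 z : arc_point 1 z = rsubmx z.
Proof.
rewrite /arc_point /arcc /arcs expr1n subrr mul0r scale0r add0r mulr1.
by rewrite (_ : 2 / (1 + 1) = 1) ?scale1r//; field.
Qed.

(* The indicator of [A] equals one along the path; it stands for [E], which does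
   not depend on the position alone. *)
Let chain_sum N z (lam : R) : (0 < N)%N -> 0 <= lam -> E z ->
  expR (lam * (psi (rsubmx z) - psi (lsubmx z))) <=
  N%:R^-1 * \sum_(k < N) (expR (4 * lam * K / N%:R) *
    (\1_A (arc_point (pt N k) z) *
     expR ((N%:R * lam * arc_sin (pt N k) (pt N k.+1)) *
      mx_inner (g (arc_point (pt N k) z)) (arc_velocity (pt N k) z)))).
Proof.
move=> N0 lam0 Ez.
have Np : (0 : R) < N%:R by rewrite ltr0n.
have Nn : (N%:R : R) != 0 by rewrite gt_eqF.
have pt0 k : 0 <= pt N k by rewrite divr_ge0.
have ptS k : pt N k <= pt N k.+1 by rewrite ler_pM2r ?invr_gt0// ler_nat.
have pt1 k : (k <= N)%N -> pt N k <= 1 by move=> kN; rewrite ler_pdivrMr// mul1r ler_nat.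
have ptd k : pt N k.+1 - pt N k = N%:R^-1.
  by rewrite /pt -mulrBl -natrB// subSnn mul1r.
pose D (k : nat) := psi (arc_point (pt N k.+1) z) - psi (arc_point (pt N k) z).
have tel : psi (rsubmx z) - psi (lsubmx z) = \sum_(k < N) D k.
  rewrite -(big_mkord xpredT D) /D (telescope_sumr (fun k => psi (arc_point (pt N k) z)))//.
  by rewrite {1}/pt divff// point1 /pt mul0r point0.
have -> : lam * (psi (rsubmx z) - psi (lsubmx z)) =
    N%:R^-1 * \sum_(k < N) (N%:R * lam * D k).
  by rewrite tel -mulr_sumr -mulrA mulKf.
apply: le_trans (expR_average _ N0) _.
have Ni : 0 <= N%:R^-1 :> R by rewrite invr_ge0 ltW.
rewrite ler_wpM2l//; apply: ler_sum => k _.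
have kN : (k < N)%N by [].
have hA : \1_A (arc_point (pt N k) z) = 1 :> R.
  rewrite indicE mem_set//; apply: grad => //.
  by rewrite pt0 pt1// ltnW.
rewrite hA mul1r -expRD ler_expR.
have hs := step Ez (pt0 k) (ptS k) (pt1 _ kN).
have hs0 := arc_sin_ge0 (pt0 k) (ptS k).
have hs1 := arc_sin_le (pt0 k) (ptS k); rewrite ptd in hs1.
set sn := arc_sin _ _ in hs hs0 hs1 *; set ip := mx_inner _ _ in hs *.
apply: (@le_trans _ _ (N%:R * lam * (sn * ip + K * sn ^+ 2))).
  by rewrite ler_wpM2l// mulr_ge0// ltW.
rewrite mulrDr addrC lerD//; last by rewrite mulrA.
have -> : 4 * lam * K / N%:R = N%:R * lam * (K * (2 * N%:R^-1) ^+ 2).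
  by field.
have Nl : 0 <= N%:R * lam by rewrite mulr_ge0// ltW.
rewrite ler_wpM2l// ler_wpM2l//.
by rewrite ler_pXn2r// nnegrE mulr_ge0.
Qed.

Let mHk c u : measurable_fun setT (fun z => H c (rotate_pair (arcc u) (arcs u) z)).
Proof. exact: (measurableT_comp (mH c) (measurable_rotate_pair (ab1 u))). Qed.

(** A Gaussian concentration inequality for the difference of a function at two
    independent points, localized on the event [E].  Moving from one point to
    the other along a quarter circle in many small steps, every point of the
    path and its velocity are again a pair of independent Gaussian matrices, so
    each step has a Gaussian Laplace transform given the position; convexity of
    the exponential replaces the sum of the steps by the average of these
    transforms, and the second-order remainders vanish in the limit. *)
Theorem chain_concentration (x : R) : 0 < x ->
  (nu (E `&` [set z | (x <= psi (rsubmx z) - psi (lsubmx z))%R]) <=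
   (2 * expR (- (x ^+ 2 / (8 * L ^+ 2))))%:E)%E.
Proof.
move=> x0.
(* [lam] minimizes [2 * lam ^+ 2 * L ^+ 2 - lam * x], and [N] makes the total
   second-order remainder cost at most a factor two. *)
pose lam := x / (4 * L ^+ 2).
have L2 : 0 < L ^+ 2 by rewrite exprn_gt0.
have lam0 : 0 < lam by rewrite divr_gt0// mulr_gt0.
have ln2 : 0 < ln 2 :> R by rewrite ln_gt0// ltr1n.
pose N := (Num.truncn (4 * lam * K / ln 2)).+1.
have N0 : (0 < N)%N by [].
have Np : (0 : R) < N%:R by rewrite ltr0n.
have Nn : (N%:R : R) != 0 by rewrite gt_eqF.
have N2 : expR (4 * lam * K / N%:R) <= 2.
  rewrite -[leRHS]lnK ?posrE// ler_expR ler_pdivrMr// -ler_pdivrMl// mulrC.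
  exact/ltW/truncnS_gt.
set Bad := _ `&` _.
have mBad : measurable Bad.
  apply: measurableI => //; apply: measurable_le_set => //.
  by apply: measurable_funB; exact: (measurableT_comp mpsi).
pose c k := N%:R * lam * arc_sin (pt N k) (pt N k.+1).
pose F k z := H (c k) (rotate_pair (arcc (pt N k)) (arcs (pt N k)) z).
have F0 k z : (0 <= F k z)%E by exact: H0.
have mF k : measurable_fun setT (F k) by exact: mHk.
have FL k : (k < N)%N -> (\int[nu]_z F k z <= (expR (2 * lam ^+ 2 * L ^+ 2))%:E)%E.
  move=> kN; rewrite /F (rotate_pair_invariant (ab1 _) (mH (c k)) (H0 (c k))).
  apply: le_trans (HL (c k)) _; rewrite lee_fin ler_expR.
  have pt0 : 0 <= pt N k by rewrite divr_ge0.
  have ptS : pt N k <= pt N k.+1 by rewrite ler_pM2r ?invr_gt0// ler_nat.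
  have hs0 := arc_sin_ge0 pt0 ptS; have := arc_sin_le pt0 ptS.
  rewrite (_ : pt N k.+1 - pt N k = N%:R^-1); last first.
    by rewrite /pt -mulrBl -natrB// subSnn mul1r.
  move=> hs1; have hc : c k <= 2 * lam.
    rewrite /c (_ : 2 * lam = N%:R * lam * (2 * N%:R^-1)); last by field.
    by rewrite ler_wpM2l// mulr_ge0// ltW.
  have hc0 : 0 <= c k.
    by apply: mulr_ge0 => //; apply: mulr_ge0 => //; exact: ltW.
  have hc2 : c k ^+ 2 <= (2 * lam) ^+ 2.
    by rewrite ler_pXn2r// nnegrE mulr_ge0// ltW.
  have -> : 2 * lam ^+ 2 * L ^+ 2 = (2 * lam) ^+ 2 * L ^+ 2 / 2 by field.
  by rewrite ler_wpM2r ?invr_ge0// ler_wpM2r// ltW.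
pose C := expR (- (lam * x)) * (N%:R^-1 * 2).
have C0 : 0 <= C by rewrite !mulr_ge0 ?expR_ge0// invr_ge0 ltW.
have mS : measurable_fun setT (fun z => (\sum_(k < N) F k z)%E).
  by apply: emeasurable_sum => k; exact: mF.
have S0 z : (0 <= \sum_(k < N) F k z)%E by exact: sume_ge0.
have key : (nu Bad <= C%:E * \int[nu]_z (\sum_(k < N) F k z))%E.
  rewrite -ge0_integralZl_EFin//.
  rewrite -[X in (X <= _)%E]mul1e -(integral_cst nu mBad 1%:E).
  rewrite integral_mkcond; apply: ge0_le_integral => //.
  - by move=> z _; rewrite patchE; case: ifP.
  - apply/(measurable_restrictT _ mBad).
    exact: measurable_cst.
  - by apply: measurable_funeM.
  move=> z _; rewrite patchE; case: ifPn => [|_]; last by rewrite mule_ge0.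
  rewrite inE => -[Ez /= xz].
  rewrite /F /H sumEFin -EFinM lee_fin.
  have := chain_sum N0 (ltW lam0) Ez => h.
  have h1 : 1 <= expR (- (lam * x)) * expR (lam * (psi (rsubmx z) - psi (lsubmx z))).
    by rewrite -expRD -[leLHS]expR0 ler_expR -mulNr addrC mulNr subr_ge0 ler_wpM2l// ltW.
  apply: le_trans h1 _; rewrite /C -[leRHS]mulrA ler_wpM2l ?expR_ge0//.
  apply: le_trans h _; rewrite -[leRHS]mulrA ler_wpM2l ?invr_ge0 ?(ltW Np)//.
  rewrite mulr_sumr; apply: ler_sum => k _.
  rewrite pointE velocityE ler_wpM2r// mulr_ge0// expR_ge0//.
apply: le_trans key _.
rewrite ge0_integral_sum//.
apply: (@le_trans _ _ (C%:E * \sum_(k < N) (expR (2 * lam ^+ 2 * L ^+ 2))%:E)%E).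
  by rewrite lee_wpmul2l// ?lee_fin//; apply: lee_sum => k _; exact: FL.
rewrite sumEFin -EFinM lee_fin sumr_const card_ord -[X in _ * X <= _]mulr_natl /C.
have -> : expR (- (lam * x)) * (N%:R^-1 * 2) * (N%:R * expR (2 * lam ^+ 2 * L ^+ 2))
   = 2 * (expR (- (lam * x)) * expR (2 * lam ^+ 2 * L ^+ 2)) by field.
rewrite -expRD ler_wpM2l// ler_expR le_eqVlt; apply/orP; left; apply/eqP.
by rewrite /lam; field; rewrite gt_eqF.
Qed.

End ChainBound.
End Chain.

(** * Sample covariance at two independent points *)

HB.lock Definition wishart (R : realType) (d m : nat) (Z : 'M[R]_(d, m)) :
  'M[R]_d := m%:R^-1 *: (Z *m Z^T).

(** The polar form of [wishart]. *)
HB.lock Definition cross (R : realType) (d m : nat) (Z V : 'M[R]_(d, m)) :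
  'M[R]_d := m%:R^-1 *: (Z *m V^T + V *m Z^T).

Section Wishart.
Context {R : realType} {d m : nat}.
Hypothesis m0 : (0 < m)%N.
Implicit Types Z V : 'M[R]_(d, m).

Let mp : (0 : R) < m%:R. Proof. by rewrite ltr0n. Qed.
Let mn : (m%:R : R) != 0. Proof. by rewrite gt_eqF. Qed.

Lemma wishart_sym Z : (wishart Z)^T = wishart Z.
Proof. by rewrite wishart.unlock linearZ /= trmx_mul trmxK. Qed.

Lemma wishart_comb a b Z V : wishart (a *: Z + b *: V) =
  a ^+ 2 *: wishart Z + b ^+ 2 *: wishart V + (a * b) *: cross Z V.
Proof.
rewrite wishart.unlock cross.unlock linearD /= !linearZ /= mulmxDl !mulmxDr.
rewrite -!scalemxAl -!scalemxAr.
move: (Z *m Z^T) (Z *m V^T) (V *m Z^T) (V *m V^T) => X1 X2 X3 X4; ring_mx.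
Qed.

Lemma gram_wishart Z : Z *m Z^T = m%:R *: wishart Z.
Proof. by rewrite wishart.unlock scalerA divff// scale1r. Qed.

Lemma cross_inner (B : 'M[R]_d) Z V : B^T = B ->
  mx_inner B (cross Z V) = 2 / m%:R * mx_inner (B *m Z) V.
Proof.
move=> sB; rewrite cross.unlock mx_innerZr mx_innerDr.
have e1 : mx_inner B (V *m Z^T) = mx_inner (B *m Z) V by rewrite mx_innerMl.
have e2 : mx_inner B (Z *m V^T) = mx_inner (B *m Z) V.
  by rewrite -mx_innerT trmx_mul trmxK sB mx_innerMl.
by rewrite e1 e2; ring.
Qed.

Definition diag_mean : R := (Num.sqrt 2)^-1.

Lemma diag_mean_sqr : diag_mean ^+ 2 = 1 / 2.
Proof. by rewrite /diag_mean exprVn sqr_sqrtr// div1r. Qed.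

(** The polar form is recovered from the value at the normalized sum, which is
    why [good_pair] also constrains that point. *)
Lemma crossE Z V : cross Z V =
  2 *: wishart (diag_mean *: Z + diag_mean *: V) - wishart Z - wishart V.
Proof.
rewrite wishart_comb -expr2 diag_mean_sqr.
move: (wishart Z) (wishart V) (cross Z V) => X1 X2 X3.
by apply/matrixP => i j; rewrite !mxE; field.
Qed.

Lemma unit_prod_le (a b : R) : a ^+ 2 + b ^+ 2 = 1 -> `|a * b| <= 1 / 2.
Proof.
move=> h; rewrite ler_norml; apply/andP; split.
  have := sqr_ge0 (a + b); rewrite sqrrD; lra.
have := sqr_ge0 (a - b); rewrite sqrrB; lra.
Qed.

Lemma qformDm n (A B : 'M[R]_n) x : qform (A + B) x = qform A x + qform B x.
Proof. by rewrite /qform mulmxDl mx_innerDr. Qed.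

Lemma qformZm n (A : 'M[R]_n) c x : qform (c *: A) x = c * qform A x.
Proof. by rewrite /qform -scalemxAl mx_innerZr. Qed.

(** If two samples and their normalized sum have sample covariance close to the
    identity, so has every point of the circle through them. *)
Lemma near_id_comb e Z V a b : near_id e (wishart Z) -> near_id e (wishart V) ->
  near_id e (wishart (diag_mean *: Z + diag_mean *: V)) ->
  a ^+ 2 + b ^+ 2 = 1 -> near_id (3 * e) (wishart (a *: Z + b *: V)).
Proof.
move=> [_ hZ] [_ hV] [_ hP] ab1; split=> [|x]; first exact: wishart_sym.
rewrite wishart_comb crossE; set P := wishart (_ + _) in hP *.
set w := mx_inner x x.
have -> : a ^+ 2 *: wishart Z + b ^+ 2 *: wishart V +
    (a * b) *: (2 *: P - wishart Z - wishart V) - 1%:M =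
    (a ^+ 2 - a * b) *: (wishart Z - 1%:M) +
    (b ^+ 2 - a * b) *: (wishart V - 1%:M) + (2 * (a * b)) *: (P - 1%:M).
  have e1 : (1%:M : 'M[R]_d) = (a ^+ 2 + b ^+ 2) *: 1%:M by rewrite ab1 scale1r.
  rewrite {1}e1; clear hP.
  move: (wishart Z) (wishart V) P (1%:M : 'M[R]_d) => X1 X2 X3 X4; ring_mx.
move: hZ hV hP; move: (wishart Z - 1%:M) (wishart V - 1%:M) (P - 1%:M).
move=> D3 D2 D1 /(_ x) h3 /(_ x) h2 /(_ x) h1.
rewrite !(qformDm, qformZm); move: h1 h2 h3; rewrite -/w.
set q1 := qform D1 x; set q2 := qform D2 x; set q3 := qform D3 x => h1 h2 h3.
have hab := unit_prod_le ab1.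
have ew : 0 <= e * w by exact: le_trans (normr_ge0 _) h1.
have n1 : `|a ^+ 2 - a * b| <= a ^+ 2 + 1 / 2.
  apply: le_trans (ler_normB _ _) _; rewrite ger0_norm ?sqr_ge0//; lra.
have n2 : `|b ^+ 2 - a * b| <= b ^+ 2 + 1 / 2.
  apply: le_trans (ler_normB _ _) _; rewrite ger0_norm ?sqr_ge0//; lra.
have n3 : `|2 * (a * b)| <= 1 by rewrite normrM ger0_norm//; lra.
apply: le_trans (ler_normD _ _) _; rewrite normrM.
have k1 : `|2 * (a * b)| * `|q1| <= 1 * (e * w) by exact: ler_pM.
have k2 : `|(b ^+ 2 - a * b) * q2| <= (b ^+ 2 + 1 / 2) * (e * w).
  by rewrite normrM; exact: ler_pM.
have k3 : `|(a ^+ 2 - a * b) * q3| <= (a ^+ 2 + 1 / 2) * (e * w).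
  by rewrite normrM; exact: ler_pM.
have k4 := ler_normD ((a ^+ 2 - a * b) * q3) ((b ^+ 2 - a * b) * q2).
have k5 : (a ^+ 2 + 1 / 2) * (e * w) + (b ^+ 2 + 1 / 2) * (e * w) = 2 * (e * w).
  rewrite -mulrDl; congr (_ * _); lra.
have -> : 3 * e * w = 3 * (e * w) by ring.
lra.
Qed.

Lemma arc_point_step (u v : R) (z : 'M[R]_(d, m + m)) : arc_point v z =
  arc_cos u v *: arc_point u z + arc_sin u v *: arc_velocity u z.
Proof.
have h := arc_sqr u.
have e1 : arcc v = arc_cos u v * arcc u - arc_sin u v * arcs u.
  transitivity (arcc v * (arcc u ^+ 2 + arcs u ^+ 2)); first by rewrite h mulr1.
  by rewrite /arc_cos /arc_sin; ring.
have e2 : arcs v = arc_cos u v * arcs u + arc_sin u v * arcc u.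
  transitivity (arcs v * (arcc u ^+ 2 + arcs u ^+ 2)); first by rewrite h mulr1.
  by rewrite /arc_cos /arc_sin; ring.
rewrite /arc_point /arc_velocity {1}e1 {1}e2.
move: (lsubmx z) (rsubmx z) => X1 X2; ring_mx.
Qed.

Variable mu : probability 'M[R]_(d, m) R.
Hypothesis gmu : gaussian_law mu.
Variable good : set 'M[R]_(d, m).
Hypothesis mgood : measurable good.
Hypothesis good_near_id : forall Z, good Z -> near_id (1 / 6) (wishart Z).

Local Notation nu := (joint_law mu mu).

(** By [near_id_comb], on this event the whole circle through the two samples
    stays near the identity. *)
Definition good_pair : set 'M[R]_(d, m + m) := [set z | [/\ good (lsubmx z),
  good (rsubmx z) & good (diag_mean *: lsubmx z + diag_mean *: rsubmx z)]].

Let diag_unit : diag_mean ^+ 2 + diag_mean ^+ 2 = 1.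
Proof. rewrite diag_mean_sqr; lra. Qed.

Let mean_pt (z : 'M[R]_(d, m + m)) := diag_mean *: lsubmx z + diag_mean *: rsubmx z.

Let mean_ptE z : mean_pt z = lsubmx (rotate_pair diag_mean diag_mean z).
Proof. by rewrite row_mxKl. Qed.

Let mls : measurable_fun setT (fun z : 'M[R]_(d, m + m) => lsubmx z).
Proof. exact: measurable_lsubmx. Qed.

Let mrs : measurable_fun setT (fun z : 'M[R]_(d, m + m) => rsubmx z).
Proof. exact: measurable_rsubmx. Qed.

Let mmp : measurable_fun setT mean_pt.
Proof.
rewrite (_ : mean_pt = fun z => lsubmx (rotate_pair diag_mean diag_mean z)).
  by apply: measurable_lsubmx; exact: measurable_rotate_pair.
by apply/funext => z; rewrite mean_ptE.
Qed.

Let good_pairE : good_pair = lsubmx @^-1` good `&` rsubmx @^-1` good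
  `&` mean_pt @^-1` good.
Proof.
apply/seteqP; split=> z /=; first by case.
by move=> [[]].
Qed.

Lemma measurable_good_pair : measurable good_pair.
Proof.
by rewrite good_pairE; apply: measurableI; [apply: measurableI|]; exact: measurable_preimageT.
Qed.

Lemma law_invariant_set n1 n2 (P : probability 'M[R]_(n1, n2) R) f A :
  law_invariant P f -> measurable_fun setT f -> measurable A ->
  P (f @^-1` A) = P A.
Proof.
move=> hf mf mA.
have mfA := measurable_preimageT mf mA.
have mi : measurable_fun setT (fun x => (\1_A x : R)%:E).
  by apply/measurable_EFinP; exact: measurable_indic.
have i0 x : (0 <= (\1_A x : R)%:E)%E by rewrite lee_fin.
have := hf _ mi i0.
rewrite [RHS]integral_indic// setIT => <-.
rewrite (_ : (fun x => _) = (fun x => (\1_(f @^-1` A) x : R)%:E))//.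
by rewrite integral_indic// setIT.
Qed.

(** The normalized sum of the two samples is one more standard Gaussian matrix,
    as a component of a rotated pair. *)
Lemma good_pair_compl : (nu (~` good_pair) <= 3%:E * mu (~` good))%E.
Proof.
have mgc : measurable (~` good) by exact: measurableC.
have E : ~` good_pair `<=` (lsubmx @^-1` (~` good) `|` rsubmx @^-1` (~` good))
    `|` mean_pt @^-1` (~` good).
  by rewrite good_pairE !setCI.
have m1 := measurable_preimageT mls mgc; have m2 := measurable_preimageT mrs mgc.
have m3 := measurable_preimageT mmp mgc.
have i1 : nu (lsubmx @^-1` (~` good)) = mu (~` good) by exact: joint_law_fst.
have i2 : nu (rsubmx @^-1` (~` good)) = mu (~` good) by exact: joint_law_snd.
have i3 : nu (mean_pt @^-1` (~` good)) = mu (~` good).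
  have inv : law_invariant nu (rotate_pair diag_mean diag_mean).
    by move=> F mF F0; exact: rotate_pair_invariant.
  have h := law_invariant_set inv (measurable_rotate_pair diag_unit) m1.
  apply: (eq_trans _ (eq_trans h i1)); congr (nu _).
  by apply/funext => z; rewrite /preimage /= mean_ptE.
apply: (@le_trans _ _ (nu (lsubmx @^-1` (~` good)) + nu (rsubmx @^-1` (~` good))
    + nu (mean_pt @^-1` (~` good)))%E).
  apply: le_trans (le_measure _ _ _ E) _.
  - by rewrite inE; apply: measurableC; exact: measurable_good_pair.
  - by rewrite inE; do 2 (apply: measurableU => //).
  apply: le_trans (measureU2 _ _ _) _ => //; first exact: measurableU.
  by apply: leeD => //; exact: measureU2.
rewrite i1 i2 i3 -[mu _]fineK ?fin_num_measure//.
by rewrite -!EFinD -EFinM lee_fin; lra.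
Qed.

Section Deviation.
Variables (Phi : 'M[R]_d -> R) (B : 'M[R]_d -> 'M[R]_d) (beta kappa : R).
Hypothesis beta0 : 0 < beta.
Hypothesis kappa0 : 0 <= kappa.
Hypothesis B_sym : forall S, near_id (1 / 2) S -> (B S)^T = B S.
Hypothesis B_le : forall S, near_id (1 / 2) S -> frob_norm (B S) <= beta.
Hypothesis Phi_le : forall S1 S2, near_id (1 / 2) S1 -> near_id (1 / 2) S2 ->
  Phi S2 <= Phi S1 + mx_inner (B S1) (S2 - S1) + kappa * frob_norm (S2 - S1) ^+ 2.
Hypothesis mPhi : measurable_fun setT (fun Z => Phi (wishart Z)).
Hypothesis mB : measurable_fun setT (fun Z => B (wishart Z)).

Let grad Z : 'M[R]_(d, m) := (2 / m%:R) *: (B (wishart Z) *m Z).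

Let mgrad : measurable_fun setT grad.
Proof.
apply: measurable_scalemx; first exact: measurable_cst.
by apply: measurable_mulmx => //; exact: measurable_id.
Qed.

Let near_half z a b : good_pair z -> a ^+ 2 + b ^+ 2 = 1 ->
  near_id (1 / 2) (wishart (a *: lsubmx z + b *: rsubmx z)).
Proof.
move=> [g1 g2 g3] ab1; have := near_id_comb (good_near_id g1) (good_near_id g2)
  (good_near_id g3) ab1.
by rewrite (_ : 3 * (1 / 6) = 1 / 2)//; field.
Qed.

Let t0 := frob_norm (1%:M : 'M[R]_d).

Let near_frob (S : 'M[R]_d) : near_id (1 / 2) S -> frob_norm S <= 3 / 2 * t0.
Proof.
move=> h; have := frob_norm_mulmxl 1%:M _ (near_id_op_le h).
by rewrite mulmx1; apply; lra.
Qed.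

(* [15 * t0] bounds the speed of the sample covariance along the arc, and
   [9 * t0] its second-order remainder. *)
Let K := 9 * t0 * beta + kappa * (15 * t0) ^+ 2.

(* The squared gradient [|2 / m * B Z|^2] is [4 / m * <B, B W>] with [W] of norm
   at most [3 / 2]. *)
Let L := Num.sqrt (6 / m%:R) * beta.

Let point_step z u v : good_pair z -> 0 <= u -> u <= v -> v <= 1 ->
  Phi (wishart (arc_point v z)) - Phi (wishart (arc_point u z)) <=
    arc_sin u v * mx_inner (grad (arc_point u z)) (arc_velocity u z)
    + K * arc_sin u v ^+ 2.
Proof.
move=> gz u0 uv v1; have t00 : 0 <= t0 by exact: frob_norm_ge0.
have u01 : 0 <= u <= 1 by rewrite u0 (le_trans uv).
have v01 : 0 <= v <= 1 by rewrite (le_trans u0).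
have s0 := arc_sin_ge0 u0 uv; have s1 := arc_sin_le1 u v.
have /andP[c0 c1] := arc_cos_close u01 v01.
have cs := arc_sincos u v.
have nP : near_id (1 / 2) (wishart (arc_point u z)).
  by apply: near_half => //; exact: arc_sqr.
have nQ : near_id (1 / 2) (wishart (arc_point v z)).
  by apply: near_half => //; exact: arc_sqr.
have nV : near_id (1 / 2) (wishart (arc_velocity u z)).
  rewrite /arc_velocity addrC -scaleNr; apply: near_half => //.
  by rewrite sqrrN addrC arc_sqr.
have nM : near_id (1 / 2)
    (wishart (diag_mean *: arc_point u z + diag_mean *: arc_velocity u z)).
  have -> : diag_mean *: arc_point u z + diag_mean *: arc_velocity u z =
     (diag_mean * (arcc u - arcs u)) *: lsubmx z +
     (diag_mean * (arcc u + arcs u)) *: rsubmx z.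
    rewrite /arc_point /arc_velocity.
    move: (lsubmx z) (rsubmx z) => X1 X2; ring_mx.
  apply: near_half => //; rewrite !exprMn diag_mean_sqr.
  transitivity (arcc u ^+ 2 + arcs u ^+ 2); last exact: arc_sqr.
  by field.
set P := arc_point u z in nP nM *; set V := arc_velocity u z in nV nM *.
set s := arc_sin u v in s0 s1 c1 cs *; set c := arc_cos u v in c0 c1 cs *.
pose rem := (- s ^+ 2) *: wishart P + ((c - 1) * s) *: cross P V
  + s ^+ 2 *: wishart V.
have dE : wishart (arc_point v z) - wishart P = s *: cross P V + rem.
  rewrite (arc_point_step u) -/P -/V -/s -/c wishart_comb /rem.
  have -> : c ^+ 2 = 1 - s ^+ 2 by lra.
  move: (wishart P) (wishart V) (cross P V) => X1 X2 X3; ring_mx.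
have fP := near_frob nP; have fV := near_frob nV; have fM := near_frob nM.
have fC : frob_norm (cross P V) <= 6 * t0.
  rewrite crossE; apply: le_trans (frob_normB _ _) _.
  have := frob_normB (2 *: wishart (diag_mean *: P + diag_mean *: V)) (wishart P).
  rewrite frob_normZ ger0_norm//; lra.
have s2 : s ^+ 2 <= s by rewrite expr2 ler_piMr.
have fr : frob_norm rem <= 9 * t0 * s ^+ 2.
  apply: le_trans (frob_normD _ _) _; rewrite frob_normZ ger0_norm ?sqr_ge0//.
  have := frob_normD ((- s ^+ 2) *: wishart P) (((c - 1) * s) *: cross P V).
  rewrite !frob_normZ normrN (ger0_norm (sqr_ge0 s)) normrM (ger0_norm s0).
  rewrite distrC (ger0_norm c0) => h.
  have k1 : s ^+ 2 * frob_norm (wishart P) <= s ^+ 2 * (3 / 2 * t0).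
    by rewrite ler_wpM2l// sqr_ge0.
  have k2 : s ^+ 2 * frob_norm (wishart V) <= s ^+ 2 * (3 / 2 * t0).
    by rewrite ler_wpM2l// sqr_ge0.
  have k3 : (1 - c) * s * frob_norm (cross P V) <= s ^+ 2 * (6 * t0).
    apply: ler_pM => //; [exact: mulr_ge0|exact: frob_norm_ge0|].
    apply: le_trans (_ : (1 - c) * 1 <= _); first by rewrite ler_wpM2l.
    by rewrite mulr1.
  lra.
have fd : frob_norm (wishart (arc_point v z) - wishart P) <= 15 * t0 * s.
  rewrite dE; apply: le_trans (frob_normD _ _) _.
  rewrite frob_normZ ger0_norm//.
  have k1 : s * frob_norm (cross P V) <= s * (6 * t0) by rewrite ler_wpM2l.
  have k2 : 9 * t0 * s ^+ 2 <= 9 * t0 * s by rewrite ler_wpM2l// mulr_ge0.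
  lra.
have main := Phi_le nP nQ; rewrite dE mx_innerDr mx_innerZr -dE in main.
have bB := B_le nP.
have k1 : mx_inner (B (wishart P)) rem <= 9 * t0 * beta * s ^+ 2.
  apply: le_trans (mx_inner_le _ _) _.
  apply: le_trans (_ : beta * (9 * t0 * s ^+ 2) <= _).
    by apply: ler_pM => //; exact: frob_norm_ge0.
  by rewrite le_eqVlt; apply/orP; left; apply/eqP; ring.
have k2 : kappa * frob_norm (wishart (arc_point v z) - wishart P) ^+ 2 <=
    kappa * (15 * t0) ^+ 2 * s ^+ 2.
  rewrite -mulrA ler_wpM2l// -exprMn ler_pXn2r// nnegrE ?frob_norm_ge0//.
  by rewrite !mulr_ge0.
have k3 : mx_inner (B (wishart P)) (cross P V) = mx_inner (grad P) V.
  by rewrite cross_inner ?B_sym// /grad mx_innerZl.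
have k4 : K * s ^+ 2 = 9 * t0 * beta * s ^+ 2 + kappa * (15 * t0) ^+ 2 * s ^+ 2.
  exact: mulrDl.
rewrite k3 in main; rewrite k4; lra.
Qed.

Let grad_le z u : good_pair z -> 0 <= u <= 1 ->
  mx_inner (grad (arc_point u z)) (grad (arc_point u z)) <= L ^+ 2.
Proof.
move=> gz u01; set P := arc_point u z.
have nP : near_id (1 / 2) (wishart P) by apply: near_half => //; exact: arc_sqr.
rewrite /grad mx_innerZl mx_innerZr mulrA.
rewrite mx_innerMl -mulmxA.
rewrite gram_wishart -scalemxAr mx_innerZr.
have p32 : 0 <= 3 / 2 :> R by lra.
have h1 := frob_norm_mulmxr (B (wishart P)) p32 (near_id_op_le nP).
have h2 := mx_inner_le (B (wishart P)) (B (wishart P) *m wishart P).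
have h3 := B_le nP; have h4 := frob_norm_ge0 (B (wishart P)).
have h5 : mx_inner (B (wishart P)) (B (wishart P) *m wishart P) <= 3 / 2 * beta ^+ 2.
  apply: le_trans h2 _; rewrite expr2 mulrCA.
  apply: ler_pM => //; first exact: frob_norm_ge0.
  by apply: le_trans h1 _; rewrite ler_wpM2l.
rewrite /L exprMn sqr_sqrtr ?divr_ge0//.
have -> : 6 / m%:R * beta ^+ 2 = 2 / m%:R * (2 / m%:R) * (m%:R * (3 / 2 * beta ^+ 2)).
  by field.
by rewrite ler_wpM2l ?mulr_ge0 ?invr_ge0// ler_wpM2l.
Qed.

(** [Phi] is smooth near the identity only, which suffices on a good pair: the
    arc between its samples does not leave that neighbourhood. *)
Lemma wishart_pair_deviation x : 0 < x ->
  (nu [set z | (x <= Phi (wishart (rsubmx z)) - Phi (wishart (lsubmx z)))%R] <=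
   3%:E * mu (~` good) +
   (2 * expR (- (x ^+ 2 * m%:R / (48 * beta ^+ 2))))%:E)%E.
Proof.
move=> x0.
have L0 : 0 < L by rewrite mulr_gt0// sqrtr_gt0 divr_gt0.
have K0 : 0 <= K.
  have t00 : 0 <= t0 by exact: frob_norm_ge0.
  by rewrite addr_ge0// mulr_ge0 ?sqr_ge0 ?mulr_ge0 ?(ltW beta0).
have := @chain_concentration R d m mu gmu (fun Z => Phi (wishart Z)) grad
  mPhi mgrad good_pair K L measurable_good_pair K0 L0 point_step grad_le x x0.
set E := [set z | _] => h.
have mE : measurable E.
  apply: measurable_le_set => //; apply: measurable_funB.
    exact: (measurableT_comp mPhi mrs).
  exact: (measurableT_comp mPhi mls).
have mG := measurable_good_pair.
apply: (@le_trans _ _ (nu (~` good_pair) + nu (good_pair `&` E))%E).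
  apply: le_trans (measureU2 _ _ _); last 2 first.
  - exact: measurableC.
  - exact: measurableI.
  apply: le_measure; rewrite ?inE//.
    by apply: measurableU; [exact: measurableC|exact: measurableI].
  by move=> z Ez; have [g|g] := pselect (good_pair z); [right|left].
apply: leeD; first exact: good_pair_compl.
apply: le_trans h _; rewrite lee_fin.
have -> : 8 * L ^+ 2 = 48 * beta ^+ 2 / m%:R.
  by rewrite /L exprMn sqr_sqrtr ?divr_ge0//; field.
by rewrite invf_div mulrA.
Qed.

End Deviation.
End Wishart.

(** * Union bound and measurability of the inverse *)

Section UnionBound.
Context d (T : measurableType d) (R : realType) (P : probability T R).
Local Open Scope ereal_scope.

Lemma probability_union_le (I : finType) (A : I -> set T) (F : set T) :
  measurable F -> (forall i, measurable (A i)) ->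
  (forall t, F t -> exists i, A i t) -> P F <= \sum_i P (A i).
Proof.
move=> mF mA FA.
have h (s : seq I) : measurable (\big[setU/set0]_(i <- s) A i) /\
    P (\big[setU/set0]_(i <- s) A i) <= \sum_(i <- s) P (A i).
  elim: s => [|i s [ms IH]]; first by rewrite !big_nil measure0.
  rewrite !big_cons; split; first exact: measurableU.
  by apply: le_trans (measureU2 _ (mA i) ms) _; exact: leeD.
have [mU le] := h (index_enum I); apply: le_trans le.
apply: le_measure; rewrite ?inE// => t /FA[i Ait].
by rewrite -bigcup_seq; exists i => //=; exact: mem_index_enum.
Qed.

End UnionBound.

Section MeasurableInverse.
Context {R : realType} d (T : measurableType d).

Lemma measurable_inv (f : T -> R) : measurable_fun setT f ->
  measurable_fun setT (fun x => (f x)^-1).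
Proof.
move=> mf.
rewrite (_ : (fun x => _) = (fun x => f x * (f x ^+ 2) `^ (-1))).
  apply: measurable_funM => //.
  apply: (measurableT_comp (@measurable_powR R (-1))).
  exact: measurable_funX.
apply/funext => x; rewrite powR_inv1 ?sqr_ge0//.
have [->|x0] := eqVneq (f x) 0; first by rewrite invr0 mul0r.
by field.
Qed.

Lemma measurable_det n (f : T -> 'M[R]_n) : measurable_fun setT f ->
  measurable_fun setT (fun x => \det (f x)).
Proof.
move=> mf; apply: measurable_sum => s; apply: measurable_funM => //.
by apply: measurable_prod => i _; exact: measurable_mx_entry.
Qed.

(** Cramer's formula, as a total function: its entries are visibly measurable. *)
Definition adjinv n (A : 'M[R]_n) : 'M[R]_n := (\det A)^-1 *: \adj A.

Lemma adjinvE n (A : 'M[R]_n) : A \in unitmx -> adjinv A = invmx A.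
Proof. by rewrite /adjinv /invmx => ->. Qed.

Lemma measurable_adjinv n (f : T -> 'M[R]_n) : measurable_fun setT f ->
  measurable_fun setT (fun x => adjinv (f x)).
Proof.
move=> mf; apply: measurable_scalemx.
  by apply: measurable_inv; exact: measurable_det.
apply: measurable_fun_matrixP => i j.
under eq_fun do rewrite mxE.
apply: measurable_funM => //; apply: measurable_det.
apply: measurable_fun_matrixP => k l.
by under eq_fun do rewrite !mxE; exact: measurable_mx_entry.
Qed.

End MeasurableInverse.

(** * Lower deviations by averaging over signed shifts *)

Section SignedShifts.
Context {R : realType} {n : nat}.
Local Notation d := n.+1.

(** The cyclic shift of the coordinates by [k], followed by changes of signs. *)
Definition sign_shift (s : {ffun 'I_d -> bool}) (k : 'I_d) : 'M[R]_d :=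
  \matrix_(i, j) ((-1) ^+ s i * (j == i + k)%:R).

Lemma sign_shift_mul s k m (Z : 'M[R]_(d, m)) i j :
  (sign_shift s k *m Z) i j = (-1) ^+ s i * Z (i + k) j.
Proof.
rewrite mxE (bigD1 (i + k))//= mxE eqxx mulr1 big1 ?addr0// => l lk.
by rewrite mxE (negbTE lk) mulr0 mul0r.
Qed.

Lemma sign_shift_mulT s k m (Z : 'M[R]_(m, d)) i j :
  (Z *m (sign_shift s k)^T) i j = (-1) ^+ s j * Z i (j + k).
Proof. by rewrite -(trmxK (Z *m _)) trmx_mul trmxK mxE sign_shift_mul mxE. Qed.

Lemma sign_shift_orth s k : sign_shift s k *m (sign_shift s k)^T = 1%:M.
Proof.
apply/matrixP => i j; rewrite sign_shift_mul !mxE.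
have -> : (i + k == j + k) = (i == j) by rewrite (inj_eq (addIr k)).
have [->|_] := eqVneq i j; last by rewrite !mulr0.
by rewrite mulr1 -expr2 sqrr_sign.
Qed.

(** Flipping the sign at [i] changes the sign of the sum. *)
Lemma sum_sign_ne (i j : 'I_d) : i != j ->
  \sum_(s : {ffun 'I_d -> bool}) ((-1) ^+ s i * (-1) ^+ s j : R) = 0.
Proof.
move=> ij; set S := \sum_s _.
pose fl (s : {ffun 'I_d -> bool}) := [ffun l => if l == i then ~~ s l else s l].
have flK : involutive fl.
  by move=> s; apply/ffunP => l; rewrite !ffunE; case: eqP => // _; rewrite negbK.
have : S = - S.
  rewrite {1}/S (reindex_inj (inv_inj flK)) -sumrN; apply: eq_bigr => s _.
  rewrite !ffunE eqxx eq_sym (negbTE ij) -mulNr; congr (_ * _).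
  by case: (s i); rewrite /= expr0 expr1 ?opprK.
by move=> h; lra.
Qed.

(** Averaging over signed cyclic shifts replaces a matrix by the multiple of
    the identity with the same trace. *)
Lemma sum_sign_shift (K V : 'M[R]_d) :
  \sum_(p : {ffun 'I_d -> bool} * 'I_d)
     mx_inner K (sign_shift p.1 p.2 *m V *m (sign_shift p.1 p.2)^T) =
  (2 ^ d)%:R * (\tr V * \tr K).
Proof.
pose c (i j : 'I_d) (s : {ffun 'I_d -> bool}) (k : 'I_d) : R := ((-1) ^+ s i * (-1) ^+ s j) * (V (i + k) (j + k) * K i j).
have E p : mx_inner K (sign_shift p.1 p.2 *m V *m (sign_shift p.1 p.2)^T) =
    \sum_(q : 'I_d * 'I_d) c q.1 q.2 p.1 p.2.
  rewrite mx_innerE; apply: eq_bigr => q _; rewrite -mulmxA sign_shift_mul.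
  by rewrite sign_shift_mulT /c; ring.
rewrite (eq_bigr _ (fun p _ => E p)) exchange_big/=.
have E2 (q : 'I_d * 'I_d) : \sum_p c q.1 q.2 p.1 p.2 =
    if q.1 == q.2 then (2 ^ d)%:R * (\tr V * K q.1 q.2) else 0.
  rewrite -(pair_bigA _ (fun s k => c q.1 q.2 s k))/=.
  case: eqP => [e|/eqP ne].
    rewrite (eq_bigr (fun=> \tr V * K q.1 q.2)); last first.
      move=> s _; rewrite /c e -expr2 sqrr_sign.
      under eq_bigr do rewrite mul1r.
      rewrite -mulr_suml /mxtrace; congr (_ * _).
      by rewrite [RHS](reindex_inj (addrI q.2)).
    by rewrite sumr_const card_ffun card_bool card_ord mulr_natl.
  rewrite exchange_big/= big1// => k _; rewrite -mulr_suml.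
  by rewrite sum_sign_ne// mul0r.
rewrite (eq_bigr _ (fun q _ => E2 q)).
rewrite -(pair_bigA _ (fun i j => if i == j then (2 ^ d)%:R * (\tr V * K i j) else 0))/=.
rewrite [\tr K]/mxtrace !mulr_sumr; apply: eq_bigr => i _.
by rewrite -big_mkcond (big_pred1 i)// => j; rewrite eq_sym.
Qed.

End SignedShifts.

Section LowerDeviation.
Context {R : realType} {n m : nat}.
Local Notation d := n.+1.
Hypothesis m0 : (0 < m)%N.
Variable mu : probability 'M[R]_(d, m) R.
Hypothesis gmu : gaussian_law mu.
Variable good : set 'M[R]_(d, m).
Hypothesis mgood : measurable good.
Hypothesis good_near_id : forall Z, good Z -> near_id (1 / 6) (wishart Z).

Local Notation nu := (joint_law mu mu).

Lemma near_id_weaken k (a b : R) (S : 'M[R]_k) : a <= b -> near_id a S -> near_id b S.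
Proof.
move=> ab [sS h]; split=> // x; apply: le_trans (h x) _.
by rewrite ler_wpM2r// mx_inner_ge0.
Qed.

Lemma wishart_mulmx k (S : 'M[R]_(k, d)) (Z : 'M[R]_(d, m)) :
  wishart (S *m Z) = S *m wishart Z *m S^T.
Proof.
by rewrite wishart.unlock trmx_mul -scalemxAr -scalemxAl !mulmxA.
Qed.

Lemma measurable_wishart : measurable_fun setT (@wishart R d m).
Proof.
rewrite wishart.unlock; apply: measurable_scalemx; first exact: measurable_cst.
by apply: measurable_mulmx; [exact: measurable_id|exact: measurable_trmx].
Qed.

Definition move_right (S : 'M[R]_d) (z : 'M[R]_(d, m + m)) : 'M[R]_(d, m + m) :=
  row_mx (lsubmx z) (S *m rsubmx z).

Lemma move_right_isometry S : S^T *m S = 1%:M -> linear_isometry (move_right S).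
Proof.
move=> oS; split=> [c u v|u]; rewrite /move_right.
  rewrite scale_row_mx add_row_mx; congr row_mx.
    by apply/matrixP => i j; rewrite !mxE.
  rewrite scalemxAr -mulmxDr; congr (_ *m _).
  by apply/matrixP => i j; rewrite !mxE.
rewrite -[in RHS](hsubmxK u) !mx_inner_row_mx; congr (_ + _).
by rewrite mx_innerMr mulmxA oS mul1mx.
Qed.

Section Deviation.
Variables (K : 'M[R]_d) (h : 'M[R]_d -> 'M[R]_d) (B : 'M[R]_d -> 'M[R]_d).
Variables (beta kappa theta : R).
Hypothesis beta0 : 0 < beta.
Hypothesis kappa0 : 0 <= kappa.
Let Phi S := mx_inner K (h S).
Hypothesis B_sym : forall S, near_id (1 / 2) S -> (B S)^T = B S.
Hypothesis B_le : forall S, near_id (1 / 2) S -> frob_norm (B S) <= beta.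
Hypothesis Phi_le : forall S1 S2, near_id (1 / 2) S1 -> near_id (1 / 2) S2 ->
  Phi S2 <= Phi S1 + mx_inner (B S1) (S2 - S1) + kappa * frob_norm (S2 - S1) ^+ 2.
Hypothesis mh : measurable_fun setT (fun Z : 'M[R]_(d, m) => h (wishart Z)).
Hypothesis mB : measurable_fun setT (fun Z : 'M[R]_(d, m) => B (wishart Z)).
Hypothesis h_conj : forall S U, near_id (1 / 2) S -> U *m U^T = 1%:M ->
  h (U *m S *m U^T) = U *m h S *m U^T.
Hypothesis h_tr : forall S, near_id (1 / 2) S -> theta * d%:R <= \tr (h S).
Hypothesis trK : 0 <= \tr K.

Let mPhi : measurable_fun setT (fun Z : 'M[R]_(d, m) => Phi (wishart Z)).
Proof. by apply: measurable_mx_inner => //; exact: measurable_cst. Qed.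

Definition low_set x : set 'M[R]_(d, m) :=
  [set Z | Phi (wishart Z) < theta * \tr K - x].

Lemma measurable_low_set x : measurable (low_set x).
Proof. exact: measurable_lt_set. Qed.

(** Concentration only compares two independent samples; averaging the second
    one over the signed cyclic shifts, which do not change its law, identifies
    the level around which the functional concentrates. *)
Theorem lower_deviation x : 0 < x ->
  (mu (low_set x) <= (2 ^ d * d)%:R%:E *
    (3%:E * mu (~` good) +
     (2 * expR (- (x ^+ 2 * m%:R / (48 * beta ^+ 2))))%:E) + mu (~` good))%E.
Proof.
move=> x0.
pose E : set 'M[R]_(d, m + m) :=
  [set z | (x <= Phi (wishart (rsubmx z)) - Phi (wishart (lsubmx z)))%R].
have mls : measurable_fun setT (fun z : 'M[R]_(d, m + m) => lsubmx z).
  by exact: measurable_lsubmx.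
have mrs : measurable_fun setT (fun z : 'M[R]_(d, m + m) => rsubmx z).
  by exact: measurable_rsubmx.
have mE : measurable E.
  apply: measurable_le_set => //; apply: measurable_funB.
    exact: (measurableT_comp mPhi mrs).
  exact: (measurableT_comp mPhi mls).
have dev : (nu E <= 3%:E * mu (~` good) +
    (2 * expR (- (x ^+ 2 * m%:R / (48 * beta ^+ 2))))%:E)%E.
  exact: (wishart_pair_deviation m0 gmu mgood good_near_id beta0 kappa0
    B_sym B_le Phi_le mPhi mB x0).
pose I : finType := ({ffun 'I_d -> bool} * 'I_d)%type.
pose S (p : I) : 'M[R]_d := sign_shift p.1 p.2.
have oS p : S p *m (S p)^T = 1%:M by exact: sign_shift_orth.
have isoS p : linear_isometry (move_right (S p)).
  by apply: move_right_isometry; exact: mulmx1C.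
have mS p : measurable_fun setT (move_right (S p)).
  exact: measurable_isometry (isoS p).
pose A (p : I) : set 'M[R]_(d, m + m) := move_right (S p) @^-1` E.
pose C : set 'M[R]_(d, m + m) := rsubmx @^-1` (~` good).
have mgc : measurable (~` good) by exact: measurableC.
have mA p : measurable (A p) by exact: measurable_preimageT.
have mC : measurable C by exact: measurable_preimageT.
have mL := measurable_low_set x.
pose F : set 'M[R]_(d, m + m) := lsubmx @^-1` (low_set x).
have mF : measurable F by exact: measurable_preimageT.
have mFC : measurable (F `\` C) by exact: measurableD.
rewrite -(joint_law_fst mu mu mL) -/F.
have cover z : (F `\` C) z -> exists p, A p z.
  move=> [Fz Cz]; apply: contrapT => /forallNP nA.
  have gz : good (rsubmx z) by exact: contrapT.
  have nz : near_id (1 / 2) (wishart (rsubmx z)).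
    by apply: near_id_weaken (good_near_id gz); lra.
  have lt p : Phi (wishart (S p *m rsubmx z)) < theta * \tr K.
    have := nA p; rewrite /A /E /= /move_right row_mxKl row_mxKr.
    by move/negP; rewrite -ltNge; move: Fz; rewrite /F /low_set /=; lra.
  have : \sum_p Phi (wishart (S p *m rsubmx z)) < \sum_(p : I) theta * \tr K.
    rewrite (bigD1 ([ffun=> false], ord0))// [ltRHS](bigD1 ([ffun=> false], ord0))//=.
    by apply: ltr_leD => //; apply: ler_sum => p _; exact: ltW.
  have -> : \sum_p Phi (wishart (S p *m rsubmx z)) =
      (2 ^ d)%:R * (\tr (h (wishart (rsubmx z))) * \tr K).
    rewrite -sum_sign_shift; apply: eq_bigr => p _.
    by rewrite /Phi wishart_mulmx h_conj.
  rewrite sumr_const card_prod card_ffun card_bool card_ord.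
  rewrite -[ltRHS]mulr_natl natrM -mulrA ltr_pM2l ?ltr0n ?expn_gt0//.
  apply/negP; rewrite -leNgt mulrA ler_wpM2r// mulrC.
  exact: h_tr.
apply: (@le_trans _ _ (nu (F `\` C) + nu C)%E).
  apply: le_trans (measureU2 nu mFC mC); apply: le_measure; rewrite ?inE//.
    exact: measurableU.
  by move=> z Fz; have [Cz|Cz] := pselect (C z); [right|left].
apply: leeD; last by rewrite (joint_law_snd mu mu mgc).
apply: le_trans (@probability_union_le _ _ _ nu _ _ _ mFC mA cover) _.
have Ap p : nu (A p) = nu E.
  apply: law_invariant_set => //; apply: gaussian_isometry_invariant => //.
  exact: gaussian_joint_law.
rewrite (eq_bigr (fun=> nu E)); last by move=> p _; exact: Ap.
have nuE : nu E = (fine (nu E))%:E by rewrite fineK// fin_num_measure.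
rewrite nuE sumEFin sumr_const card_prod card_ffun card_bool card_ord.
rewrite (_ : _ *+ _ = (2 ^ d * d)%:R * fine (nu E)); last by rewrite mulr_natl.
by rewrite EFinM -nuE; apply: lee_wpmul2l => //; rewrite lee_fin.
Qed.

End Deviation.

(** [N] itself is the gradient and there is no remainder. The constant [768] is
    the one of [wishart_lower_inverse]. *)
Lemma wishart_lower_linear (N : 'M[R]_d) (y : R) : N^T = N -> 0 <= \tr N -> 0 < y ->
  (mu [set Z : 'M[R]_(d, m) | (mx_inner N (wishart Z) <
       1 / 5 * \tr N - frob_norm N * Num.sqrt (768 * y / m%:R))%R] <=
   (2 ^ d * d)%:R%:E * (3%:E * mu (~` good) + (2 * expR (- y))%:E)
   + mu (~` good))%E.
Proof.
move=> sN trN y0.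
have mp : (0 : R) < m%:R by rewrite ltr0n.
have [N0|Nn] := eqVneq (frob_norm N) 0.
  have {}N0 : N = 0 by apply: mx_inner_eq0; rewrite -frob_norm_sqr N0 expr0n.
  rewrite (_ : [set Z | _] = set0) ?measure0.
    apply: adde_ge0 => //; apply: mule_ge0; first by rewrite lee_fin.
    by apply: adde_ge0; rewrite ?mule_ge0// lee_fin mulr_ge0// expR_ge0.
  apply/seteqP; split=> // Z /=.
  rewrite N0 /frob_norm /mx_inner !mul0mx mxtrace0 sqrtr0 mul0r mulr0.
  by rewrite subrr ltxx.
have N0 : 0 < frob_norm N by rewrite lt0r Nn frob_norm_ge0.
pose r := Num.sqrt (768 * y / m%:R).
have r2 : 0 < 768 * y / m%:R by rewrite divr_gt0 ?mulr_gt0 ?ltr0n.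
have r0 : 0 < r by rewrite sqrtr_gt0.
have PL S1 S2 : near_id (1 / 2) S1 -> near_id (1 / 2) S2 ->
    mx_inner N S2 <= mx_inner N S1 + mx_inner N (S2 - S1) +
      0 * frob_norm (S2 - S1) ^+ 2.
  by move=> _ _; rewrite mul0r addr0 mx_innerBr addrC subrK.
have ht (S : 'M[R]_d) : near_id (1 / 2) S -> 1 / 5 * d%:R <= \tr S.
  by move=> /near_id_tr_ge; have := ler0n R d; lra.
have H := @lower_deviation N id (fun=> N) (frob_norm N) 0 (1 / 5) N0 (lexx _)
  (fun _ _ => sN) (fun _ _ => lexx _) PL measurable_wishart (measurable_cst _)
  (fun _ _ _ _ => erefl _) ht trN (frob_norm N * r) (mulr_gt0 N0 r0).
apply: le_trans H _.
apply: leeD => //; apply: lee_wpmul2l; first by rewrite lee_fin.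
apply: leeD => //; rewrite lee_fin ler_wpM2l// ler_expR lerN2.
have rr : r ^+ 2 = 768 * y / m%:R by exact: sqr_sqrtr (ltW r2).
rewrite exprMn rr.
rewrite ler_pdivlMr; last by rewrite mulr_gt0// exprn_gt0.
have -> : frob_norm N ^+ 2 * (768 * y / m%:R) * m%:R = frob_norm N ^+ 2 * (768 * y).
  by field; rewrite gt_eqF.
have : 0 <= frob_norm N ^+ 2 * y by rewrite mulr_ge0 ?sqr_ge0 ?(ltW y0).
lra.
Qed.

(** The inverse has the expansion [V2 = V1 - V1 D V1 + V2 D V1 D V1], so the
    gradient is [- V K V], of norm at most [4 * |K|], and the remainder is at most
    [8 * |K| * |D|^2]. The constant is [768 = 48 * 4 ^ 2]. *)
Lemma wishart_lower_inverse (K : 'M[R]_d) (y : R) : K^T = K -> 0 <= \tr K -> 0 < y ->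
  (mu [set Z : 'M[R]_(d, m) | (mx_inner K (adjinv (wishart Z)) <
       1 / 5 * \tr K - frob_norm K * Num.sqrt (768 * y / m%:R))%R] <=
   (2 ^ d * d)%:R%:E * (3%:E * mu (~` good) + (2 * expR (- y))%:E)
   + mu (~` good))%E.
Proof.
move=> sK trK y0.
have mp : (0 : R) < m%:R by rewrite ltr0n.
have [K0|Kn] := eqVneq (frob_norm K) 0.
  have {}K0 : K = 0 by apply: mx_inner_eq0; rewrite -frob_norm_sqr K0 expr0n.
  rewrite (_ : [set Z | _] = set0) ?measure0.
    apply: adde_ge0 => //; apply: mule_ge0; first by rewrite lee_fin.
    by apply: adde_ge0; rewrite ?mule_ge0// lee_fin mulr_ge0// expR_ge0.
  apply/seteqP; split=> // Z /=.
  rewrite K0 /frob_norm /mx_inner !mul0mx mxtrace0 sqrtr0 mul0r mulr0.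
  by rewrite subrr ltxx.
have K0 : 0 < frob_norm K by rewrite lt0r Kn frob_norm_ge0.
pose r := Num.sqrt (768 * y / m%:R).
have r2 : 0 < 768 * y / m%:R by rewrite divr_gt0 ?mulr_gt0 ?ltr0n.
have r0 : 0 < r by rewrite sqrtr_gt0.
pose B (S : 'M[R]_d) := - (adjinv S *m K *m adjinv S).
have aE (S : 'M[R]_d) : near_id (1 / 2) S -> adjinv S = invmx S.
  by move=> hS; rewrite adjinvE// near_id_unitmx.
have b2 : (0 : R) <= 2 by [].
have beta0 : 0 < 4 * frob_norm K by rewrite mulr_gt0.
have kap0 : 0 <= 8 * frob_norm K by rewrite mulr_ge0// ltW.
have sB S : near_id (1 / 2) S -> (B S)^T = B S.
  move=> hS; rewrite /B linearN /= !trmx_mul sK aE// near_id_inv_sym//.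
  by rewrite mulmxA.
have BL S : near_id (1 / 2) S -> frob_norm (B S) <= 4 * frob_norm K.
  move=> hS; rewrite /B frob_normN aE//.
  have h1 := frob_norm_mulmxr (invmx S *m K) b2 (near_id_inv_op_le hS).
  have h2 := frob_norm_mulmxl K b2 (near_id_inv_op_le hS).
  lra.
have PL S1 S2 : near_id (1 / 2) S1 -> near_id (1 / 2) S2 ->
    mx_inner K (adjinv S2) <= mx_inner K (adjinv S1) +
      mx_inner (B S1) (S2 - S1) + 8 * frob_norm K * frob_norm (S2 - S1) ^+ 2.
  move=> h1 h2; rewrite /B !aE//.
  have u1 := near_id_unitmx h1; have u2 := near_id_unitmx h2.
  set V1 := invmx S1; set V2 := invmx S2; set D := S2 - S1.
  have e1 : V2 - V1 = - (V2 *m D *m V1).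
    rewrite /D mulmxBr mulVmx// mulmxBl mul1mx -mulmxA mulmxV// mulmx1.
    by rewrite opprB.
  have e2 : V2 = V1 - V1 *m D *m V1 + V2 *m D *m V1 *m D *m V1.
    have -> : V2 *m D *m V1 = V1 - V2 by rewrite -[LHS]opprK -e1 opprB.
    rewrite !mulmxBl.
    have -> : V2 *m D *m V1 = V1 - V2 by rewrite -[LHS]opprK -e1 opprB.
    move: (V1 *m D *m V1) => X; apply/matrixP => i j; rewrite !mxE; ring.
  have e3 : mx_inner K (V1 *m D *m V1) = mx_inner (V1 *m K *m V1) D.
    rewrite mx_innerC mx_innerMl mx_innerMr.
    by rewrite !near_id_inv_sym// mulmxA mx_innerC.
  rewrite {1}e2 mx_innerDr mx_innerBr e3 mx_innerNl lerD2l.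
  apply: le_trans (mx_inner_le _ _) _.
  have o1 : op_le 2 V1 by exact: near_id_inv_op_le.
  have o2 : op_le 2 V2 by exact: near_id_inv_op_le.
  have k1 := frob_norm_mulmxr (V2 *m D *m V1 *m D) b2 o1.
  have f0 := frob_norm_ge0 D.
  have oD : op_le (frob_norm D) D.
    exact: op_le_frob.
  have k2 := frob_norm_mulmxr (V2 *m D *m V1) f0 oD.
  have k3 := frob_norm_mulmxr (V2 *m D) b2 o1.
  have k4 := frob_norm_mulmxl D b2 o2.
  have k5 : frob_norm (V2 *m D *m V1) * frob_norm D <= 4 * frob_norm D * frob_norm D.
    by rewrite ler_wpM2r//; lra.
  rewrite -mulrA mulrCA ler_wpM2l ?(ltW K0)// expr2; lra.
have hc (S U : 'M[R]_d) : near_id (1 / 2) S -> U *m U^T = 1%:M ->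
    adjinv (U *m S *m U^T) = U *m adjinv S *m U^T.
  move=> hS oU.
  have uS := near_id_unitmx hS; have oU' := mulmx1C oU.
  have uU : U \in unitmx by case: (mulmx1_unit oU).
  have uUT : U^T \in unitmx by case: (mulmx1_unit oU).
  rewrite adjinvE ?unitmx_mul ?uU ?uS ?uUT// aE//.
  apply: (@can_inj _ _ _ _ (mulKmx (_ : U *m S *m U^T \in unitmx))).
    by rewrite !unitmx_mul uU uS.
  rewrite mulmxV ?unitmx_mul ?uU ?uS ?uUT//.
  by rewrite -!mulmxA (mulmxA U^T) oU' mul1mx (mulmxA S) mulmxV// mul1mx oU.
have mV : measurable_fun setT (fun Z : 'M[R]_(d, m) => adjinv (wishart Z)).
  by apply: measurable_adjinv; exact: measurable_wishart.
have mB : measurable_fun setT (fun Z : 'M[R]_(d, m) => B (wishart Z)).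
  rewrite (_ : (fun Z => _) = (fun Z : 'M[R]_(d, m) =>
     (-1) *: (adjinv (wishart Z) *m K *m adjinv (wishart Z)))).
    apply: measurable_scalemx; first exact: measurable_cst.
    by apply: measurable_mulmx => //; exact: measurable_mulmx.
  by apply/funext => Z; rewrite scaleN1r.
have ht (S : 'M[R]_d) : near_id (1 / 2) S -> 1 / 5 * d%:R <= \tr (adjinv S).
  by move=> hS; rewrite aE//; have := near_id_tr_inv_ge hS; lra.
have H := @lower_deviation K (@adjinv R d) B (4 * frob_norm K) (8 * frob_norm K)
  (1 / 5) beta0 kap0 sB BL PL mV mB hc ht trK (frob_norm K * r) (mulr_gt0 K0 r0).
apply: le_trans H _.
apply: leeD => //; apply: lee_wpmul2l; first by rewrite lee_fin.
apply: leeD => //; rewrite lee_fin ler_wpM2l// ler_expR lerN2.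
have rr : r ^+ 2 = 768 * y / m%:R by exact: sqr_sqrtr (ltW r2).
rewrite !exprMn rr.
have f2 : 0 < frob_norm K ^+ 2 by rewrite exprn_gt0.
rewrite le_eqVlt; apply/orP; left; apply/eqP.
by field; rewrite !gt_eqF.
Qed.

End LowerDeviation.

(** * Chi-square tails *)

Section ChiSquare.
Context {R : realType}.

(** In other words [ln (1 - y) >= - (y + y ^+ 2)]. *)
Lemma expR_lower_1m (y : R) : - (1 / 2) <= y -> y <= 1 / 4 ->
  expR (- (y + y ^+ 2)) <= 1 - y.
Proof.
move=> y1 y2; have yp : 0 < 1 - y by lra.
rewrite expRN -[leRHS]invrK lef_pV2 ?posrE ?invr_gt0 ?expR_gt0//.
rewrite -[leLHS]div1r ler_pdivrMr// mulrC.
have [y0|y0] := leP 0 y; last first.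
  have h := expR_ge1Dx (y + y ^+ 2).
  apply: le_trans (_ : (1 - y) * (1 + (y + y ^+ 2)) <= _).
    have -> : (1 - y) * (1 + (y + y ^+ 2)) = 1 + (- y) * y ^+ 2 by ring.
    by rewrite lerDl mulr_ge0 ?sqr_ge0// oppr_ge0 ltW.
  by rewrite ler_wpM2l// ltW.
set w := y + y ^+ 2; have w0 : 0 <= w by rewrite addr_ge0 ?sqr_ge0.
have h := expR_ge1Dx (w / 2).
have h2 : (1 + w / 2) ^+ 2 <= expR w.
  have -> : expR w = expR (w / 2) ^+ 2.
    by rewrite -expRM_natl; congr expR; field.
  by rewrite ler_pXn2r// nnegrE ?expR_ge0// addr_ge0// divr_ge0.
apply: le_trans (_ : (1 - y) * (1 + w / 2) ^+ 2 <= _); last first.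
  by rewrite ler_wpM2l// ltW.
have -> : (1 - y) * (1 + w / 2) ^+ 2 =
    1 + y ^+ 2 * ((1 + y - y ^+ 2 - y ^+ 3) / 4 - y) by rewrite /w; field.
rewrite lerDl mulr_ge0 ?sqr_ge0//.
have y3 : y ^+ 2 <= y / 4 by rewrite expr2 ler_wpM2l//; lra.
have y4 : y ^+ 3 <= y / 16.
  rewrite exprS; apply: le_trans (ler_wpM2l y0 y3) _.
  have : y * y <= y * (1 / 4) by rewrite ler_wpM2l//; lra.
  lra.
lra.
Qed.

Lemma inv_sqrt_le (s : R) : - (1 / 4) <= s -> s <= 1 / 8 ->
  (Num.sqrt (1 - 2 * s))^-1 <= expR (s + 2 * s ^+ 2).
Proof.
move=> s1 s2; have sp : 0 < 1 - 2 * s by lra.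
have h := @expR_lower_1m (2 * s); rewrite -[leRHS]invrK lef_pV2 ?posrE; last 2 first.
- by rewrite sqrtr_gt0.
- by rewrite invr_gt0 expR_gt0.
rewrite -expRN -(@ler_pXn2r _ 2)// ?nnegrE ?expR_ge0 ?sqrtr_ge0//.
rewrite sqr_sqrtr ?(ltW sp)// -expRM_natl.
have -> : 2 * - (s + 2 * s ^+ 2) = - (2 * s + (2 * s) ^+ 2) by ring.
by apply: h; lra.
Qed.

Context {d m : nat}.
Variable mu : probability 'M[R]_(d, m) R.
Hypothesis gmu : gaussian_law mu.

Definition row_sumsq (i : 'I_d) (Z : 'M[R]_(d, m)) : R := \sum_k Z i k ^+ 2.

Lemma measurable_row_sumsq i : measurable_fun setT (row_sumsq i).
Proof.
apply: measurable_sum => k; apply: measurable_funX; exact: measurable_entry.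
Qed.

Lemma row_sumsq_mgf i (s : R) : - (1 / 4) <= s -> s <= 1 / 8 ->
  (\int[mu]_Z (expR (s * row_sumsq i Z))%:E <=
   (expR (m%:R * (s + 2 * s ^+ 2)))%:E)%E.
Proof.
move=> s1 s2; pose l := [seq (i, k) | k <- index_enum 'I_m].
have ul : uniq l by rewrite map_inj_uniq ?index_enum_uniq// => a b [].
have s2' : s < 1 / 2 by lra.
have := gaussian_mgf_sumsq gmu ul s2'.
rewrite (_ : (fun x : 'M[R]_(d, m) => _) = fun Z => (expR (s * row_sumsq i Z))%:E).
  move=> ->; rewrite lee_fin size_map.
  have -> : size (index_enum 'I_m) = m.
    by rewrite -[RHS](card_ord m) cardT enumT.
  rewrite expRM_natl lerXn2r// ?nnegrE ?expR_ge0 ?invr_ge0 ?sqrtr_ge0//.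
  exact: inv_sqrt_le.
by apply/funext => Z; rewrite big_map.
Qed.

Lemma chernoff (f : 'M[R]_(d, m) -> R) (a b : R) :
  measurable_fun setT f ->
  (\int[mu]_Z (expR (f Z))%:E <= (expR b)%:E)%E ->
  (mu [set Z | (a <= f Z)%R] <= (expR (b - a))%:E)%E.
Proof.
move=> mf hf; set E := [set Z | _].
have mE : measurable E by exact: measurable_le_set.
have mef : measurable_fun setT (fun Z => (expR (f Z))%:E).
  by apply/measurable_EFinP; apply: measurableT_comp.
apply: (@le_trans _ _ ((expR (- a))%:E * \int[mu]_Z (expR (f Z))%:E)%E).
  rewrite -ge0_integralZl//.
  rewrite -[X in (X <= _)%E]mul1e -(integral_cst mu mE 1%:E).
  rewrite integral_mkcond; apply: ge0_le_integral => //.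
  - by move=> z _; rewrite patchE; case: ifP.
  - by apply/(measurable_restrictT _ mE); exact: measurable_cst.
  - by apply: measurable_funeM.
  move=> z _; rewrite patchE; case: ifPn => [|_]; last first.
    by rewrite -EFinM lee_fin mulr_ge0// expR_ge0.
  rewrite inE => Ez; rewrite -EFinM lee_fin -expRD -[leLHS]expR0 ler_expR.
  by rewrite addrC subr_ge0.
rewrite addrC expRD EFinM; apply: lee_wpmul2l => //.
Qed.

Lemma row_sumsq_tail i (tau : R) : 0 < tau -> tau <= 1 -> (0 < m)%N ->
  (mu [set Z | (tau < `|m%:R^-1 * row_sumsq i Z - 1|)%R] <=
   (2 * expR (- (m%:R * tau ^+ 2 / 16)))%:E)%E.
Proof.
move=> t0 t1 m0; have mp : (0 : R) < m%:R by rewrite ltr0n.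
(* [s = tau / 8] stays in the range of [inv_sqrt_le] for all [tau <= 1]. *)
pose s := tau / 8.
pose f1 (Z : 'M[R]_(d, m)) := s * row_sumsq i Z.
pose f2 (Z : 'M[R]_(d, m)) := - s * row_sumsq i Z.
have mf1 : measurable_fun setT f1.
  by apply: measurable_funM => //; exact: measurable_row_sumsq.
have mf2 : measurable_fun setT f2.
  by apply: measurable_funM => //; exact: measurable_row_sumsq.
have s1 : - (1 / 4) <= s by rewrite /s; lra.
have s2 : s <= 1 / 8 by rewrite /s; lra.
have s3 : - (1 / 4) <= - s by rewrite /s; lra.
have s4 : - s <= 1 / 8 by rewrite /s; lra.
have c1 := @chernoff f1 (s * (m%:R * (1 + tau))) _ mf1 (row_sumsq_mgf i s1 s2).
have c2 := @chernoff f2 (- s * (m%:R * (1 - tau))) _ mf2 (row_sumsq_mgf i s3 s4).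
have e16 : s ^+ 2 = tau ^+ 2 / 64 by rewrite /s; field.
have t2 : 0 <= m%:R * tau ^+ 2 by rewrite mulr_ge0 ?sqr_ge0 ?ltW.
set E1 := [set Z | _] in c1; set E2 := [set Z | _] in c2.
have mE1 : measurable E1 by exact: measurable_le_set.
have mE2 : measurable E2 by exact: measurable_le_set.
apply: (@le_trans _ _ (mu E1 + mu E2)%E).
  apply: le_trans (measureU2 mu mE1 mE2); apply: le_measure.
  - rewrite inE; apply: measurable_lt_set => //; apply: measurableT_comp => //.
    apply: measurable_funB => //; apply: measurable_funM => //.
    exact: measurable_row_sumsq.
  - by rewrite inE; exact: measurableU.
  have s0 : 0 <= s by rewrite divr_ge0// ltW.
  move=> Z /=; rewrite lter_normr => /orP[h|h]; [left|right]; rewrite /E1 /E2 /f1 /f2 /=.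
    rewrite ler_wpM2l// -ler_pdivlMl//; lra.
  rewrite !mulNr lerN2 ler_wpM2l// -ler_pdivrMl//; lra.
apply: (@le_trans _ _ ((expR (- (m%:R * tau ^+ 2 / 16)))%:E +
    (expR (- (m%:R * tau ^+ 2 / 16)))%:E)%E); last first.
  by rewrite -EFinD lee_fin; lra.
apply: leeD.
  apply: le_trans c1 _; rewrite lee_fin ler_expR.
  have -> : m%:R * (s + 2 * s ^+ 2) - s * (m%:R * (1 + tau)) =
      m%:R * (2 * s ^+ 2 - s * tau) by ring.
  rewrite e16 /s; lra.
apply: le_trans c2 _; rewrite lee_fin ler_expR.
have -> : m%:R * (- s + 2 * (- s) ^+ 2) - - s * (m%:R * (1 - tau)) =
    m%:R * (2 * s ^+ 2 - s * tau) by ring.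
rewrite e16 /s; lra.
Qed.

End ChiSquare.

Section Householder.
Context {R : realType} {n : nat}.
Local Notation d := n.+1.

(** The reflection along [v - |v| e_0] exchanges [v] and [|v| e_0]. *)
Lemma householder (v : 'cV[R]_d) : exists H : 'M[R]_d,
  H *m H^T = 1%:M /\ H^T *m v = frob_norm v *: delta_mx ord0 ord0.
Proof.
set r := frob_norm v; pose e : 'cV[R]_d := delta_mx ord0 ord0.
pose w := v - r *: e; have [w0|w0] := eqVneq (mx_inner w w) 0.
  exists 1%:M; rewrite trmx1 mulmx1 mul1mx; split=> //.
  by have /subr0_eq := mx_inner_eq0 w0.
have ee : mx_inner e e = 1 by rewrite (mx_inner_delta e (ord0, ord0)) mxE !eqxx.
have rr : mx_inner v v = r ^+ 2 by rewrite frob_norm_sqr.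
have ww : mx_inner w w = 2 * mx_inner w v.
  rewrite /w !(mx_innerBl, mx_innerBr, mx_innerZl, mx_innerZr) (mx_innerC e v).
  rewrite rr ee; ring.
have wTw : w^T *m w = (mx_inner w w)%:M.
  apply/matrixP => i j; rewrite !ord1 mxE (mx_innerE w).
  rewrite -(pair_bigA _ (fun k l => w k l * w k l))/= mxE eqxx mulr1n.
  by apply: eq_bigr => k _; rewrite big_ord1 mxE.
have wTv : w^T *m v = (mx_inner w v)%:M.
  apply/matrixP => i j; rewrite !ord1 mxE (mx_innerE w).
  rewrite -(pair_bigA _ (fun k l => w k l * v k l))/= mxE eqxx mulr1n.
  by apply: eq_bigr => k _; rewrite big_ord1 mxE.
pose c := 2 / mx_inner w w.
pose H : 'M[R]_d := 1%:M - c *: (w *m w^T).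
have sH : H^T = H.
  by rewrite /H linearB linearZ /= trmx1 trmx_mul trmxK.
have P2 : (w *m w^T) *m (w *m w^T) = mx_inner w w *: (w *m w^T).
  by rewrite -mulmxA (mulmxA w^T) wTw mul_scalar_mx -scalemxAr.
exists H; rewrite sH; split.
  have P3 : (c *: (w *m w^T)) *m (c *: (w *m w^T)) = (2 * c) *: (w *m w^T).
    rewrite -scalemxAl -scalemxAr P2 !scalerA; congr (_ *: _).
    by rewrite /c; field.
  rewrite /H mulmxBl !mulmxBr !mul1mx mulmx1 P3.
  move: (w *m w^T) => X; apply/matrixP => i j; rewrite !mxE; ring.
rewrite /H mulmxBl mul1mx -scalemxAl -mulmxA wTv mul_mx_scalar scalerA.
have -> : c * mx_inner w v = 1 by rewrite /c ww; field; move: w0; rewrite ww mulf_eq0 negb_or => /andP[].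
by rewrite scale1r /w opprB addrC subrK.
Qed.

End Householder.

Section GoodSet.
Context {R : realType} {n m : nat}.
Local Notation d := n.+1.
Hypothesis m0 : (0 < m)%N.

Lemma qform_wishart (Z : 'M[R]_(d, m)) v :
  qform (wishart Z) v = m%:R^-1 * mx_inner (Z^T *m v) (Z^T *m v).
Proof.
rewrite /qform wishart.unlock -scalemxAl mx_innerZr -mulmxA mx_innerC mx_innerMr.
by [].
Qed.

Lemma qform_wishart_delta (Z : 'M[R]_(d, m)) :
  qform (wishart Z) (delta_mx ord0 ord0) = m%:R^-1 * row_sumsq ord0 Z.
Proof.
rewrite qform_wishart mx_innerE; congr (_ * _).
set w := _ *m _; have we k j : w k j = Z ord0 k.
  by rewrite /w -colE !mxE.
rewrite -(pair_bigA _ (fun k l => w k l * w k l))/=; apply: eq_bigr => k _.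
by rewrite big_ord1 we expr2.
Qed.

Variable mu : probability 'M[R]_(d, m) R.
Hypothesis gmu : gaussian_law mu.

Definition dev_set (tau : R) (v : 'cV[R]_d) : set 'M[R]_(d, m) :=
  [set Z | (tau * mx_inner v v < `|qform (wishart Z - 1%:M) v|)].

Lemma measurable_qform_wishart (v : 'cV[R]_d) :
  measurable_fun setT (fun Z : 'M[R]_(d, m) => qform (wishart Z - 1%:M) v).
Proof.
under eq_fun do rewrite qformB1.
apply: measurable_funB => //; rewrite /qform.
apply: measurable_mx_inner; first exact: measurable_cst.
by apply: measurable_mulmx; [exact: measurable_wishart|exact: measurable_cst].
Qed.

Lemma measurable_dev_set tau v : measurable (dev_set tau v).
Proof.
apply: measurable_lt_set => //; apply: measurableT_comp => //.
exact: measurable_qform_wishart.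
Qed.

(** By rotation invariance [v] may be placed on the first axis, where the
    quadratic form is a chi-square variable. *)
Lemma dev_set_le tau v : 0 < tau -> tau <= 1 ->
  (mu (dev_set tau v) <= (2 * expR (- (m%:R * tau ^+ 2 / 16)))%:E)%E.
Proof.
move=> t0 t1; have [v0|vn] := eqVneq (mx_inner v v) 0.
  rewrite (_ : dev_set _ _ = set0) ?measure0 ?lee_fin ?mulr_ge0 ?expR_ge0//.
  apply/seteqP; split=> // Z; rewrite /dev_set /= v0 mulr0.
  by rewrite (mx_inner_eq0 v0) /qform mulmx0 (_ : mx_inner _ _ = 0) ?normr0 ?ltxx//
    /mx_inner mul0mx mxtrace0.
have vp : 0 < mx_inner v v by rewrite lt0r vn mx_inner_ge0.
have [H [HH Hv]] := householder v.
have isoH : linear_isometry (fun Z : 'M[R]_(d, m) => H *m Z).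
  split=> [a x y|x]; first by rewrite mulmxDr scalemxAr.
  by rewrite mx_innerMr mulmxA (mulmx1C HH) mul1mx.
have mH := measurable_isometry isoH.
have inv := gaussian_isometry_invariant gmu isoH.
rewrite -(law_invariant_set inv mH (measurable_dev_set tau v)).
apply: le_trans (row_sumsq_tail gmu ord0 t0 t1 m0).
rewrite le_eqVlt; apply/orP; left; apply/eqP; congr (mu _).
apply/seteqP; split => Z; rewrite /dev_set /preimage /=;
rewrite qformB1 wishart_mulmx.
all: rewrite (_ : qform (H *m wishart Z *m H^T) v = qform (wishart Z) (H^T *m v));
  last by rewrite /qform -!mulmxA (mulmxA H) mx_innerC -mulmxA mx_innerMr mx_innerC.
all: rewrite Hv qformZ frob_norm_sqr qform_wishart_delta.
all: rewrite (_ : mx_inner v v * _ - mx_inner v v =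
    mx_inner v v * (m%:R^-1 * row_sumsq ord0 Z - 1)); last by ring.
all: by rewrite normrM (ger0_norm (ltW vp)) (mulrC tau) ltr_pM2l.
Qed.

End GoodSet.

(** * The good event *)

Section Grid.
Context {R : realType} {n : nat}.
Local Notation d := n.+1.

(** Grid vectors have coordinates in [-1, 1], multiples of [1 / grid_size]. *)
Definition grid_size := (4 * d ^ 2)%N.
Definition grid_index : finType := {ffun 'I_d -> 'I_(2 * grid_size).+1}.

Definition grid_vec (g : grid_index) : 'cV[R]_d :=
  \col_i ((g i)%:R / grid_size%:R - 1).

Let M : R := grid_size%:R.

Let ME : M = 4 * d%:R ^+ 2.
Proof. by rewrite /M /grid_size natrM natrX. Qed.

Let M0 : 0 < M.
Proof. by rewrite ltr0n /grid_size muln_gt0 expn_gt0. Qed.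

Lemma grid_vec01 (a : 'I_d -> bool) : exists g, grid_vec g = \col_i (a i)%:R.
Proof.
exists [ffun i => inord (grid_size * (a i).+1)%N]; apply/matrixP => i j; rewrite !mxE ffunE inordK.
  have Mn : grid_size%:R != 0 :> R by rewrite gt_eqF.
  by rewrite natrM -natr1; field.
by rewrite ltnS [leqRHS]mulnC leq_mul2l ltnS leq_b1 orbT.
Qed.

Lemma grid_vec_near (x : 'cV[R]_d) : (forall i, `|x i 0| <= 1) ->
  exists g, forall i, `|x i 0 - grid_vec g i 0| <= M^-1.
Proof.
move=> x1.
pose k i := Num.trunc ((x i 0 + 1) * M).
have p0 i : 0 <= (x i 0 + 1) * M.
  by have := x1 i; rewrite ler_norml => /andP[h _]; rewrite mulr_ge0 ?(ltW M0)//; lra.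
have kle i : (k i < (2 * grid_size).+1)%N.
  have /andP[h _] := truncn_itv (p0 i).
  rewrite ltnS -(ler_nat R); apply: le_trans h _.
  rewrite natrM -/M ler_wpM2r ?(ltW M0)//.
  by have := x1 i; rewrite ler_norml => /andP[_ h]; lra.
exists [ffun i => inord (k i)] => i; rewrite mxE ffunE inordK//.
have /andP[h1 h2] := truncn_itv (p0 i).
rewrite -/(k i) -natr1 in h1 h2.
have Mn : M != 0 by rewrite gt_eqF.
rewrite -/M (_ : _ - _ = ((x i 0 + 1) * M - (k i)%:R) / M); last by field.
rewrite normrM (@ger0_norm _ M^-1) ?invr_ge0 ?(ltW M0)//.
rewrite -[leRHS]mul1r ler_wpM2r ?invr_ge0 ?(ltW M0)// ger0_norm; lra.
Qed.

Section Net.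
Variables (S : 'M[R]_d) (tau : R).
Hypothesis sS : S^T = S.
Hypothesis tau0 : 0 <= tau.
Hypothesis hS : forall g, `|qform S (grid_vec g)| <= tau * mx_inner (grid_vec g) (grid_vec g).

Lemma grid_entry i j : `|S i j| <= 2 * tau.
Proof.
have dd (k l : 'I_d) : mx_inner (delta_mx k 0 : 'cV[R]_d) (delta_mx l 0) = (k == l)%:R.
  by rewrite (mx_inner_delta _ (l, 0)) mxE eqxx andbT eq_sym.
have E k : `|S k k| <= tau.
  have [g hg] := grid_vec01 (fun l => l == k).
  have ge : grid_vec g = delta_mx k 0.
    by rewrite hg; apply/matrixP => l l'; rewrite !mxE ord1 eqxx andbT.
  have := hS g; rewrite ge dd eqxx mulr1.
  by rewrite /qform -colE mx_innerC (mx_inner_delta _ (k, 0)) mxE.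
have [<-|ij] := eqVneq i j; first by apply: le_trans (E i) _; rewrite ler_peMl// ler1n.
have [g hg] := grid_vec01 (fun l => (l == i) || (l == j)).
have ge : grid_vec g = delta_mx i 0 + delta_mx j 0.
  rewrite hg; apply/matrixP => l l'; rewrite !mxE ord1 eqxx !andbT.
  by case: eqVneq => [->|]; rewrite ?(negbTE ij) ?addr0 ?add0r.
have := hS g; rewrite ge qformD// !(mx_innerDl, mx_innerDr) !dd !eqxx.
rewrite [i == j](negbTE ij) [j == i]eq_sym (negbTE ij) /qform -!colE.
rewrite !(mx_innerC (delta_mx _ _)).
rewrite !(mx_inner_delta _ (i, 0)) !(mx_inner_delta _ (j, 0)) !mxE.
have sij : S j i = S i j by rewrite -[in LHS]sS mxE.
rewrite ?sij; move: (E i) (E j); rewrite !ler_norml.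
move=> /= /andP[a1 a2] /andP[b1 b2] /andP[c1 c2]; have t0 := tau0; apply/andP; split; lra.
Qed.

Lemma grid_frob : frob_norm S <= 2 * d%:R * tau.
Proof.
apply: frob_norm_le; first by rewrite !mulr_ge0 ?ler0n.
rewrite mx_innerE (le_trans (y := \sum_(p : 'I_d * 'I_d) (2 * tau) ^+ 2))//.
  apply: ler_sum => p _; rewrite -expr2 -[leLHS](real_normK (num_real _)).
  by rewrite lerXn2r ?nnegrE ?mulr_ge0 ?grid_entry.
rewrite sumr_const card_prod card_ord -[leLHS]mulr_natr natrM le_eqVlt; apply/orP; left.
by apply/eqP; ring.
Qed.

Lemma grid_unit (x : 'cV[R]_d) : frob_norm x = 1 -> `|qform S x| <= 3 * tau.
Proof.
move=> x1.
have xi i : `|x i 0| <= 1.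
  have := mx_inner_sqr_le x (delta_mx i 0).
  rewrite (mx_inner_delta _ (i, 0)) (mx_inner_delta _ (i, 0)) mxE !eqxx mulr1.
  rewrite -frob_norm_sqr x1 /= => h.
  by rewrite -(@ler_pXn2r _ 2) ?nnegrE// (real_normK (num_real _)).
have [g hg] := grid_vec_near xi; set v := grid_vec g in hg.
pose r := x - v; have d1 : 1 <= d%:R :> R by rewrite ler1n.
have r1 : frob_norm r <= (4 * d%:R)^-1.
  apply: frob_norm_le; first by rewrite invr_ge0 mulr_ge0 ?ler0n.
  rewrite mx_innerE (le_trans (y := \sum_(p : 'I_d * 'I_1) (M^-1) ^+ 2))//.
    apply: ler_sum => -[i j] _; rewrite -expr2 -[leLHS](real_normK (num_real _)) /= ord1.
    by rewrite lerXn2r ?nnegrE ?invr_ge0 ?(ltW M0)//; have := hg i; rewrite !mxE.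
  rewrite sumr_const card_prod !card_ord -[leLHS]mulr_natr muln1.
  have d0 : d%:R != 0 :> R by rewrite pnatr_eq0.
  rewrite ME (_ : _ * _ = (4 * d%:R)^-1 ^+ 2 / d%:R); last by field.
  by rewrite ler_pdivrMr ?ltr0n// ler_peMr// sqr_ge0.
have r2 : frob_norm r <= 1 / 4.
  apply: le_trans r1 _; rewrite div1r lef_pV2 ?posrE ?mulr_gt0 ?ltr0n//.
  by rewrite ler_peMr.
have v1 : frob_norm v <= 5 / 4.
  have -> : v = x + - r by rewrite /r opprB addrC subrK.
  by apply: le_trans (frob_normD _ _) _; rewrite frob_normN x1; lra.
have qv : `|qform S v| <= tau * (25 / 16).
  apply: le_trans (hS g) _; rewrite ler_wpM2l// -frob_norm_sqr -/v.
  have -> : 25 / 16 = (5 / 4) ^+ 2 :> R by field.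
  by rewrite lerXn2r ?nnegrE ?frob_norm_ge0//; lra.
have qd : qform S x = qform S v + mx_inner r (S *m (x + v)).
  rewrite /r /qform mulmxDr mx_innerBl !mx_innerDr.
  have -> : mx_inner v (S *m x) = mx_inner x (S *m v).
    by rewrite [RHS]mx_innerC [LHS]mx_innerC mx_innerMr sS mx_innerC.
  ring.
have bd u : `|mx_inner r u| <= frob_norm r * frob_norm u.
  rewrite ler_norml mx_inner_le andbT lerNl -mx_innerNl.
  by apply: le_trans (mx_inner_le _ _) _; rewrite frob_normN.
have Sxv : frob_norm (S *m (x + v)) <= (2 * d%:R * tau) * (9 / 4).
  apply: le_trans (frob_norm_mulmxl (x + v) (frob_norm_ge0 S) (op_le_frob S)) _.
  apply: ler_pM; rewrite ?frob_norm_ge0 ?grid_frob//.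
  by apply: le_trans (frob_normD _ _) _; rewrite x1; lra.
have : `|mx_inner r (S *m (x + v))| <= (4 * d%:R)^-1 * ((2 * d%:R * tau) * (9 / 4)).
  by apply: le_trans (bd _) _; apply: ler_pM; rewrite ?frob_norm_ge0.
have d0 : d%:R != 0 :> R by rewrite pnatr_eq0.
rewrite (_ : _^-1 * _ = 9 / 8 * tau); last by field.
rewrite qd => h; apply: le_trans (ler_normD _ _) _; have t0 := tau0; lra.
Qed.

(** Rounding a unit vector to the grid moves it by at most [1 / (4 d)]. This is
    affordable because the values on [e_i] and [e_i + e_j], which are grid
    vectors, already bound the entries of [S], hence its Frobenius norm. *)
Lemma grid_net (x : 'cV[R]_d) : `|qform S x| <= 3 * tau * mx_inner x x.
Proof.
have [x0|xn] := eqVneq (mx_inner x x) 0.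
  rewrite (mx_inner_eq0 x0) /qform mulmx0 (_ : mx_inner _ _ = 0) ?normr0 ?mulr0//.
  by rewrite /mx_inner mul0mx mxtrace0.
have xp : 0 < mx_inner x x by rewrite lt0r xn mx_inner_ge0.
have fp : 0 < frob_norm x by rewrite sqrtr_gt0.
have fn : frob_norm x != 0 by rewrite gt_eqF.
have e : x = frob_norm x *: ((frob_norm x)^-1 *: x) by rewrite scalerA divff// scale1r.
have u1 : frob_norm ((frob_norm x)^-1 *: x) = 1.
  by rewrite frob_normZ ger0_norm ?invr_ge0 ?(ltW fp)// mulVf.
rewrite {1}e qformZ frob_norm_sqr normrM (ger0_norm (ltW xp)) mulrC.
by rewrite ler_wpM2r ?(ltW xp)// grid_unit.
Qed.

End Net.
End Grid.

Section Good.
Context {R : realType} {n m : nat}.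
Local Notation d := n.+1.

(** [3 / 20 <= 1 / 6]: by [grid_net] these finitely many constraints give
    [near_id (1 / 6)]. *)
Definition good : set 'M[R]_(d, m) :=
  [set Z | forall g : @grid_index n, ~ dev_set (1 / 20) (grid_vec g) Z].

Lemma goodC_bigcup : ~` good =
  \bigcup_(g in [set: @grid_index n]) dev_set (1 / 20) (grid_vec g).
Proof.
apply/seteqP; split => Z /=.
  by move=> /existsNP[g /contrapT h]; exists g.
by move=> [g _ h] /(_ g).
Qed.

Lemma measurable_good : measurable good.
Proof.
rewrite -(setCK good); apply: measurableC; rewrite goodC_bigcup.
apply: fin_bigcup_measurable => [|g _]; last exact: measurable_dev_set.
exact: finite_finset.
Qed.

Lemma good_near_id Z : good Z -> near_id (1 / 6) (wishart Z).
Proof.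
move=> gZ; have sW : (wishart Z)^T = wishart Z := wishart_sym Z.
split=> // x.
have sS : (wishart Z - 1%:M)^T = wishart Z - 1%:M.
  by rewrite linearB /= trmx1 sW.
have h g : `|qform (wishart Z - 1%:M) (grid_vec g)| <= 1 / 20 * mx_inner (grid_vec g) (grid_vec g).
  by rewrite leNgt; apply/negP => h; exact: gZ h.
have t0 : 0 <= 1 / 20 :> R by lra.
apply: le_trans (grid_net sS t0 h x) _.
by rewrite ler_wpM2r ?mx_inner_ge0//; lra.
Qed.

Lemma good_fail_le (mu : probability 'M[R]_(d, m) R) : gaussian_law mu -> (0 < m)%N ->
  (mu (~` good) <= ((8 * d ^ 2).+1 ^ d)%:R%:E * (2 * expR (- (m%:R / 6400)))%:E)%E.
Proof.
move=> gmu m0.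
have h t : (~` good) t -> exists g : @grid_index n, dev_set (1 / 20) (grid_vec g) t.
  by rewrite goodC_bigcup => -[g _ h]; exists g.
apply: (le_trans (@probability_union_le _ _ _ mu _ _ _ (measurableC measurable_good) _ h)).
  by move=> g; exact: measurable_dev_set.
have t0 : 0 < 1 / 20 :> R by lra.
have t1 : 1 / 20 <= 1 :> R by lra.
apply: (@le_trans _ _ (\sum_(g : @grid_index n) (2 * expR (- (m%:R / 6400)))%:E)%E).
  apply: lee_sum => g _; apply: le_trans (dev_set_le m0 gmu (grid_vec g) t0 t1) _.
  rewrite lee_fin (_ : m%:R * (1 / 20) ^+ 2 / 16 = m%:R / 6400)//; by field.
rewrite sumEFin sumr_const card_ffun !card_ord -EFinM lee_fin -[leLHS]mulr_natl.
by rewrite (_ : (2 * @grid_size n = 8 * d ^ 2)%N) ?lexx// /grid_size mulnA.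
Qed.

End Good.

(** * Frobenius deviation of the sample covariance *)

Section RowCross.
Context {R : realType} {d m : nat}.
Variable mu : probability 'M[R]_(d, m) R.
Hypothesis gmu : gaussian_law mu.
Hypothesis m0 : (0 < m)%N.
Variable i : 'I_d.

Definition row_inner (j : 'I_d) (Z : 'M[R]_(d, m)) : R := \sum_k Z j k * Z i k.

(** Truncating the length of row [i] keeps the Laplace transform of the squared
    inner products with it finite. *)
Definition short_row (Z : 'M[R]_(d, m)) : R := (row_sumsq i Z <= 2 * m%:R :> R)%R%:R.

Lemma measurable_short_row : measurable_fun setT short_row.
Proof.
rewrite (_ : short_row = \1_[set Z | row_sumsq i Z <= 2 * m%:R]).
  apply: measurable_indic; apply: measurable_le_set => //.
  exact: measurable_row_sumsq.
apply/funext => Z; rewrite /short_row indicE; congr (nat_of_bool _)%:R.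
by apply/idP/idP; rewrite inE.
Qed.

Lemma measurable_row_inner j : measurable_fun setT (row_inner j).
Proof.
by apply: measurable_sum => k; apply: measurable_funM; exact: measurable_entry.
Qed.

(** Given row [i], its inner products with the other rows are independent centered
    Gaussian variables with variance the squared length of row [i]. With
    the coefficient [1 / (8 * m)], the quantity under the square root in
    [gaussian_mgf_square] is at least [1 / 2], so each row contributes a factor
    at most [sqrt 2 <= expR 1]. *)
Lemma row_cross_mgf (s : seq 'I_d) : uniq s -> i \notin s ->
  (\int[mu]_Z (expR ((8 * m%:R)^-1 *
     \sum_(j <- s) (short_row Z * row_inner j Z) ^+ 2))%:E <= (expR (size s)%:R)%:E)%E.
Proof.
have mp : (0 : R) < m%:R by rewrite ltr0n.
have mn : m%:R != 0 :> R by rewrite gt_eqF.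
set c := (8 * m%:R)^-1.
have c0 : 0 <= c by rewrite invr_ge0 mulr_ge0.
have mQ s' : measurable_fun setT (fun Z => \sum_(j <- s') (short_row Z * row_inner j Z) ^+ 2).
  apply: measurable_sum => j; apply: measurable_funX; apply: measurable_funM.
    exact: measurable_short_row.
  exact: measurable_row_inner.
elim: s => [_ _|j s IH /= /andP[js us]].
  under eq_integral do rewrite big_nil mulr0 expR0.
  by rewrite (integral_cst mu measurableT 1%:E) mul1e expR0; exact: (probability_le1 mu measurableT).
rewrite inE negb_or => /andP[ij is_].
pose l := [seq (j, k) | k <- index_enum 'I_m].
have ul : uniq l by rewrite map_inj_uniq ?index_enum_uniq// => a b [].
have lj p : p \in l -> p.1 = j by move=> /mapP[k _ ->].
pose F (Z : 'M[R]_(d, m)) :=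
  (expR (c * \sum_(j <- s) (short_row Z * row_inner j Z) ^+ 2))%:E.
pose u (p : 'I_d * 'I_m) (Z : 'M[R]_(d, m)) := short_row Z * Z i p.2.
have upd_other (p : 'I_d * 'I_m) t (Z : 'M[R]_(d, m)) a k :
    p \in l -> a != j -> (upd p t Z) a k = Z a k.
  move=> pl aj; rewrite (updE p t Z (a, k)); case: eqP => // ap.
  by move: aj; rewrite -(lj _ pl) -ap eqxx.
have short_upd p t Z : p \in l -> short_row (upd p t Z) = short_row Z.
  move=> pl; rewrite /short_row /row_sumsq.
  by under eq_bigr do rewrite upd_other//.
have cF : constant_along l F.
  move=> p t Z pl; rewrite /F short_upd//; do 3 congr (_ _).
  apply: eq_big_seq => a as_; congr ((_ * _) ^+ 2).
  rewrite /row_inner; apply: eq_bigr => k _; rewrite !upd_other//.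
  by apply: contraNneq js => <-.
have cu p : constant_along l (u p).
  by move=> q t Z ql; rewrite /u short_upd// upd_other.
have mu_ p : measurable_fun setT (u p).
  by apply: measurable_funM; [exact: measurable_short_row|exact: measurable_entry].
have mF : measurable_fun setT F.
  apply/measurable_EFinP; apply: measurableT_comp => //.
  by apply: measurable_funM => //; exact: mQ.
have sumu Z : \sum_(p <- l) u p Z ^+ 2 = short_row Z * row_sumsq i Z.
  rewrite big_map /u /= /row_sumsq mulr_sumr; apply: eq_bigr => k _.
  by rewrite exprMn /short_row -natrX; case: (_ <= _).
have sumu_le Z : \sum_(p <- l) u p Z ^+ 2 <= 2 * m%:R.
  rewrite sumu /short_row; case: (leP (row_sumsq i Z) (2 * m%:R)) => /= h; rewrite ?mulr1n ?mulr0n ?mul1r ?mul0r ?mulr_ge0 ?ler0n //.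
have ub Z : 2 * c * \sum_(p <- l) u p Z ^+ 2 <= 1 / 2.
  apply: (@le_trans _ _ (2 * c * (2 * m%:R))); first by rewrite ler_wpM2l ?mulr_ge0.
  by rewrite le_eqVlt /c; apply/orP; left; apply/eqP; field.
have ub1 Z : 2 * c * \sum_(p <- l) u p Z ^+ 2 < 1 by have := ub Z; lra.
have F0 Z : (0 <= F Z)%E by rewrite lee_fin expR_ge0.
have h := gaussian_mgf_square gmu c0 ul mF F0 cF mu_ cu ub1.
rewrite (_ : (fun Z => (expR (c * \sum_(j0 <- j :: s) _))%:E) =
  fun Z => (F Z * (expR (c * (\sum_(p <- l) Z p.1 p.2 * u p Z) ^+ 2))%:E)%E); last first.
  apply/funext => Z; rewrite /F -EFinM -expRD big_cons -mulrDr addrC.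
  congr (expR (c * (_ + _)))%:E; congr (_ ^+ 2).
  rewrite big_map /u /row_inner mulr_sumr; apply: eq_bigr => k _ /=; ring.
rewrite h; apply: (@le_trans _ _ (\int[mu]_Z (F Z * (expR 1)%:E))%E).
  apply: ge0_le_integral => //.
  - by move=> Z _; rewrite mule_ge0// lee_fin invr_ge0 sqrtr_ge0.
  - apply: emeasurable_funM => //; apply/measurable_EFinP.
    apply: measurable_inv.
    have msq : measurable_fun setT (@Num.sqrt R).
      by apply: continuous_measurable_fun; exact: sqrt_continuous.
    apply: measurableT_comp => //.
    apply: measurable_funB => //; apply: measurable_funM => //.
    by apply: measurable_sum => p; apply: measurable_funX; exact: mu_.
  - exact: emeasurable_funM.
  move=> Z _; apply: lee_wpmul2l => //; rewrite lee_fin.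
  apply: (@le_trans _ _ 2); last by have := expR_ge1Dx (1 : R); lra.
  have h4 : 1 / 2 <= Num.sqrt (1 - 2 * c * \sum_(p <- l) u p Z ^+ 2).
    rewrite -(@ler_pXn2r _ 2)// ?nnegrE ?sqrtr_ge0// sqr_sqrtr; have := ub Z; lra.
  rewrite -[leRHS]invrK lef_pV2 ?posrE//; lra.
rewrite ge0_integralZr//.
rewrite -natr1 expRD EFinM; apply: lee_wpmul2r => //.
exact: IH.
Qed.

End RowCross.

Section FrobeniusDeviation.
Context {R : realType} {n m : nat}.
Local Notation d := n.+1.
Variable mu : probability 'M[R]_(d, m) R.
Hypothesis gmu : gaussian_law mu.
Hypothesis m0 : (0 < m)%N.

Lemma frob_wishart_rows (Z : 'M[R]_(d, m)) :
  frob_norm (wishart Z - 1%:M) ^+ 2 =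
  \sum_i ((m%:R^-1 * row_sumsq i Z - 1) ^+ 2 +
          \sum_(j | j != i) (m%:R^-1 * row_inner i j Z) ^+ 2).
Proof.
rewrite frob_norm_sqr mx_innerE.
rewrite -(pair_bigA _ (fun i j => (wishart Z - 1%:M) i j * (wishart Z - 1%:M) i j))/=.
have W i j : wishart Z i j = m%:R^-1 * row_inner i j Z.
  rewrite wishart.unlock !mxE; congr (_ * _); rewrite /row_inner.
  by apply: eq_bigr => k _; rewrite mxE mulrC.
apply: eq_bigr => i _; rewrite (bigD1 i)//= -!expr2; congr (_ + _).
  rewrite !mxE eqxx mulr1n W; congr ((_ * _ - _) ^+ 2).
by apply: eq_bigr => j ji; rewrite -expr2 !mxE eq_sym (negbTE ji) subr0 W.
Qed.

(** The off-diagonal entries of a row are bounded all at once, by Chernoff's bound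
    on the sum of their squares: only [d] events are needed, at the price of the
    term [d] in the exponent. *)
Lemma frob_wishart_tail (u : R) : 0 < u -> 16 * u <= m%:R ->
  (mu [set Z | (24 * d%:R * u / m%:R < frob_norm (wishart Z - 1%:M) ^+ 2)%R] <=
   (3 * d%:R * expR (d%:R - u))%:E)%E.
Proof.
move=> u0 um; have mp : (0 : R) < m%:R by rewrite ltr0n.
have mn : m%:R != 0 :> R by rewrite gt_eqF.
pose tau := Num.sqrt (16 * u / m%:R).
have tau2 : tau ^+ 2 = 16 * u / m%:R by rewrite sqr_sqrtr ?divr_ge0// mulr_ge0 ?ltW.
have tau0 : 0 < tau by rewrite sqrtr_gt0 divr_gt0// mulr_gt0.
have tau1 : tau <= 1.
  by rewrite -(@ler_pXn2r _ 2) ?nnegrE ?(ltW tau0)// tau2 expr1n ler_pdivrMr// mul1r.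
pose others i := [seq j <- index_enum 'I_d | j != i].
pose q i (Z : 'M[R]_(d, m)) := (8 * m%:R)^-1 *
     \sum_(j <- others i) (short_row i Z * row_inner i j Z) ^+ 2.
pose E1 i := [set Z : 'M[R]_(d, m) | tau < `|m%:R^-1 * row_sumsq i Z - 1|].
pose E2 i := [set Z | u <= q i Z].
have mq i : measurable_fun setT (q i).
  apply: measurable_funM => //; apply: measurable_sum => j; apply: measurable_funX.
  by apply: measurable_funM; [exact: measurable_short_row|exact: measurable_row_inner].
have mE1 i : measurable (E1 i).
  apply: measurable_lt_set => //; apply: measurableT_comp => //.
  apply: measurable_funB => //; apply: measurable_funM => //.
  exact: measurable_row_sumsq.
have mE2 i : measurable (E2 i) by exact: measurable_le_set.
have mEE i : measurable (E1 i `|` E2 i) by exact: measurableU.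
set F := [set Z | _].
have mF : measurable F.
  apply: measurable_lt_set => //; under eq_fun do rewrite frob_norm_sqr.
  have mW1 : measurable_fun setT (fun Z : 'M[R]_(d, m) => wishart Z - 1%:M).
    by apply: measurable_addmx; [exact: measurable_wishart|exact: measurable_cst].
  exact: measurable_mx_inner.
have cover Z : F Z -> exists i, (E1 i `|` E2 i) Z.
  rewrite /F /=; apply: contraPP => /forallNP h; apply/negP; rewrite -leNgt.
  rewrite frob_wishart_rows.
  apply: (@le_trans _ _ (\sum_(i < d) (24 * u / m%:R))); last first.
    by rewrite sumr_const card_ord -[leLHS]mulr_natl le_eqVlt; apply/orP; left; apply/eqP; field.
  apply: ler_sum => i _; have := h i; rewrite /setU /= => /not_orP[/negP a1 /negP a2].
  rewrite -leNgt in a1; rewrite -ltNge in a2.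
  have rs : row_sumsq i Z <= 2 * m%:R.
    move: a1; rewrite ler_norml => /andP[_ a1].
    by rewrite -ler_pdivrMr// mulrC; lra.
  have sh : short_row i Z = 1 by rewrite /short_row rs.
  have : (m%:R^-1 * row_sumsq i Z - 1) ^+ 2 <= 16 * u / m%:R.
    rewrite -tau2 -[leLHS](real_normK (num_real _)).
    by rewrite lerXn2r ?nnegrE ?(ltW tau0).
  have : \sum_(j | j != i) (m%:R^-1 * row_inner i j Z) ^+ 2 <= 8 * u / m%:R.
    rewrite (_ : \sum_(j | j != i) _ = 8 / m%:R * q i Z).
      by rewrite [leRHS]mulrAC ler_wpM2l ?divr_ge0 ?(ltW mp) ?(ltW a2).
    rewrite /q mulrA mulr_sumr big_filter; apply: eq_bigr => j _.
    by rewrite sh mul1r; field.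
  have -> : 24 * u / m%:R = 16 * u / m%:R + 8 * u / m%:R by ring.
  by move=> b1 b2; exact: lerD.
apply: (le_trans (@probability_union_le _ _ _ mu _ _ _ mF mEE cover)).
apply: (@le_trans _ _ (\sum_(i < d) (3 * expR (d%:R - u))%:E)%E); last first.
  rewrite sumEFin sumr_const card_ord lee_fin -[leLHS]mulr_natl le_eqVlt.
  by apply/orP; left; apply/eqP; ring.
apply: lee_sum => i _; apply: (le_trans (measureU2 mu (mE1 i) (mE2 i))).
apply: (@le_trans _ _ ((2 * expR (- u))%:E + (expR (d%:R - u))%:E)%E).
  apply: leeD.
    apply: (le_trans (row_sumsq_tail gmu i tau0 tau1 m0)).
    rewrite lee_fin (_ : m%:R * _ / 16 = u)// tau2; by field.
  apply: (@chernoff _ _ _ mu (q i) u d%:R) => //.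
  have := row_cross_mgf gmu m0 (i := i) (s := others i).
  rewrite filter_uniq ?index_enum_uniq// mem_filter eqxx /=.
  move=> /(_ isT isT) h; apply: (le_trans h); rewrite lee_fin ler_expR ler_nat.
  rewrite size_filter; apply: (leq_trans (count_size _ _)).
  by rewrite -[leqRHS]card_ord cardT enumT.
rewrite -EFinD lee_fin.
have : expR (- u) <= expR (d%:R - u) by rewrite ler_expR lerDr.
lra.
Qed.

End FrobeniusDeviation.

(** * Whitening the two samples *)

Section Law.
Context {disp : measure_display} {T : measurableType disp} {R : realType}.
Variable P : probability T R.

Definition law_of m n (f : T -> 'M[R]_(m, n)) (mf : measurable_fun setT f) :
  probability 'M[R]_(m, n) R := distribution P (mfun_Sub (mem_set mf)).

Lemma law_ofE m n (f : T -> 'M[R]_(m, n)) (mf : measurable_fun setT f) A :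
  law_of mf A = P (f @^-1` A).
Proof. by []. Qed.

(** If [X = A Z] then [M X = (M A) Z], and [M A] is orthogonal. *)
Lemma gaussian_column d (S M : 'M[R]_d) (X : {RV P >-> d.-tuple R}) (B : 'I_d -> set R) :
  gaussian_vector S X -> M *m S *m M^T = 1%:M -> (forall i, measurable (B i)) ->
  P [set w | forall i, B i ((M *m col_of_tuple (X w)) i 0)] =
    (\prod_i fine (gauss1 R (B i)))%:E.
Proof.
move=> [A [Z [AA Zind Zlaw XE]]] MS mB.
pose z w : 'cV[R]_d := \col_k Z k w.
have mz : measurable_fun setT z.
  apply: measurable_fun_matrixP => i j; under eq_fun do rewrite mxE.
  exact: measurable_funPT.
have gz : gaussian_law (law_of mz).
  move=> C mC; rewrite law_ofE.
  have := Zind [set: 'I_d]%SET (fun i => C (i, 0)) (fun i => mC _).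
  rewrite (_ : \bigcap_(i in _) _ = z @^-1` box C); last first.
    apply/seteqP; split => w /= h.
      by move=> -[i j]; rewrite /= ord1 mxE; have := h i; rewrite /= inE; apply.
    by move=> i _; have := h (i, 0); rewrite /= mxE.
  move=> ->; congr EFin; rewrite !prod_pair /=.
  under eq_bigl do rewrite inE; apply: eq_bigr => i _; rewrite big_ord1; congr fine.
  exact: Zlaw.
pose O := M *m A.
have OO : O^T *m O = 1%:M.
  by apply: mulmx1C; rewrite /O trmx_mul mulmxA -(mulmxA M) AA.
have iO : linear_isometry (fun u : 'cV[R]_d => O *m u).
  split=> [a x y|x]; first by rewrite mulmxDr scalemxAr.
  by rewrite mx_innerMr mulmxA OO mul1mx.
have inv := gaussian_isometry_invariant gz iO.
pose C (p : 'I_d * 'I_1) := B p.1.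
have mC p : measurable (C p) by exact: mB.
have := law_invariant_set inv (measurable_isometry iO) (measurable_box mC).
rewrite (gz C mC) prod_pair /=.
under eq_bigr do rewrite big_ord1.
move=> <-; rewrite law_ofE; congr (P _); apply/seteqP; split => w /= h.
  by move=> -[i j]; have := h i; rewrite /C XE ord1 /= /O -mulmxA.
by move=> i; have := h (i, 0); rewrite /C XE /= /O -mulmxA.
Qed.

Lemma gauss1_setT : fine (gauss1 R setT) = 1.
Proof. by rewrite (_ : gauss1 R setT = 1%:E)//; exact: probability_setT. Qed.

End Law.

Section Marginals.
Context {R : realType} {d m n : nat}.

Variable nu : probability 'M[R]_(d, m + n) R.
Hypothesis gnu : gaussian_law nu.

Lemma gaussian_law_lsubmx : gaussian_law (law_of nu (@measurable_lsub R d m n)).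
Proof.
move=> B mB; rewrite law_ofE.
pose C (p : 'I_d * 'I_(m + n)) :=
  if fintype.split p.2 is inl k then B (p.1, k) else setT.
have mC p : measurable (C p) by rewrite /C; case: (fintype.split _).
rewrite (_ : _ @^-1` _ = box C); last first.
  apply/seteqP; split => Z /= h [i k] /=.
    rewrite /C /=; case: fintype.splitP => // j kj.
    by have := h (i, j); rewrite mxE /= (_ : lshift n j = k)//; exact: val_inj.
  by rewrite mxE; have := h (i, lshift n k); rewrite /C /= (unsplitK (inl k)).
rewrite gnu//; congr EFin.
rewrite !prod_pair /=.
apply: eq_bigr => i _; rewrite big_split_ord /= [X in _ * X]big1 ?mulr1.
  by apply: eq_bigr => k _; rewrite /C /= (unsplitK (inl k)).
by move=> k _; rewrite /C /= (unsplitK (inr k)) gauss1_setT.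
Qed.

Lemma gaussian_law_rsubmx : gaussian_law (law_of nu (@measurable_rsub R d m n)).
Proof.
move=> B mB; rewrite law_ofE.
pose C (p : 'I_d * 'I_(m + n)) :=
  if fintype.split p.2 is inr k then B (p.1, k) else setT.
have mC p : measurable (C p) by rewrite /C; case: (fintype.split _).
rewrite (_ : _ @^-1` _ = box C); last first.
  apply/seteqP; split => Z /= h [i k] /=.
    rewrite /C /=; case: fintype.splitP => // j kj.
    by have := h (i, j); rewrite mxE /= (_ : rshift m j = k)//; exact: val_inj.
  by rewrite mxE; have := h (i, rshift m k); rewrite /C /= (unsplitK (inr k)).
rewrite gnu//; congr EFin.
rewrite !prod_pair /=.
apply: eq_bigr => i _; rewrite big_split_ord /= [X in X * _]big1 ?mul1r.
  by apply: eq_bigr => k _; rewrite /C /= (unsplitK (inr k)).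
by move=> k _; rewrite /C /= (unsplitK (inl k)) gauss1_setT.
Qed.

End Marginals.

Section Whitening.
Context {disp : measure_display} {T : measurableType disp} {R : realType}.
Variable P : probability T R.
Context {d : nat}.

Definition whiten (M : 'M[R]_d) m (X : 'I_m -> {RV P >-> d.-tuple R}) (w : T) :
  'M[R]_(d, m) := \matrix_(i, k) (M *m col_of_tuple (X k w)) i 0.

Lemma measurable_whiten M m (X : 'I_m -> {RV P >-> d.-tuple R}) :
  measurable_fun setT (whiten M X).
Proof.
apply: measurable_fun_matrixP => i j; under eq_fun do rewrite !mxE.
apply: measurable_sum => k; apply: measurable_funM => //.
under eq_fun do rewrite mxE.
exact: (measurableT_comp (measurable_tnth k) (measurable_funPT (X j))).
Qed.

Lemma sample_cov_whiten (A : 'M[R]_d) m (X : 'I_m -> {RV P >-> d.-tuple R}) w :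
  A \in unitmx -> sample_cov X w = A *m wishart (whiten (invmx A) X w) *m A^T.
Proof.
move=> uA; rewrite wishart.unlock /sample_cov -scalemxAr -scalemxAl; congr (_ *: _).
set W := whiten _ _ _; rewrite (_ : A *m _ *m A^T = (A *m W) *m (A *m W)^T); last first.
  by rewrite trmx_mul !mulmxA.
rewrite /W.
have -> : A *m whiten (invmx A) X w = \matrix_(i, k) (col_of_tuple (X k w)) i 0.
  apply/matrixP => i k; rewrite [RHS]mxE -[in RHS](mulKVmx uA (col_of_tuple (X k w))).
  by rewrite !mxE; apply: eq_bigr => j _; rewrite !mxE.
apply/matrixP => i j; rewrite summxE !mxE; apply: eq_bigr => k _.
by rewrite !mxE big_ord1 !mxE.
Qed.

Context {m n : nat} (X : 'I_m -> {RV P >-> d.-tuple R}) (Y : 'I_n -> {RV P >-> d.-tuple R}).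
Variables (S1 S2 M1 M2 : 'M[R]_d).
Hypothesis XYind : mutually_independent (sum_family X Y).
Hypothesis gX : forall i, gaussian_vector S1 (X i).
Hypothesis gY : forall j, gaussian_vector S2 (Y j).
Hypothesis M1S : M1 *m S1 *m M1^T = 1%:M.
Hypothesis M2S : M2 *m S2 *m M2^T = 1%:M.

Definition whitened_samples w : 'M[R]_(d, m + n) :=
  row_mx (whiten M1 X w) (whiten M2 Y w).

Lemma measurable_whitened_samples : measurable_fun setT whitened_samples.
Proof.
apply: measurable_fun_matrixP => i j; under eq_fun do rewrite mxE.
case: (fintype.split j) => k.
  exact: (measurableT_comp (measurable_entry i k) (measurable_whiten M1 X)).
exact: (measurableT_comp (measurable_entry i k) (measurable_whiten M2 Y)).
Qed.

Lemma gaussian_whitened_samples : gaussian_law (law_of P measurable_whitened_samples).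
Proof.
move=> B mB; rewrite law_ofE.
pose Mof (s : 'I_m + 'I_n) := if s is inl _ then M1 else M2.
pose Bs (s : 'I_m + 'I_n) i := B (i, unsplit s).
pose Cs s : set (d.-tuple R) := [set t | forall i, Bs s i ((Mof s *m col_of_tuple t) i 0)].
have mCs s : measurable (Cs s).
  pose f (t : d.-tuple R) : 'cV[R]_d := Mof s *m col_of_tuple t.
  have mf : measurable_fun setT f.
    apply: measurable_mulmx; first exact: measurable_cst.
    apply: measurable_fun_matrixP => i j; under eq_fun do rewrite mxE.
    exact: measurable_tnth.
  rewrite (_ : Cs s = f @^-1` box (fun p => Bs s p.1)).
    rewrite -[X in measurable X]setTI; apply: mf => //.
    by apply: measurable_box => p; exact: mB.
  apply/seteqP; split => t /= h; first by move=> -[i j] /=; rewrite ord1; exact: h.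
  by move=> i; exact: (h (i, 0)).
have := @XYind [set: 'I_m + 'I_n]%SET Cs mCs.
have Ecol s : P (sum_family X Y s @^-1` Cs s) = (\prod_i fine (gauss1 R (Bs s i)))%:E.
  case: s => k.
    by apply: (gaussian_column (gX k) M1S) => i; exact: mB.
  by apply: (gaussian_column (gY k) M2S) => i; exact: mB.
rewrite (_ : \bigcap_(i in _) _ = whitened_samples @^-1` box B); last first.
  apply/seteqP; split => w /= h.
    move=> -[i k] /=; rewrite mxE; case: fintype.splitP => j kj.
      have kE : k = lshift n j by exact: val_inj.
      have := h (inl j); rewrite /= inE => /(_ isT i).
      by rewrite /Bs /= kE [whiten _ _ _ _ _]mxE.
    have kE : k = rshift m j by exact: val_inj.
    have := h (inr j); rewrite /= inE => /(_ isT i).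
    by rewrite /Bs /= kE [whiten _ _ _ _ _]mxE.
  move=> [k|k] _ i; have := h (i, unsplit _).
    by move=> /(_ (inl k)); rewrite /= row_mxEl mxE.
  by move=> /(_ (inr k)); rewrite /= row_mxEr mxE.
move=> ->; congr EFin; under eq_bigr do rewrite Ecol /=.
under eq_bigl do rewrite inE.
rewrite big_sumType /=.
rewrite prod_pair [RHS]exchange_big /=.
by rewrite big_split_ord.
Qed.

(** The whitened samples are two independent standard Gaussian matrices, whose
    joint law is therefore the product of its marginals. *)
Lemma whitened_samples_law : exists (mu : probability 'M[R]_(d, m) R)
    (nu : probability 'M[R]_(d, n) R), [/\ gaussian_law mu, gaussian_law nu &
  forall E, measurable E -> P (whitened_samples @^-1` E) = joint_law mu nu E].
Proof.
have g := gaussian_whitened_samples.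
exists (law_of (law_of P measurable_whitened_samples) (@measurable_lsub R d m n)).
exists (law_of (law_of P measurable_whitened_samples) (@measurable_rsub R d m n)).
split; [exact: gaussian_law_lsubmx|exact: gaussian_law_rsubmx|move=> E mE].
rewrite -(law_ofE P measurable_whitened_samples).
apply: gaussian_law_unique => //; apply: gaussian_joint_law.
  exact: gaussian_law_lsubmx.
exact: gaussian_law_rsubmx.
Qed.

End Whitening.

(** * The likelihood score of a wrong labelling *)

Section Score.
Context {R : realType} {n : nat}.
Implicit Types (G V W : 'M[R]_n).

(** Its inner product with the second whitened sample covariance is the excess of
    the objective over its value at the true labelling. *)
Definition excess G V : 'M[R]_n := G^T *m V *m G - V.

Lemma excess_sym G V : V^T = V -> (excess G V)^T = excess G V.
Proof.
move=> sV; rewrite /excess linearB /= !trmx_mul trmxK sV.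
by rewrite mulmxA.
Qed.

Lemma excess_tr G V : V^T = V ->
  \tr (excess G V) = mx_inner (G *m G^T - 1%:M) V.
Proof.
move=> sV; rewrite /excess /mx_inner sV raddfB /= mulmxBl mul1mx raddfB /=.
by rewrite -mulmxA mxtrace_mulC -mulmxA mxtrace_mulC.
Qed.

Lemma distortion_tr G : \tr (G *m G^T - 1%:M) = mx_inner G G - n%:R.
Proof. by rewrite raddfB /= mxtrace1. Qed.

(** [tr N = <K, V>] is at least [D / 5 - |K| a] and at most [5 |N| b]; since [|K|]
    and [|N|] are of order [sqrt D] and [sqrt D + f], this is a quadratic
    inequality in [sqrt D]. *)
Lemma distortion_bound G W WY (a b f : R) : \det G ^+ 2 = 1 -> near_id (1 / 2) W ->
  1 / 5 * \tr (G *m G^T - 1%:M) - frob_norm (G *m G^T - 1%:M) * a <=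
    mx_inner (G *m G^T - 1%:M) (invmx W) ->
  (0 <= \tr (excess G (invmx W)) ->
   1 / 5 * \tr (excess G (invmx W)) - frob_norm (excess G (invmx W)) * b <=
     mx_inner (excess G (invmx W)) WY) ->
  mx_inner (excess G (invmx W)) WY <= 0 -> frob_norm (W - 1%:M) <= f ->
  0 <= a -> a <= 1 / 40 -> 0 <= b -> b <= 1 / 400 ->
  mx_inner G G - n%:R <= 2 * (20 * a) ^+ 2 + 2 * (200 * b) ^+ 2 + 200 * (b * f).
Proof.
move=> dG hW; have sV : (invmx W)^T = invmx W := near_id_inv_sym hW.
have D0 := distortion_ge0 dG.
have K_le := distortion_frob dG.
have N_le := distortion_conj dG (near_id_inv_op_le hW) sV.
have V_le := near_id_inv_frob hW.
rewrite (distortion_tr G) (excess_tr G sV) /excess.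
rewrite -/(excess G (invmx W)) in N_le *.
have N0 := frob_norm_ge0 (excess G (invmx W)).
have W0 := frob_norm_ge0 (W - 1%:M).
move: (mx_inner (G *m G^T - 1%:M) (invmx W)) (mx_inner (excess _ _) WY)
  (frob_norm (G *m G^T - 1%:M)) (frob_norm (excess _ _)) (frob_norm (W - 1%:M))
  (frob_norm (invmx W - 1%:M)) D0 K_le N_le V_le N0 W0.
move: (mx_inner G G - n%:R) => D t x k N w v D0 K_le N_le V_le N0 W0.
move=> hK hN x0 Wf a0 a1 b0 b1.
have s0 : 0 <= Num.sqrt D := sqrtr_ge0 _.
have sD : D = Num.sqrt D ^+ 2 by rewrite sqr_sqrtr.
move: (Num.sqrt D) s0 sD K_le N_le => s s0 sD K_le N_le.
have {}N_le : N <= 4 * f + 4 * s + 2 * D by lra.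
have t_le : t <= 5 * (N * b).
  have [h|h] := leP 0 t; first by have := hN h; lra.
  have : 0 <= N * b by rewrite mulr_ge0.
  lra.
have Ka : k * a <= (2 * s + D) * a by rewrite ler_wpM2r.
have Nb : N * b <= (4 * f + 4 * s + 2 * D) * b by rewrite ler_wpM2r.
have Da : D * a <= D * (1 / 40) by rewrite ler_wpM2l.
have Db : D * b <= D * (1 / 400) by rewrite ler_wpM2l.
(* The terms linear in [s] are absorbed into [s ^+ 2] by completing squares. *)
have qa : 0 <= (s / 4 - 20 * a) ^+ 2 := sqr_ge0 _.
have qb : 0 <= (s / 4 - 200 * b) ^+ 2 := sqr_ge0 _.
have main : D <= 5 * ((2 * s + D) * a) + 25 * ((4 * f + 4 * s + 2 * D) * b) by lra.
have ea : (s / 4 - 20 * a) ^+ 2 = D / 16 - 10 * (s * a) + (20 * a) ^+ 2.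
  by rewrite sD; field.
have eb : (s / 4 - 200 * b) ^+ 2 = D / 16 - 100 * (s * b) + (200 * b) ^+ 2.
  by rewrite sD; field.
rewrite ea in qa; rewrite eb in qb.
move: ((20 * a) ^+ 2) ((200 * b) ^+ 2) qa qb => A2 B2 qa qb; lra.
Qed.

End Score.

Section Permutations.
Context {R : realType} {d : nat}.
Implicit Types (p q : 'S_d) (A S W : 'M[R]_d).

Lemma perm_conjE p S : perm_conj p S = perm_mx p *m S *m (perm_mx p)^T.
Proof.
apply/matrixP => i j; rewrite mxE -row_permE tr_perm_mx -[p in LHS]invgK.
by rewrite -col_permE !mxE !invgK.
Qed.

Lemma perm_mxK p : (perm_mx p)^T *m perm_mx p = 1%:M :> 'M[R]_d.
Proof. by rewrite tr_perm_mx -perm_mxM mulVg perm_mx1. Qed.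

Lemma perm_mxKt p : perm_mx p *m (perm_mx p)^T = 1%:M :> 'M[R]_d.
Proof. by rewrite tr_perm_mx -perm_mxM mulgV perm_mx1. Qed.

(** In whitened coordinates, misplacing the labels by [p] instead of [q] acts as
    this matrix; it is orthogonal exactly when the two conjugates agree. *)
Definition mismatch A p q : 'M[R]_d :=
  invmx A *m (perm_mx p)^T *m perm_mx q *m A.

Lemma mismatch_det A p q : A \in unitmx -> \det (mismatch A p q) ^+ 2 = 1.
Proof.
move=> uA; rewrite /mismatch !det_mulmx det_tr !det_perm det_inv !exprMn.
rewrite -!exprM mulnC exprM sqrrN expr1n expr1n mulr1.
rewrite mulnC exprM sqrrN expr1n expr1n mulr1 -exprMn mulVr ?expr1n//.
Qed.

Lemma perm_conj_inv A W p : A \in unitmx -> W \in unitmx ->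
  invmx (perm_conj p (A *m W *m A^T)) =
  (perm_mx p *m (invmx A)^T) *m invmx W *m (perm_mx p *m (invmx A)^T)^T.
Proof.
move=> uA uW; set B := RHS.
have e : perm_conj p (A *m W *m A^T) *m B = 1%:M.
  rewrite perm_conjE /B !trmx_mul !trmxK -!mulmxA (mulmxA _^T (perm_mx p)) perm_mxK mul1mx.
  rewrite (mulmxA A^T) -trmx_mul mulVmx// trmx1 mul1mx (mulmxA W) mulmxV// mul1mx.
  by rewrite (mulmxA A) mulmxV// mul1mx perm_mxKt.
have [u _] := mulmx1_unit e.
by rewrite -[LHS]mulmx1 -e mulKmx.
Qed.

Lemma qmle_score A W WY p q : A \in unitmx -> W \in unitmx ->
  qmle_objective (A *m W *m A^T) (perm_mx q *m A *m WY *m (perm_mx q *m A)^T) p =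
  mx_inner ((mismatch A p q)^T *m invmx W *m mismatch A p q) WY.
Proof.
move=> uA uW; rewrite /qmle_objective perm_conj_inv//.
set U := perm_mx q *m A; set H := perm_mx p *m (invmx A)^T.
have -> : mismatch A p q = H^T *m U.
  by rewrite /H /U /mismatch trmx_mul trmxK !mulmxA.
rewrite mx_innerMl trmxK mx_innerMr mx_innerC; congr mx_inner.
by rewrite (trmx_mul H^T U) trmxK !mulmxA.
Qed.

Lemma mismatch_id A p : A \in unitmx -> mismatch A p p = 1%:M.
Proof. by move=> uA; rewrite /mismatch -(mulmxA _ _^T) perm_mxK mulmx1 mulVmx. Qed.

Lemma qmle_excess A W WY p q : A \in unitmx -> W \in unitmx ->
  is_qmle (A *m W *m A^T) (perm_mx q *m A *m WY *m (perm_mx q *m A)^T) p ->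
  mx_inner (excess (mismatch A p q) (invmx W)) WY <= 0.
Proof.
move=> uA uW /(_ q); rewrite !qmle_score// mismatch_id// trmx1 mul1mx mulmx1.
by rewrite -subr_le0 -mx_innerBl.
Qed.

Lemma op_le_perm p : op_le 1 (perm_mx p : 'M[R]_d).
Proof. by apply: op_le_orth; exact: perm_mxK. Qed.

Lemma op_le_permT p : op_le 1 ((perm_mx p)^T : 'M[R]_d).
Proof. by apply: op_le_orth; rewrite trmxK perm_mxKt. Qed.

Lemma perm_conj_loss A p q : A \in unitmx -> op_le 1 A ->
  frob_norm (perm_conj p (A *m A^T) - perm_conj q (A *m A^T)) ^+ 2 <=
  4 * (mx_inner (mismatch A p q) (mismatch A p q) - d%:R).
Proof.
move=> uA oA; set G := mismatch A p q; set D := mx_inner G G - _; have dG : \det G ^+ 2 = 1 by exact: mismatch_det.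
have AG : A *m G = (perm_mx p)^T *m perm_mx q *m A.
  by rewrite /G /mismatch -!mulmxA mulKVmx.
have oAG : op_le 1 (A *m G).
  rewrite AG -(mul1r 1); apply: op_leM => //; rewrite -(mul1r 1).
  by apply: op_leM; [exact: op_le_permT|exact: op_le_perm].
have h := distortion_loss dG oA oAG.
set M := A *m (G *m G^T - 1%:M) *m A^T in h.
have E : perm_conj p (A *m A^T) - perm_conj q (A *m A^T) =
    perm_mx p *m (- M) *m (perm_mx p)^T.
  have -> : M = (A *m G) *m (A *m G)^T - A *m A^T.
    by rewrite /M mulmxBr mulmx1 mulmxBl (trmx_mul A G) !mulmxA.
  rewrite opprB mulmxBr mulmxBl !perm_conjE; congr (_ - _).
  rewrite AG !trmx_mul trmxK -!mulmxA (mulmxA (perm_mx p)) perm_mxKt mul1mx.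
  by rewrite mulmx1.
have le1 : frob_norm (perm_conj p (A *m A^T) - perm_conj q (A *m A^T)) <= 2 * Num.sqrt D.
  rewrite E; apply: le_trans (frob_norm_mulmxr _ ler01 (op_le_permT p)) _.
  rewrite mul1r; apply: le_trans (frob_norm_mulmxl _ ler01 (op_le_perm p)) _.
  by rewrite mul1r frob_normN.
have D0 : 0 <= D := distortion_ge0 dG.
have -> : 4 * D = (2 * Num.sqrt D) ^+ 2 by rewrite exprMn sqr_sqrtr//; ring.
by rewrite lerXn2r ?nnegrE ?frob_norm_ge0 ?mulr_ge0 ?sqrtr_ge0.
Qed.

Lemma op_norm_op_le S : op_norm S <= 1 -> op_le 1 S.
Proof.
move=> S1 x; rewrite expr1n mul1r.
have [x0|xn] := eqVneq (mx_inner x x) 0.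
  by rewrite (mx_inner_eq0 x0) mulmx0.
have xp : 0 < mx_inner x x by rewrite lt0r xn mx_inner_ge0.
have fp : 0 < frob_norm x by rewrite sqrtr_gt0.
pose e := (frob_norm x)^-1 *: x.
have e1 : frob_norm e = 1.
  by rewrite frob_normZ ger0_norm ?invr_ge0 ?(ltW fp)// mulVf// gt_eqF.
have : frob_norm (S *m e) <= op_norm S.
  apply: ub_le_sup; last by exists e => //=; rewrite e1.
  exists (frob_norm S) => _ [y /= y1 <-].
  apply: le_trans (frob_norm_mulmxl y (frob_norm_ge0 S) (op_le_frob S)) _.
  by rewrite ler_piMr ?frob_norm_ge0.
move=> /le_trans /(_ S1); rewrite /e -scalemxAr frob_normZ ger0_norm ?invr_ge0 ?(ltW fp)//.
rewrite mulrC ler_pdivrMr// mul1r => h.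
by rewrite -!frob_norm_sqr lerXn2r ?nnegrE ?frob_norm_ge0.
Qed.

(** [|A^T x|^2 = <x, S x> <= |x|^2]. *)
Lemma op_le_factor A S : A *m A^T = S -> op_le 1 S -> op_le 1 A.
Proof.
move=> AS oS; rewrite -[A]trmxK; apply: op_leT => // x.
rewrite expr1n mul1r mx_innerMr trmxK mulmxA AS.
apply: le_trans (mx_inner_le _ _) _; rewrite -frob_norm_sqr expr2 ler_wpM2l ?frob_norm_ge0//.
apply: frob_norm_le; first exact: frob_norm_ge0.
by rewrite frob_norm_sqr; have := oS x; rewrite expr1n mul1r.
Qed.

Lemma posdef_factor_unit A S : A *m A^T = S -> posdef S -> A \in unitmx.
Proof.
move=> AS [_ pS]; rewrite -row_free_unit -kermx_eq0; apply/eqP/row_matrixP => i.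
set v := row i _; rewrite row0; apply/eqP; apply: contraT => vn.
have vA : v *m A = 0 by apply/sub_kermxP; exact: row_sub.
have := pS v^T; rewrite trmxK -AS mulmxA vA !mul0mx mxE ltxx; apply.
by apply: contra vn => /eqP h; rewrite -[v]trmxK h trmx0.
Qed.

End Permutations.

(** * Union over the labellings *)

Lemma measurable_frob_norm disp (T : measurableType disp) (R : realType) m n
    (f : T -> 'M[R]_(m, n)) :
  measurable_fun setT f -> measurable_fun setT (fun t => frob_norm (f t)).
Proof.
move=> mf; have msq : measurable_fun setT (@Num.sqrt R).
  by apply: continuous_measurable_fun; exact: sqrt_continuous.
apply: (measurableT_comp msq (_ : measurable_fun setT (fun t => mx_inner (f t) (f t)))).
exact: measurable_mx_inner.
Qed.

Lemma measurable_mxtrace disp (T : measurableType disp) (R : realType) n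
    (f : T -> 'M[R]_n) :
  measurable_fun setT f -> measurable_fun setT (fun t => \tr (f t)).
Proof.
by move=> mf; apply: measurable_sum => i; exact: measurable_mx_entry.
Qed.

Section Failure.
Context {R : realType} {d' m n : nat}.
Local Notation d := d'.+1.
Hypothesis m0 : (0 < m)%N.
Hypothesis n0 : (0 < n)%N.
Variables (mu : probability 'M[R]_(d, m) R) (nu : probability 'M[R]_(d, n) R).
Hypothesis gmu : gaussian_law mu.
Hypothesis gnu : gaussian_law nu.

Definition cov1 (Z : 'M[R]_(d, m + n)) : 'M[R]_d := wishart (lsubmx Z).
Definition cov2 (Z : 'M[R]_(d, m + n)) : 'M[R]_d := wishart (rsubmx Z).

Definition deviates (N W : 'M[R]_d) (r : R) : Prop :=
  mx_inner N W < 1 / 5 * \tr N - frob_norm N * r.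

(** A nonnegative trace is what [wishart_lower_linear] asks for; a negative one
    satisfies at once the upper bound sought on the trace. *)
Definition fail_cross (G : 'M[R]_d) (b : R) : set 'M[R]_(d, m + n) :=
  [set Z | [/\ good (lsubmx Z), 0 <= \tr (excess G (adjinv (cov1 Z))) &
           deviates (excess G (adjinv (cov1 Z))) (cov2 Z) b]].

Lemma measurable_cov1 : measurable_fun setT cov1.
Proof. exact: (measurableT_comp (@measurable_wishart R d' m) (@measurable_lsub R d m n)). Qed.

Lemma measurable_cov2 : measurable_fun setT cov2.
Proof. exact: (measurableT_comp (@measurable_wishart R d' n) (@measurable_rsub R d m n)). Qed.

Lemma measurable_excess G : measurable_fun setT (fun Z => excess G (adjinv (cov1 Z))).
Proof.
have mV : measurable_fun setT (fun Z => adjinv (cov1 Z)).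
  by apply: measurable_adjinv; exact: measurable_cov1.
have mG (H : 'M[R]_d) : measurable_fun setT (fun _ : 'M[R]_(d, m + n) => H).
  exact: measurable_cst.
rewrite (_ : (fun Z => _) = fun Z =>
    G^T *m adjinv (cov1 Z) *m G + (-1) *: adjinv (cov1 Z)).
  apply: measurable_addmx; last exact: measurable_scalemx.
  by apply: measurable_mulmx => //; exact: measurable_mulmx.
by apply/funext => Z; rewrite scaleN1r.
Qed.

Lemma measurable_deviates disp (T : measurableType disp) (N W : T -> 'M[R]_d) r :
  measurable_fun setT N -> measurable_fun setT W ->
  measurable [set t | deviates (N t) (W t) r].
Proof.
move=> mN mW; apply: measurable_lt_set; first exact: measurable_mx_inner.
apply: measurable_funB; apply: measurable_funM => //.
  exact: measurable_mxtrace.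
exact: measurable_frob_norm.
Qed.

Lemma measurable_fail_cross G b : measurable (fail_cross G b).
Proof.
rewrite (_ : fail_cross G b = (@lsubmx R d m n @^-1` good) `&`
   ([set Z | 0 <= \tr (excess G (adjinv (cov1 Z)))] `&`
    [set Z | deviates (excess G (adjinv (cov1 Z))) (cov2 Z) b])); last first.
  by apply/seteqP; split => Z /= [] // ? [].
apply: measurableI; last apply: measurableI.
- rewrite -[X in measurable X]setTI; apply: measurable_lsub => //.
  exact: measurable_good.
- apply: measurable_le_set => //; apply: measurable_mxtrace.
  exact: measurable_excess.
- by apply: measurable_deviates; [exact: measurable_excess|exact: measurable_cov2].
Qed.

Variable g y : R.
Hypothesis y0 : 0 < y.
Hypothesis mu_good : (mu (~` good) <= g%:E)%E.
Hypothesis nu_good : (nu (~` good) <= g%:E)%E.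

Definition fail_bound : R := (2 ^ d * d)%:R * (3 * g + 2 * expR (- y)) + g.

Let fail_bound_le (p : \bar R) : (p <= g%:E)%E ->
  ((2 ^ d * d)%:R%:E * (3%:E * p + (2 * expR (- y))%:E) + p <= fail_bound%:E)%E.
Proof.
move=> pg; have -> : fail_bound%:E =
  ((2 ^ d * d)%:R%:E * (3%:E * g%:E + (2 * expR (- y))%:E) + g%:E)%E by [].
apply: leeD => //; apply: lee_wpmul2l => //.
by apply: leeD => //; apply: lee_wpmul2l.
Qed.

Lemma fail_inverse_le (G : 'M[R]_d) : \det G ^+ 2 = 1 ->
  (mu [set x | deviates (G *m G^T - 1%:M) (adjinv (wishart x)) (Num.sqrt (768 * y / m%:R))]
   <= fail_bound%:E)%E.
Proof.
move=> dG; apply: le_trans (fail_bound_le mu_good).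
apply: wishart_lower_inverse => //.
- exact: measurable_good.
- by move=> Z; exact: good_near_id.
- by rewrite linearB /= trmx1 trmx_mul trmxK.
- by rewrite distortion_tr; exact: distortion_ge0.
Qed.

(** The first sample fixes the matrix [excess], so the deviation of the second
    sample can be integrated over the first. *)
Lemma fail_cross_le (G : 'M[R]_d) :
  (joint_law mu nu (fail_cross G (Num.sqrt (768 * y / n%:R))) <= fail_bound%:E)%E.
Proof.
set b := Num.sqrt _; have mE := measurable_fail_cross G b.
rewrite -[X in joint_law mu nu X]setIT -integral_indic//.
have mI : measurable_fun setT (fun Z => (\1_(fail_cross G b) Z)%:E : \bar R).
  by apply/measurable_EFinP; exact: measurable_indic.
rewrite (integral_joint_law mu nu mI); last by move=> Z; rewrite lee_fin.
have b0 : (0 <= fail_bound%:E)%E.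
  by apply: le_trans (fail_bound_le nu_good); rewrite adde_ge0// mule_ge0// adde_ge0// mule_ge0.
have sec x : (\int[nu]_z (\1_(fail_cross G b) (row_mx x z))%:E <= fail_bound%:E)%E.
  have ms : measurable ((fun z : 'M[R]_(d, n) => row_mx x z) @^-1` fail_cross G b).
    rewrite -[X in measurable X]setTI.
    have mr : measurable_fun setT (fun z : 'M[R]_(d, n) => row_mx x z).
      apply: measurable_fun_matrixP => i j; under eq_fun do rewrite mxE.
      by case: (fintype.split j) => k; [exact: measurable_cst|exact: measurable_entry].
    exact: mr.
  rewrite (_ : (fun z => _) = fun z =>
     (\1_((fun z : 'M[R]_(d, n) => row_mx x z) @^-1` fail_cross G b) z)%:E) //.
  rewrite integral_indic// setIT.
  pose N := excess G (adjinv (wishart x)).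
  have [[gx trN]|h] := pselect (good x /\ 0 <= \tr N); last first.
    rewrite (_ : _ @^-1` _ = set0) ?measure0//.
    apply/seteqP; split => // z; rewrite /fail_cross /cov1 /= row_mxKl => -[h1 h2 _].
    exact: h.
  have hW : near_id (1 / 6) (wishart x) by exact: good_near_id.
  have hW2 : near_id (1 / 2) (wishart x) by apply: near_id_weaken hW; lra.
  have sN : N^T = N.
    apply: excess_sym; rewrite adjinvE; first exact: near_id_inv_sym.
    exact: near_id_unitmx.
  have := wishart_lower_linear n0 gnu measurable_good (@good_near_id R d' n) sN trN y0.
  move=> H; apply: le_trans (fail_bound_le nu_good); apply: le_trans H.
  apply: le_measure; rewrite ?inE//.
    apply: (@measurable_deviates _ _ (fun=> N) (fun z => wishart z)) => //.
    exact: measurable_wishart.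
  by move=> z; rewrite /fail_cross /cov1 /cov2 /= row_mxKl row_mxKr => -[].
apply: (@le_trans _ _ (\int[mu]_x (fail_bound%:E))%E).
  apply: ge0_le_integral => //.
  - by move=> x _; apply: integral_ge0 => z _; rewrite lee_fin.
  - have mj : measurable_fun setT ((fun Z => (\1_(fail_cross G b) Z)%:E : \bar R) \o @join_samples R d m n).
      by apply: measurableT_comp => //; exact: measurable_join_samples.
    have j0 z : (0 <= ((fun Z => (\1_(fail_cross G b) Z)%:E : \bar R) \o @join_samples R d m n) z)%E.
      by rewrite lee_fin.
    exact: (@measurable_fun_fubini_tonelli_F _ _ _ _ R nu _ mj j0).
rewrite (integral_cst mu measurableT (fail_bound%:E)).
rewrite -[leRHS]mule1; apply: lee_wpmul2l => //.
exact: (probability_le1 mu measurableT).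
Qed.

Variables (A : 'M[R]_d) (q : 'S_d) (u : R).
Hypothesis uA : A \in unitmx.
Hypothesis u0 : 0 < u.
Hypothesis um : 16 * u <= m%:R.

Definition failure (i : bool + ('S_d + 'S_d)) : set 'M[R]_(d, m + n) :=
  match i with
  | inl true => [set Z | ~ good (lsubmx Z)]
  | inl false => [set Z | 24 * d%:R * u / m%:R < frob_norm (cov1 Z - 1%:M) ^+ 2]
  | inr (inl p) => let G := mismatch A p q in
      [set Z | deviates (G *m G^T - 1%:M) (adjinv (cov1 Z)) (Num.sqrt (768 * y / m%:R))]
  | inr (inr p) => fail_cross (mismatch A p q) (Num.sqrt (768 * y / n%:R))
  end.

Lemma measurable_failure i : measurable (failure i).
Proof.
case: i => [[]|[p|p]] /=; last exact: measurable_fail_cross.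
- rewrite (_ : [set Z | _] = @lsubmx R d m n @^-1` (~` good))//.
  rewrite -[X in measurable X]setTI; apply: measurable_lsub => //.
  by apply: measurableC; exact: measurable_good.
- apply: measurable_lt_set => //; apply: measurable_funX.
  apply: measurable_frob_norm; apply: measurable_addmx; last exact: measurable_cst.
  exact: measurable_cov1.
- apply: measurable_deviates; first exact: measurable_cst.
  by apply: measurable_adjinv; exact: measurable_cov1.
Qed.

Definition failures := \bigcup_(i in [set: bool + ('S_d + 'S_d)]) failure i.

Lemma measurable_failures : measurable failures.
Proof.
apply: fin_bigcup_measurable => [|i _]; last exact: measurable_failure.
exact: finite_finset.
Qed.

Lemma failures_le : (joint_law mu nu failures <=
  (g + 3 * d%:R * expR (d%:R - u) + 2 * (d`!)%:R * fail_bound)%:E)%E.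
Proof.
have cover Z : failures Z -> exists i, failure i Z by move=> [i _ h]; exists i.
apply: (le_trans (@probability_union_le _ _ _ (joint_law mu nu) _ _ _
  measurable_failures measurable_failure cover)).
pose bd (i : bool + ('S_d + 'S_d)) : R := match i with
  | inl true => g | inl false => 3 * d%:R * expR (d%:R - u) | inr _ => fail_bound end.
apply: (@le_trans _ _ (\sum_i (bd i)%:E)%E).
  apply: lee_sum => -[[]|[p|p]] _ /=.
  - apply: le_trans mu_good.
    rewrite -(joint_law_fst mu nu (measurableC measurable_good)) le_eqVlt.
    by apply/orP; left; apply/eqP.
  - apply: le_trans (frob_wishart_tail gmu m0 u0 um).
    rewrite -(joint_law_fst mu nu) ?le_eqVlt; last first.
      apply: measurable_lt_set => //; apply: measurable_funX.
      apply: measurable_frob_norm; apply: measurable_addmx; last exact: measurable_cst.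
      exact: measurable_wishart.
    by apply/orP; left; apply/eqP.
  - apply: le_trans (fail_inverse_le (mismatch_det p q uA)).
    rewrite -(joint_law_fst mu nu) ?le_eqVlt; last first.
      apply: measurable_deviates; first exact: measurable_cst.
      by apply: measurable_adjinv; exact: measurable_wishart.
    by apply/orP; left; apply/eqP.
  - exact: fail_cross_le.
rewrite sumEFin lee_fin !big_sumType /= big_bool /= !sumr_const.
have -> : #|{: 'S_d}| = d`! by rewrite card_Sn.
rewrite -[fail_bound *+ _]mulr_natl le_eqVlt; apply/orP; left; apply/eqP.
by ring.
Qed.

End Failure.

(** * Numerical budget *)

Section Budget.
Context {R : realType}.
Variables (d : nat) (L : R).
Hypothesis d2 : (2 <= d)%N.
Hypothesis L0 : 0 <= L.

Let E : R := (d ^ d)%:R.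

Let t : R := d%:R * ln d%:R.

Let dr2 : 2 <= d%:R :> R.
Proof. by rewrite ler_nat. Qed.

Lemma expR_dlnd : expR (d%:R * ln d%:R) = (d ^ d)%:R :> R.
Proof. by rewrite expRM_natl lnK ?natrX// posrE; apply: lt_le_trans dr2. Qed.

Let E4 : 4 <= E.
Proof.
rewrite /E ler_nat; apply: (@leq_trans (2 ^ d)); first by rewrite (@leq_exp2l 2 2).
by rewrite leq_exp2r//; apply: leq_trans d2.
Qed.

Lemma fact_le_expn k : (k`! <= k ^ k)%N.
Proof.
elim: k => // k IH; rewrite factS expnS leq_mul2l /=; apply: leq_trans IH _.
by case: k => // k; rewrite leq_exp2r.
Qed.

Let expy : expR (- (8 * (t + L))) * E ^+ 8 = expR (- (8 * L)).
Proof.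
rewrite /E -expR_dlnd -/t -expRM_natl -expRD; congr expR; ring.
Qed.

Let expL (c : R) : 1 <= c -> expR (- (c * L)) <= expR (- L).
Proof. by move=> c1; rewrite ler_expR lerN2 ler_peMl. Qed.

(** [(8 * d ^ 2).+1 <= d ^ 6] and [2 <= d ^ d], so the size of the grid costs
    [expR (7 * t)]. *)
Lemma good_budget (m : nat) : 15 * (t + L) <= m%:R / 6400 ->
  ((8 * d ^ 2).+1 ^ d)%:R * (2 * expR (- (m%:R / 6400))) <= expR (- (8 * (t + L))).
Proof.
move=> hm.
have g1 : ((8 * d ^ 2).+1 ^ d)%:R <= E ^+ 6.
  rewrite /E -natrX ler_nat -expnM (mulnC d 6) expnM leq_exp2r; last by apply: leq_trans d2.
  have d4 : (16 <= d ^ 4)%N by rewrite (@leq_exp2r 2 d 4).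
  apply: (@leq_trans (16 * d ^ 2)); last by rewrite (expnD d 4 2) leq_mul2r d4 orbT.
  have : (4 <= d ^ 2)%N by rewrite (@leq_exp2r 2 d 2).
  move: (d ^ 2)%N => k k4; rewrite (_ : 16 = 8 + 8)%N// mulnDl.
  by rewrite -addn1 leq_add2l muln_gt0; apply: leq_trans k4.
have e0 := expR_ge0 (- (m%:R / 6400) : R).
have h : expR (- (m%:R / 6400)) * E ^+ 7 <= expR (- (8 * (t + L))).
  rewrite /E -expR_dlnd -/t -expRM_natl -expRD ler_expR; have l0 := L0; lra.
apply: le_trans h; move: (expR _) e0 g1 => e e0 g1.
have -> : e * E ^+ 7 = E * (E ^+ 6 * e) by rewrite exprS; ring.
rewrite mulrCA ler_pM ?mulr_ge0 ?ler_wpM2r//.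
by apply: le_trans E4; rewrite ler_nat.
Qed.

(** [d!], [2 ^ d] and [d] are all at most [d ^ d = expR t], and the confidence
    level [8 * (t + L)] absorbs their product; in the Frobenius term the level
    [6 * (d + L)] absorbs [d * expR d]. *)
Lemma failure_budget :
  expR (- (8 * (t + L))) + 3 * d%:R * expR (d%:R - 6 * (d%:R + L)) +
  2 * (d`!)%:R * @fail_bound R d.-1 (expR (- (8 * (t + L)))) (8 * (t + L)) <= expR (- L).
Proof.
have l0 := L0; have dr := dr2; have e4 := E4; rewrite /fail_bound prednK; last by apply: leq_trans d2.
set q := expR (- (8 * (t + L))).
have q0 : 0 <= q := expR_ge0 _.
have qE : q * E ^+ 8 <= expR (- L) by rewrite expy expL//; lra.
have D0 : 0 <= expR (- L) := expR_ge0 _.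
have F0 : 0 <= (d`!)%:R :> R by [].
have FE : (d`!)%:R <= E by rewrite /E ler_nat fact_le_expn.
have QE : (2 ^ d)%:R <= E.
  by rewrite /E ler_nat leq_exp2r//; apply: leq_trans d2.
have dE : d%:R <= E.
  by rewrite /E ler_nat -[leqLHS]expn1 leq_pexp2l//; apply: leq_trans d2.
have E0 : 0 <= E by apply: le_trans E4.
have QdE : (2 ^ d * d)%:R <= E ^+ 2 by rewrite natrM expr2 ler_pM.
have E16 : 16 <= E ^+ 2.
  have -> : 16 = 4 ^+ 2 :> R by rewrite expr2; ring.
  by rewrite lerXn2r ?nnegrE.
have E64 : 64 <= E ^+ 3.
  have -> : 64 = 4 ^+ 3 :> R by rewrite !exprS; ring.
  by rewrite lerXn2r ?nnegrE.
have t3 : 2 * (d`!)%:R * ((2 ^ d * d)%:R * (3 * q + 2 * q) + q) <= expR (- L) / 64.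
  apply: (@le_trans _ _ (2 * E * (6 * E ^+ 2 * q))).
    apply: ler_pM.
    - by rewrite mulr_ge0.
    - by rewrite addr_ge0// mulr_ge0// addr_ge0// mulr_ge0.
    - by rewrite ler_wpM2l.
    have h1 : (2 ^ d * d)%:R * q <= E ^+ 2 * q by rewrite ler_wpM2r.
    have h2 : 16 * q <= E ^+ 2 * q by rewrite ler_wpM2r.
    lra.
  rewrite ler_pdivlMr//; apply: le_trans qE.
  have -> : q * E ^+ 8 = (q * E ^+ 3) * (E ^+ 2 * E ^+ 3) by ring.
  have -> : 2 * E * (6 * E ^+ 2 * q) * 64 = (q * E ^+ 3) * (12 * 64) by ring.
  rewrite ler_wpM2l ?mulr_ge0 ?exprn_ge0//.
  by apply: ler_pM => //; apply: le_trans E16; lra.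
have t1 : q <= expR (- L) / 4.
  rewrite ler_pdivlMr//; apply: le_trans qE; rewrite ler_wpM2l//.
  have -> : E ^+ 8 = E ^+ 2 * E ^+ 6 by ring.
  apply: le_trans (_ : 16 * 1 <= _); first by lra.
  by apply: ler_pM => //; rewrite exprn_ege1//; apply: le_trans E4; lra.
have t2 : 3 * d%:R * expR (d%:R - 6 * (d%:R + L)) <= expR (- L) / 3.
  have e5 : 9 * d%:R <= expR (d%:R + 4 * d%:R) :> R.
    rewrite expRD; have h1 := expR_ge1Dx (d%:R : R); have h2 := expR_ge1Dx (4 * d%:R : R).
    apply: le_trans (_ : d%:R * 9 <= _); first by lra.
    by apply: ler_pM => //; lra.
  pose w : R := d%:R + 4 * d%:R.
  have h6 : expR (- (6 * L)) <= expR (- L) by apply: expL; lra.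
  have w0 : 0 < expR w := expR_gt0 _.
  rewrite (_ : d%:R - 6 * (d%:R + L) = - w + - (6 * L)); last by rewrite /w; ring.
  have h7 : 9 * d%:R * expR (- w) <= 1 by rewrite expRN ler_pdivrMr// mul1r.
  rewrite expRD ler_pdivlMr//; apply: le_trans h6.
  move: (expR (- w)) h7 (expR (- (6 * L))) (expR_ge0 (- (6 * L))) => a h7 c c0.
  have : 9 * d%:R * a * c <= 1 * c by rewrite ler_wpM2r.
  lra.
lra.
Qed.

End Budget.

(** * The rate *)

Section Rate.
Context {R : realType}.
Implicit Types (d l m n t : R).

Lemma sqrt_le_of_sample k t m : 0 < k -> 0 < m -> 768 * 8 * k ^+ 2 * t <= m ->
  Num.sqrt (768 * (8 * t) / m) <= 1 / k.
Proof.
move=> k0 m0 h; have k1 : 0 <= 1 / k by rewrite divr_ge0// ltW.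
rewrite -[leRHS](ger0_norm k1) -sqrtr_sqr ler_wsqrtr// ler_pdivrMr//.
have kn : k != 0 by rewrite gt_eqF.
rewrite (_ : (1 / k) ^+ 2 * m = m / k ^+ 2); last by field.
rewrite ler_pdivlMr ?exprn_gt0//.
by apply: le_trans h; rewrite le_eqVlt; apply/orP; left; apply/eqP; ring.
Qed.

Lemma ln_ge_half (x : R) : 2 <= x -> 1 / 2 <= ln x.
Proof.
move=> x2; have h : ln (1 + (- (1 / 2)) : R) <= - (1 / 2) by apply: le_ln1Dx; lra.
have e : 1 + (- (1 / 2)) = 2^-1 :> R by field.
rewrite e lnV ?posrE// in h; apply: (@le_trans _ _ (ln 2)); first lra.
by rewrite ler_ln// posrE; lra.
Qed.

(** The first summand comes from the quadratic terms of [distortion_bound], the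
    second from its cross term. *)
Definition rate_const : R := 8 * (20 ^+ 2 + 200 ^+ 2) * (768 * 8) + 800 * 1000.

Lemma rate_bound d l m n mn t : 0 < m -> 0 < n -> 0 < mn -> mn <= m -> mn <= n ->
  0 <= d -> 0 <= l -> 0 <= t ->
  4 * (2 * (20 * Num.sqrt (768 * (8 * t) / m)) ^+ 2 +
       2 * (200 * Num.sqrt (768 * (8 * t) / n)) ^+ 2 +
       200 * (Num.sqrt (768 * (8 * t) / n) * Num.sqrt (24 * d * (6 * l) / m))) <=
  rate_const * (t / mn + Num.sqrt (d * t * l / (m * n))).
Proof.
move=> m0 n0 mn0 hm hn d0 l0 t0.
set a := Num.sqrt (_ / m); set b := Num.sqrt (_ / n); set f := Num.sqrt (_ / m).
have at0 : 0 <= 768 * (8 * t) by rewrite mulr_ge0 ?ler0n ?mulr_ge0 ?ler0n.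
have a2 : a ^+ 2 = 768 * 8 * (t / m).
  by rewrite sqr_sqrtr; [ring|exact: divr_ge0 at0 (ltW _)].
have b2 : b ^+ 2 = 768 * 8 * (t / n).
  by rewrite sqr_sqrtr; [ring|exact: divr_ge0 at0 (ltW _)].
have tm : t / m <= t / mn by rewrite ler_wpM2l// lef_pV2.
have tn : t / n <= t / mn by rewrite ler_wpM2l// lef_pV2.
have x0 : 0 <= d * t * l / (m * n).
  by rewrite divr_ge0 ?mulr_ge0// ltW.
have bf : b * f <= 1000 * Num.sqrt (d * t * l / (m * n)).
  rewrite -sqrtrM; last exact: divr_ge0 at0 (ltW n0).
  rewrite -(@ger0_norm _ (1000 : R)) ?ler0n// -sqrtr_sqr -sqrtrM ?sqr_ge0//.
  rewrite ler_wsqrtr//.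
  rewrite (_ : 768 * _ / n * _ = (768 * 8 * 24 * 6) * (d * t * l / (m * n))).
    by apply: ler_wpM2r => //; lra.
  by field; rewrite !gt_eqF.
have t1 : 0 <= t / mn by rewrite divr_ge0// ltW.
have s0 : 0 <= Num.sqrt (d * t * l / (m * n)) := sqrtr_ge0 _.
rewrite !exprMn a2 b2 /rate_const; move: (Num.sqrt _) (t / mn) (t / m) (t / n) (b * f) tm tn bf t1 s0.
move=> s x xm xn z tm tn bf t1 s0.
have c1 : 0 <= (20 ^+ 2 + 200 ^+ 2) * (768 * 8) :> R by lra.
have := mulr_ge0 c1 s0.
lra.
Qed.

End Rate.

Theorem theorem2 (R : realType) :
  exists c0 C : R, 0 < c0 /\ 0 < C /\
  forall (d m n : nat) (delta : R),
    (0 < d)%N -> (0 < m)%N -> (0 < n)%N -> 0 < delta -> delta < 1 ->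
    c0 * (d%:R * ln d%:R + ln (1 / delta)) <= (minn m n)%:R ->
    c0 * d%:R * (d%:R * ln d%:R + ln (1 / delta)) * (d%:R + ln (1 / delta))
      <= m%:R * n%:R ->
  forall (pstar : 'S_d) (Sigma : 'M[R]_d),
    posdef Sigma -> op_norm Sigma <= 1 ->
  forall (disp : measure_display) (T : measurableType disp)
    (P : probability T R)
    (X : 'I_m -> {RV P >-> d.-tuple R}) (Y : 'I_n -> {RV P >-> d.-tuple R}),
    covariance_alignment_model Sigma pstar X Y ->
  forall pihat : T -> 'S_d,
    (forall w : T, sample_cov X w \in unitmx ->
       is_qmle (sample_cov X w) (sample_cov Y w) (pihat w)) ->
    with_prob_ge P (1 - delta)
      [set w | frob_norm (perm_conj (pihat w) Sigma - perm_conj pstar Sigma) ^+ 2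
         <= C * ((d%:R * ln d%:R + ln (1 / delta)) / (minn m n)%:R
              + Num.sqrt (d%:R * (d%:R * ln d%:R + ln (1 / delta))
                            * (d%:R + ln (1 / delta)) / (m%:R * n%:R)))].
Proof.
exists (768 * 8 * 400 ^+ 2), rate_const.
have C0 : 0 < rate_const :> R by rewrite /rate_const; lra.
split; first by lra.
split; first exact: C0.
move=> d m n delta d0 m0 n0 delta0 delta1 hmn _ pstar Sigma pS S1.
move=> disp T P X Y [XYind gX gY] pihat hq.
set L := ln (1 / delta) in hmn *.
have L0 : 0 < L by rewrite ln_gt0// ltr_pdivlMr// mul1r.
have eL : expR (- L) = delta.
  by rewrite /L div1r lnV ?posrE// opprK lnK// posrE.
case: d d0 => // -[|d'] _ in pstar Sigma pS S1 X Y XYind gX gY pihat hq hmn *.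
  (* With one coordinate there is only the identity permutation. *)
  exists setT => //; split; last by rewrite probability_setT lee_fin gerBl ltW.
  move=> w _ /=; rewrite (_ : pihat w = pstar); last by apply/permP => i; rewrite !ord1.
  rewrite subrr frob_norm_sqr /mx_inner mul0mx mxtrace0.
  apply: mulr_ge0 (ltW C0) _.
  by rewrite addr_ge0 ?sqrtr_ge0// divr_ge0// ln1 mulr0 add0r ltW.
set d := d'.+2 in pstar Sigma pS S1 X Y XYind gX gY pihat hq hmn *.
have dr2 : 2 <= d%:R :> R by rewrite ler_nat.
have lnd := ln_ge_half dr2.
have dlnd : d%:R <= 2 * (d%:R * ln d%:R) :> R.
  have : d%:R * (1 / 2) <= d%:R * ln d%:R :> R by rewrite ler_wpM2l.
  lra.
set t := d%:R * ln d%:R + L in hmn *.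
have t0 : 0 < t by rewrite /t; lra.
have mp : 0 < m%:R :> R by rewrite ltr0n.
have np : 0 < n%:R :> R by rewrite ltr0n.
have mnp : 0 < (minn m n)%:R :> R by rewrite ltr0n leq_min m0.
have mnm : (minn m n)%:R <= m%:R :> R by rewrite ler_nat geq_minl.
have mnn : (minn m n)%:R <= n%:R :> R by rewrite ler_nat geq_minr.
have hm : 768 * 8 * 400 ^+ 2 * t <= m%:R by exact: le_trans mnm.
have hn : 768 * 8 * 400 ^+ 2 * t <= n%:R by exact: le_trans mnn.
have [A [Z [AA _ _ _]]] := gX (Ordinal m0).
have uA := posdef_factor_unit AA pS.
have oA := op_le_factor AA (op_norm_op_le S1).
pose B := perm_mx pstar *m A.
have uB : B \in unitmx by rewrite unitmx_mul unitmx_perm.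
have BB : B *m B^T = perm_conj pstar Sigma.
  by rewrite perm_conjE -AA /B trmx_mul !mulmxA.
have whiten_id (H : 'M[R]_d) : H \in unitmx -> invmx H *m (H *m H^T) *m (invmx H)^T = 1%:M.
  by move=> uH; rewrite mulKmx// -trmx_mul mulVmx// trmx1.
have WX : invmx A *m Sigma *m (invmx A)^T = 1%:M by rewrite -AA whiten_id.
have WY : invmx B *m perm_conj pstar Sigma *m (invmx B)^T = 1%:M by rewrite -BB whiten_id.
have [mu [nu [gmu gnu law]]] := whitened_samples_law XYind gX gY WX WY.
pose y := 8 * t; have y0 : 0 < y by rewrite mulr_gt0.
pose u := 6 * (d%:R + L); have u0 : 0 < u by rewrite /u; lra.
have um : 16 * u <= m%:R by rewrite /u /t in hm *; lra.
have good_le k (eta : probability 'M[R]_(d, k) R) : gaussian_law eta -> (0 < k)%N ->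
    768 * 8 * 400 ^+ 2 * t <= k%:R -> (eta (~` good) <= (expR (- y))%:E)%E.
  move=> geta k0 hk; apply: le_trans (good_fail_le geta k0) _.
  rewrite -EFinM lee_fin; apply: good_budget => //; first exact: ltW.
  rewrite -/t; lra.
have mu_good := good_le m mu gmu m0 hm.
have nu_good := good_le n nu gnu n0 hn.
have mF : measurable (failures y A pstar u : set 'M[R]_(d, m + n)) by exact: measurable_failures.
have Fle := failures_le m0 n0 gmu gnu y0 mu_good nu_good pstar uA u0 um.
have budget := @failure_budget R d L isT (ltW L0).
rewrite eL in budget.
pose S := whitened_samples X Y (invmx A) (invmx B).
have mSF : measurable (S @^-1` failures y A pstar u).
  rewrite -[X in measurable X]setTI.
  have mS := measurable_whitened_samples X Y (invmx A) (invmx B).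
  exact: (mS measurableT _ mF).
exists (~` (S @^-1` failures y A pstar u)); first exact: measurableC.
split; last first.
  rewrite probability_setC// EFinB; apply: leeB => //.
  by rewrite law//; apply: le_trans Fle _; rewrite lee_fin.
move=> w hw.
have nf i : ~ failure y A pstar u i (S w).
  by move=> h; apply: hw; exists i.
pose x := whiten (invmx A) X w; pose z := whiten (invmx B) Y w.
have c1 : cov1 (S w) = wishart x by rewrite /cov1 /S /whitened_samples row_mxKl.
have c2 : cov2 (S w) = wishart z by rewrite /cov2 /S /whitened_samples row_mxKr.
have gx : good x.
  have := nf (inl true); rewrite /= /S /whitened_samples row_mxKl => /contrapT.
  by [].
have hW : near_id (1 / 2) (wishart x).
  by apply: near_id_weaken (good_near_id gx); lra.
have uW := near_id_unitmx hW.
set p := pihat w; pose G := mismatch A p pstar.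
have dG : \det G ^+ 2 = 1 by exact: mismatch_det.
have covX := sample_cov_whiten X w uA.
have covY := sample_cov_whiten Y w uB.
have := hq w; rewrite covX covY -/x -/z !unitmx_mul uA uW unitmx_tr uA => /(_ isT) qm.
have N_le := qmle_excess uA uW qm.
pose f := Num.sqrt (24 * d%:R * (6 * (d%:R + L)) / m%:R).
have Wf : frob_norm (wishart x - 1%:M) <= f.
  have := nf (inl false); rewrite /= c1 => /negP; rewrite -leNgt => h.
  by rewrite -[leLHS]ger0_norm ?frob_norm_ge0// -sqrtr_sqr ler_wsqrtr.
have K_ge := nf (inr (inl p)); rewrite /= c1 adjinvE// /deviates in K_ge.
move/negP: K_ge; rewrite -leNgt => K_ge.
have N_ge : 0 <= \tr (excess G (invmx (wishart x))) ->
    1 / 5 * \tr (excess G (invmx (wishart x))) -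
    frob_norm (excess G (invmx (wishart x))) * Num.sqrt (768 * y / n%:R) <=
    mx_inner (excess G (invmx (wishart x))) (wishart z).
  move=> trN; rewrite leNgt; apply/negP => h.
  apply: (nf (inr (inr p))); rewrite /= /fail_cross /= c1 c2 adjinvE//; split=> //.
  by rewrite /S /whitened_samples row_mxKl.
have hm40 : 768 * 8 * 40 ^+ 2 * t <= m%:R by apply: le_trans hm; lra.
have k40 : 0 < 40 :> R by [].
have k400 : 0 < 400 :> R by [].
have Db := distortion_bound dG hW K_ge N_ge N_le Wf (sqrtr_ge0 _)
  (sqrt_le_of_sample k40 mp hm40) (sqrtr_ge0 _) (sqrt_le_of_sample k400 np hn).
rewrite /= -AA; apply: le_trans (perm_conj_loss p pstar uA oA) _.
have dl0 : 0 <= d%:R + L by lra.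
have d0 : 0 <= d%:R :> R by [].
apply: le_trans (rate_bound mp np mnp mnm mnn d0 dl0 (ltW t0)).
by rewrite ler_wpM2l.
Qed.
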